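(* Let $A$ be a UHF $C^*$-algebra and $\alpha$ a flow on $A$, and suppose that the flip automorphism $\sigma$ of $A\otimes A$ is $\alpha$-smoothly approximately inner. Then for each inverse temperature $c\in\mathbb R$ the set of $\alpha$-KMS states of $A$ at $c$ is a singleton (if it is not empty).
   Context: A flow on a unital $C^*$-algebra is a strongly continuous one-parameter group of *-automorphisms. The flip automorphism $\sigma$ of $A\otimes A$ is given by $\sigma(x\otimes y)=y\otimes x$ for $x,y\in A$. For a unitary $u$, $\mathrm{Ad}\,u(x)=uxu^*$. The flip $\sigma$ is called $\alpha$-smoothly approximately inner (more precisely, $\alpha\otimes\alpha$-smoothly approximately inner) if there is a sequence $(u_n)$ of unitaries in $A\otimes A$ such that $\sigma(z)=\lim_n\mathrm{Ad}\,u_n(z)$ for every $z\in A\otimes A$ and the functions $t\mapsto(\alpha_t\otimes\alpha_t)(u_n)$ are (norm) equi-continuous in $n$. Equivalently, there is a sequence $(u_n)$ of unitaries in the domain $D(\delta_{\alpha\otimes\alpha})$ of the generator $\delta_{\alpha\otimes\alpha}$ of the flow $t\mapsto\alpha_t\otimes\alpha_t$ such that $\sigma=\lim_n\mathrm{Ad}\,u_n$ pointwise in norm and $\sup_n\|\delta_{\alpha\otimes\alpha}(u_n)\|<\infty$. For $c>0$, a state $\omega$ of $A$ is an $\alpha$-KMS state at inverse temperature $c$ if for any $x,y\in A$ there is a bounded continuous function $F$ on the strip $S_c=\{z\in\mathbb C: 0\le\Im z\le c\}$, analytic in the interior of $S_c$, with $F(t)=\omega(x\alpha_t(y))$ and $F(t+ic)=\omega(\alpha_t(y)x)$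 for $t\in\mathbb R$; the case $c<0$ is analogous with the strip $c\le\Im z\le0$, and for $c=0$ the condition is that $\omega$ is a tracial state. *)

(* Defs.v *)
From HB Require Import structures.
From mathcomp Require Import all_boot all_order all_algebra.
From mathcomp Require Import complex.
From mathcomp Require Import all_classical all_reals all_analysis.

Set Implicit Arguments.
Unset Strict Implicit.
Unset Printing Implicit Defensive.

Import Order.TTheory GRing.Theory Num.Theory.
Import numFieldNormedType.Exports.

Local Open Scope classical_set_scope.
Local Open Scope ring_scope.
Local Open Scope complex_scope.
Local Open Scope sesquilinear_scope.

(* Unital C*-algebras, with 1 != 0. The multiplication is part of the mixin, and
   the MathComp algebra structure is derived below, because the MathComp
   hierarchy lacks the structures that a join of [GRing.Algebra] and
   [NormedModule] would need. The norm of an R[i]-normed module takes its values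
   in R[i] itself (in the nonnegative reals). *)
HB.mixin Record isCStarAlgebra (R : realType) A of CompleteNormedModule R[i] A := {
  cstar_one : A;
  cstar_mul : A -> A -> A;
  star : A -> A;
  cstar_mulA : associative cstar_mul;
  cstar_mul1l : left_id cstar_one cstar_mul;
  cstar_mul1r : right_id cstar_one cstar_mul;
  cstar_mulDl : left_distributive cstar_mul +%R;
  cstar_mulDr : right_distributive cstar_mul +%R;
  cstar_one_neq0 : cstar_one != 0;
  cstar_scaleAl : forall (a : R[i]) (x y : A),
    a *: cstar_mul x y = cstar_mul (a *: x) y;
  cstar_scaleAr : forall (a : R[i]) (x y : A),
    a *: cstar_mul x y = cstar_mul x (a *: y);
  starK : involutive star;
  starD : {morph star : x y / x + y};
  starZ : forall (a : R[i]) (x : A), star (a *: x) = a^* *: star x;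
  starM_subproof : forall x y : A, star (cstar_mul x y) = cstar_mul (star y) (star x);
  cstar_normM_subproof : forall x y : A, `|cstar_mul x y| <= `|x| * `|y|;
  cstar_norm_subproof : forall x : A, `|cstar_mul (star x) x| = `|x| ^+ 2
}.

#[short(type="cstarAlgType")]
HB.structure Definition CStarAlgebra (R : realType) :=
  {A of isCStarAlgebra R A & CompleteNormedModule R[i] A}.

HB.instance Definition _ (R : realType) (A : cstarAlgType R) :=
  GRing.Zmodule_isNzRing.Build (CStarAlgebra.sort A)
    cstar_mulA cstar_mul1l cstar_mul1r cstar_mulDl cstar_mulDr cstar_one_neq0.
HB.instance Definition _ (R : realType) (A : cstarAlgType R) :=
  GRing.LSemiModule_isLSemiAlgebra.Build R[i] (CStarAlgebra.sort A) (@cstar_scaleAl R A).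
HB.instance Definition _ (R : realType) (A : cstarAlgType R) :=
  GRing.LSemiAlgebra_isSemiAlgebra.Build R[i] (CStarAlgebra.sort A) (@cstar_scaleAr R A).

Section CStarTheory.
Variables (R : realType) (A : cstarAlgType R).

Lemma starM (x y : A) : star (x * y) = star y * star x.
Proof. exact: starM_subproof. Qed.

Lemma cstar_normM (x y : A) : `|x * y| <= `|x| * `|y|.
Proof. exact: cstar_normM_subproof. Qed.

Lemma cstar_norm (x : A) : `|star x * x| = `|x| ^+ 2.
Proof. exact: cstar_norm_subproof. Qed.

End CStarTheory.

Section CStar.
Variable R : realType.
Local Notation C := R[i].
Implicit Types A B : cstarAlgType R.

Definition unitary A (u : A) : Prop := star u * u = 1 /\ u * star u = 1.

Definition Ad A (u x : A) : A := u * x * star u.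

Definition star_automorphism A (f : {lrmorphism A -> A}) : Prop :=
  bijective f /\ forall x, f (star x) = star (f x).

(* [1 \in M_k] is part of [{lrmorphism _ -> _}]; the increasing union of the
   matrix algebras is dense. The algebras M_n themselves are included. *)
Definition UHF A : Prop :=
  exists (k : nat -> nat) (phi : forall n, {lrmorphism 'M[C]_((k n).+1) -> A}),
    [/\ forall n, injective (phi n),
        forall n (M : 'M[C]_((k n).+1)), phi n (M ^t*) = star (phi n M),
        forall n, range (phi n) `<=` range (phi n.+1) &
        closure (\bigcup_n range (phi n)) = [set: A]].

Record flow A := Flow {
  flow_fun :> R -> {lrmorphism A -> A};
  flow_aut : forall t, star_automorphism (flow_fun t);
  flow0 : forall x, flow_fun 0 x = x;
  flowD : forall s t x, flow_fun (s + t) x = flow_fun s (flow_fun t x);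
  flow_cts : forall x, continuous (fun t : R => flow_fun t x)
}.

(* [B], with elementary tensors [tens x y], is a C*-completion of the algebraic
   tensor product of [A] with itself: [tens] is bilinear and compatible with the
   *-algebra structures, the induced map from the algebraic tensor product is
   injective ([tensor_inj]), and its image is dense. UHF algebras being nuclear,
   there is only one C*-norm on the algebraic tensor product, so this determines
   A (x) A up to a unique isomorphism preserving [tens] when [A] is UHF. *)
Record is_tensor_square A B (tens : A -> A -> B) : Prop := IsTensorSquare {
  tensor_bilinear : bilinear_for *:%R *:%R tens;
  tensor1 : tens 1 1 = 1;
  tensorM : forall x y x' y',
    tens x y * tens x' y' = tens (x * x') (y * y');
  tensor_star : forall x y, star (tens x y) = tens (star x) (star y);
  tensor_inj : forall (n : nat) (x y : 'I_n -> A),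
    (forall a : 'I_n -> C, \sum_(i < n) a i *: y i = 0 -> forall i, a i = 0) ->
    \sum_(i < n) tens (x i) (y i) = 0 -> forall i, x i = 0;
  tensor_dense :
    closure [set z | exists (n : nat) (x y : 'I_n -> A),
                       z = \sum_(i < n) tens (x i) (y i)] = [set: B]
}.

(* Elementary tensors span a dense subspace and *-automorphisms are isometric,
   so each of the next two conditions determines [sigma], resp. [beta]. *)
Definition is_flip A B (tens : A -> A -> B) (sigma : {lrmorphism B -> B}) : Prop :=
  star_automorphism sigma /\ forall x y, sigma (tens x y) = tens y x.

Definition is_tensor_flow A B (tens : A -> A -> B) (alpha : flow A)
    (beta : flow B) : Prop :=
  forall t x y, beta t (tens x y) = tens (alpha t x) (alpha t y).

Definition smoothly_approx_inner B (beta : flow B) (sigma : B -> B) : Prop :=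
  exists u : nat -> B,
    [/\ forall n, unitary (u n),
        forall z, (fun n => Ad (u n) z) @ \oo --> sigma z &
        equicontinuous [set: nat] (fun n (t : R) => beta t (u n))].

Definition state A (omega : A -> C) : Prop :=
  [/\ scalar omega, forall x : A, 0 <= omega (star x * x) & omega 1 = 1].

(* [C^o] carries the topology and normed module structure of the field C. *)
Definition strip (c : R) : set C^o :=
  [set z | if 0 <= c then 0 <= complex.Im z <= c else c <= complex.Im z <= 0].

(* Differentiability is with respect to the field C, i.e. holomorphy. *)
Definition KMS A (alpha : flow A) (c : R) (omega : A -> C) : Prop :=
  state omega /\
  if c == 0 then forall x y : A, omega (x * y) = omega (y * x)
  else forall x y : A, exists F : C^o -> C^o,
    [/\ exists M : R, forall z, strip c z -> `|F z| <= M%:C,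
        {within strip c, continuous F},
        forall z : C^o, (strip c)^° z -> derivable F z 1,
        forall t : R, F t%:C = omega (x * alpha t y) &
        forall t : R, F (t +i* c) = omega (alpha t y * x)].

End CStar.

(* Main.v *)
Require Import Defs.
From HB Require Import structures.
From mathcomp Require Import all_boot all_order all_algebra.
From mathcomp Require Import complex.
From mathcomp Require Import ring lra.
From mathcomp Require Import all_classical all_reals all_analysis.

Set Implicit Arguments.
Unset Strict Implicit.
Unset Printing Implicit Defensive.

Import Order.TTheory GRing.Theory Num.Theory.
Import numFieldNormedType.Exports.

Local Open Scope classical_set_scope.
Local Open Scope complex_scope.
Local Open Scope ring_scope.

(* For a product phi = w1 (x) w2 of two KMS states, which is a KMS functional for the flow beta
   on B, one shows phi(z^* z) <= K phi(sigma(z^* z)) with K independent of w1 and w2; for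
   z = 1 (x) a this reads w2(a^* a) <= K w1(a^* a). If K > 1, applying the same inequality to
   the KMS states (K w1 - w2) / (K - 1) improves it, so in the limit K = 1 and w1 = w2.

   To get the inequality, the unitaries u_n are smoothed along the flow with a kernel
   (m / (m + t^2))^k, whose continuation has no poles for |Im t| <= |c|. By equicontinuity a
   large k makes the smoothed elements v_n close to u_n (up to normalization) uniformly in n,
   while v_n z - sigma(z) v_n still tends to 0. Shifting the contour of integration by ic, which
   only needs Goursat's lemma on the strip, yields bounded v_n' with
   phi(v_n^* x) = phi(x v_n'). Iterating the Cauchy-Schwarz inequality then gives
   phi(v_n^* z^* z v_n) <= |v_n v_n'| phi(z^* z). *)

(** * Real-valued norms and convergence *)

(** The constant K may not depend on the two states, because it is applied again to extrapolated KMS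
    states of which nothing else is known. This is where smoothness is spent: the continuation of a
    smoothed unitary is bounded by the mass of the kernel, and if the kernel had to vary with n
    these masses could diverge. Equicontinuity allows one kernel for all n. A rational kernel serves
    better than a Gaussian here, since its size and decay on the strip are algebraic inequalities.
    Strip functions for phi are at hand only on elementary tensors, as products of those of w1 and
    w2. So the contour is shifted for elementary tensors only, and phi(v_n^* x) = phi(x v_n') then
    extends by linearity and boundedness of both smoothing maps. The product state has to be built
    although B comes with no formula for its norm. On a matrix algebra a bound with a constant
    depending on the dimension is easy; replacing t by t^* t repeatedly and using the C*-identity
    removes the constant. *)

Section RealNorm.
Variable R : realType.
Local Notation C := R[i].

(* Norms take their values in R[i]; [nrm] is the same norm as an element of R. *)
Definition nrm (V : normedZmodType C) (x : V) : R := complex.Re `|x|.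

Lemma nrmE (V : normedZmodType C) (x : V) : `|x| = (nrm x)%:C.
Proof. by rewrite /nrm RRe_real ?normr_real. Qed.

Section NormedZmod.
Variable V : normedZmodType C.
Implicit Types x y z : V.

Lemma nrm_ge0 x : 0 <= nrm x.
Proof. by rewrite -ler0c -nrmE. Qed.

Lemma nrm0 : nrm (0 : V) = 0.
Proof. by rewrite /nrm normr0. Qed.

Lemma nrm_eq0 x : nrm x = 0 -> x = 0.
Proof. by move=> h; apply/eqP; rewrite -normr_eq0 nrmE h. Qed.

Lemma nrmN x : nrm (- x) = nrm x.
Proof. by rewrite /nrm normrN. Qed.

Lemma nrmD x y : nrm (x + y) <= nrm x + nrm y.
Proof. by rewrite -lecR rmorphD /= -!nrmE; exact: ler_normD. Qed.

Lemma nrmB x y : nrm (x - y) <= nrm x + nrm y.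
Proof. by rewrite -(nrmN y); exact: nrmD. Qed.

Lemma nrmC x y : nrm (x - y) = nrm (y - x).
Proof. by rewrite -nrmN opprB. Qed.

Lemma nrm_trans y x z : nrm (x - z) <= nrm (x - y) + nrm (y - z).
Proof. by rewrite -[x - z](subrKA y); exact: nrmD. Qed.

Lemma nrm_le_dist x y : nrm x <= nrm y + nrm (x - y).
Proof. by rewrite -{1}(subrK y x) addrC; exact: nrmD. Qed.

Lemma nrm_le_small x : (forall e, 0 < e -> nrm x <= e) -> x = 0.
Proof.
move=> h; apply: nrm_eq0; apply/eqP; rewrite eq_le nrm_ge0 andbT.
by apply/ler_addgt0Pr => e e0; rewrite add0r h.
Qed.

Lemma nrm_sum (I : Type) (r : seq I) (F : I -> V) :
  nrm (\sum_(i <- r) F i) <= \sum_(i <- r) nrm (F i).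
Proof.
elim/big_ind2: _ => [|a x b y ha hb|//]; first by rewrite nrm0.
exact: le_trans (nrmD _ _) (lerD ha hb).
Qed.
End NormedZmod.

Lemma nrmZ (V : normedModType C) (a : C) (x : V) : nrm (a *: x) = nrm a * nrm x.
Proof. by rewrite /nrm normrZ (nrmE a) (nrmE x) -rmorphM. Qed.

Lemma nrm_real (x : R) : nrm x%:C = `|x|.
Proof. by rewrite /nrm normc_def /= expr0n addr0 sqrtr_sqr. Qed.

Lemma nrmZr (V : normedModType C) (a : R) (x : V) : nrm (a%:C *: x) = `|a| * nrm x.
Proof. by rewrite nrmZ nrm_real. Qed.

Lemma nrmM (a b : C) : nrm (a * b) = nrm a * nrm b.
Proof. by rewrite /nrm normrM (nrmE a) (nrmE b) -rmorphM. Qed.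

Lemma nrmX (a : C) n : nrm (a ^+ n) = nrm a ^+ n.
Proof. by rewrite /nrm normrX (nrmE a) -rmorphXn. Qed.

Lemma nrm1 : nrm (1 : C) = 1.
Proof. by rewrite /nrm normr1. Qed.

Lemma nrm_sqr (a : C) : a^* * a = (nrm a ^+ 2)%:C.
Proof. by rewrite mulrC -normCK nrmE -rmorphXn. Qed.

Lemma Re_le_nrm (a : C) : complex.Re a <= nrm a.
Proof.
case: a => x y; rewrite /nrm normc_def /=.
rewrite (le_trans (ler_norm _))// -sqrtr_sqr ler_wsqrtr// lerDl; exact: sqr_ge0.
Qed.

Lemma Im_le_nrm (a : C) : `|complex.Im a| <= nrm a.
Proof.
case: a => x y; rewrite /nrm normc_def /=.
by rewrite -sqrtr_sqr ler_wsqrtr// lerDr; exact: sqr_ge0.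
Qed.

Lemma nrm_le_ReIm (a : C) : nrm a <= `|complex.Re a| + `|complex.Im a|.
Proof.
rewrite {1}[a]complexE; apply: le_trans (nrmD _ _) _.
by rewrite nrmM !nrm_real /nrm normc_def /= expr0n expr1n add0r sqrtr1 mul1r.
Qed.

Definition cvs (V : normedZmodType C) (u : nat -> V) (l : V) : Prop :=
  forall e : R, 0 < e -> exists N, forall n, (N <= n)%N -> nrm (u n - l) < e.

Definition cauchy_sequence (V : normedZmodType C) (u : nat -> V) : Prop :=
  forall e : R, 0 < e -> exists N, forall m n, (N <= m)%N -> (N <= n)%N ->
    nrm (u m - u n) < e.

Definition seq_complete (V : normedZmodType C) : Prop :=
  forall u : nat -> V, cauchy_sequence u -> exists l, cvs u l.

Lemma cvs_cvg (V : normedModType C) (u : nat -> V) (l : V) :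
  u @ \oo --> l -> cvs u l.
Proof.
move=> /cvgrPdist_lt h e e0.
have /h [N _ hN] : 0 < e%:C :> C by rewrite ltcR.
by exists N => n Nn; have := hN n Nn; rewrite /= nrmE ltcR nrmC.
Qed.

Lemma cvs_cauchy (V : normedZmodType C) (u : nat -> V) (l : V) :
  cvs u l -> cauchy_sequence u.
Proof.
move=> h e e0; have [N hN] := h (e / 2) (divr_gt0 e0 (ltr0Sn _ _)).
exists N => m n Nm Nn; apply: le_lt_trans (nrm_trans l _ _) _.
by rewrite [ltRHS](splitr e) ltrD ?hN// nrmC hN.
Qed.

Lemma cvs_unique (V : normedZmodType C) (u : nat -> V) (l l' : V) :
  cvs u l -> cvs u l' -> l = l'.
Proof.
move=> h h'; apply/eqP; rewrite -subr_eq0; apply/eqP; apply: nrm_le_small => e e0.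
have e2 : 0 < e / 2 by rewrite divr_gt0.
have [N hN] := h _ e2; have [N' hN'] := h' _ e2.
apply: le_trans (nrm_trans (u (maxn N N')) _ _) _.
rewrite [leRHS](splitr e) lerD// ltW ?hN' ?leq_maxr// nrmC hN ?leq_maxl//.
Qed.

Lemma cvsD (V : normedZmodType C) (u v : nat -> V) (l m : V) :
  cvs u l -> cvs v m -> cvs (fun n => u n + v n) (l + m).
Proof.
move=> h h' e e0; have e2 : 0 < e / 2 by rewrite divr_gt0.
have [N hN] := h _ e2; have [N' hN'] := h' _ e2.
exists (maxn N N') => n; rewrite geq_max => /andP[Nn N'n].
rewrite opprD addrACA; apply: le_lt_trans (nrmD _ _) _.
by rewrite [ltRHS](splitr e) ltrD ?hN ?hN'.
Qed.

Lemma cvs_lip (V W : normedZmodType C) (f : V -> W) (K : R) (u : nat -> V) (l : V) :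
  (forall x, nrm (f x - f l) <= K * nrm (x - l)) -> cvs u l -> cvs (f \o u) (f l).
Proof.
move=> hf h e e0; set K' := `|K| + 1; have K0 : 0 < K' by rewrite ltr_wpDl.
have [N hN] := h (e / K') (divr_gt0 e0 K0).
exists N => n Nn /=; apply: le_lt_trans (hf _) _.
have := hN n Nn; rewrite ltr_pdivlMr// mulrC.
apply: le_lt_trans; apply: ler_wpM2r; rewrite ?nrm_ge0// /K'.
by rewrite (le_trans (ler_norm _))// lerDl.
Qed.

Lemma cvs_le (V : normedZmodType C) (u : nat -> V) (l : V) (M : R) (N : nat) :
  cvs u l -> (forall n, (N <= n)%N -> nrm (u n) <= M) -> nrm l <= M.
Proof.
move=> h hM; apply/ler_addgt0Pr => e e0; have [N' hN] := h _ e0.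
apply: le_trans (nrm_le_dist _ (u (maxn N N'))) _; rewrite lerD ?hM ?leq_maxl//.
by rewrite nrmC ltW// hN// leq_maxr.
Qed.

Lemma cvs_subseq (V : normedZmodType C) (u : nat -> V) (l : V) (f : nat -> nat) :
  (forall n, (n <= f n)%N) -> cvs u l -> cvs (u \o f) l.
Proof.
move=> hf h e e0; have [N hN] := h _ e0; exists N => n Nn /=.
by apply: hN; exact: leq_trans Nn (hf n).
Qed.

Lemma complete_normedMod (V : completeNormedModType C) : seq_complete V.
Proof.
move=> u hu; suff /cvg_ex[l] : cvg (u @ \oo) by exists l; exact: cvs_cvg.
apply: cauchy_cvg; apply: cauchy_exP => e e0.
have ee : e = (complex.Re e)%:C by rewrite RRe_real// ger0_real// ltW.
have [|N hN] := hu (complex.Re e); first by rewrite -ltcR -ee.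
exists (u N); exists N => // n /= Nn; rewrite /= -ball_normE /=.
by rewrite ee nrmE ltcR hN.
Qed.

Lemma complete_real (u : nat -> R) :
  (forall e : R, 0 < e -> exists N, forall m n, (N <= m)%N -> (N <= n)%N ->
    `|u m - u n| < e) ->
  exists l, forall e : R, 0 < e -> exists N, forall n, (N <= n)%N -> `|u n - l| < e.
Proof.
move=> hu; suff /cvg_ex[l /cvgrPdist_lt hl] : cvg (u @ \oo).
  by exists l => e /hl [N _ hN]; exists N => n Nn; rewrite distrC; exact: hN.
apply: cauchy_cvg; apply: cauchy_exP => e e0.
have [N hN] := hu e e0.
exists (u N); exists N => // n /= Nn; rewrite /= -ball_normE /=; exact: hN.
Qed.

Lemma complete_complex : seq_complete (C^o : normedModType C).
Proof.
move=> u hu.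
have [e e0|a ha] := @complete_real (fun n => complex.Re (u n)).
  have [N hN] := hu e e0; exists N => m n Nm Nn; rewrite -raddfB -nrm_real.
  rewrite nrm_real; apply: le_lt_trans (hN m n Nm Nn).
  by rewrite ler_norml Re_le_nrm -nrmN lerNl -raddfN Re_le_nrm.
have [e e0|b hb] := @complete_real (fun n => complex.Im (u n)).
  have [N hN] := hu e e0; exists N => m n Nm Nn; rewrite -raddfB.
  by apply: le_lt_trans (hN m n Nm Nn); exact: Im_le_nrm.
exists (a +i* b) => e e0; have e2 : 0 < e / 2 by rewrite divr_gt0.
have [N hN] := ha _ e2; have [N' hN'] := hb _ e2.
exists (maxn N N') => n; rewrite geq_max => /andP[Nn N'n].
apply: le_lt_trans (nrm_le_ReIm _) _; rewrite !raddfB /=.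
by rewrite [ltRHS](splitr e) ltrD ?hN ?hN'.
Qed.

Lemma closure_dense (V : normedModType C) (S : set V) (z : V) (e : R) :
  closure S = [set: V] -> 0 < e -> exists2 s, S s & nrm (z - s) < e.
Proof.
move=> hS e0; have : closure S z by rewrite hS.
move=> /(_ (ball z e%:C)) []; first by apply: nbhsx_ballx; rewrite ltcR.
by move=> s [Ss]; rewrite -ball_normE /= nrmE ltcR; exists s.
Qed.

Definition cont (V : normedZmodType C) (g : R -> V) : Prop :=
  forall t (e : R), 0 < e -> exists2 d : R, 0 < d & forall s, `|s - t| < d -> nrm (g s - g t) < e.

Lemma cont_continuous (V : normedModType C) (g : R -> V) : continuous g -> cont g.
Proof.
move=> hg t e e0; have /cvgrPdist_lt/(_ e%:C) := hg t.
rewrite ltcR => /(_ e0) /nbhs_normP [d /= d0 hd]; exists d => // s hs.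
by have := hd s; rewrite /= distrC => /(_ hs); rewrite nrmE ltcR nrmC.
Qed.
End RealNorm.

Section Linear.
Variables (R : realType) (V : lmodType R[i]) (W : lmodType R[i]) (f : V -> W).
Hypothesis hf : linear f.

Lemma linD x y : f (x + y) = f x + f y.
Proof. by have := hf 1 x y; rewrite !scale1r. Qed.

Lemma lin0 : f 0 = 0.
Proof. by apply: (addIr (f 0)); rewrite -linD !add0r. Qed.

Lemma linZ a x : f (a *: x) = a *: f x.
Proof. by have := hf a x 0; rewrite lin0 !addr0. Qed.

Lemma linN x : f (- x) = - f x.
Proof. by rewrite -scaleN1r linZ scaleN1r. Qed.

Lemma linB x y : f (x - y) = f x - f y.
Proof. by rewrite linD linN. Qed.

Lemma lin_sum (I : Type) (r : seq I) (P : pred I) (F : I -> V) :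
  f (\sum_(i <- r | P i) F i) = \sum_(i <- r | P i) f (F i).
Proof. by elim/big_rec2: _ => [|i y1 y2 _ <-]; rewrite ?lin0 ?linD. Qed.
End Linear.

(** * Geometric sequences, and the removal of constants by taking powers *)

Section Geometric.
Variable R : realType.
Implicit Types (r e K : R).

Lemma bernoulli r n : 0 <= r -> 1 + r *+ n <= (1 + r) ^+ n.
Proof.
move=> r0; elim: n => [|n IH]; first by rewrite mulr0n addr0 expr0.
rewrite exprS; apply: le_trans (ler_wpM2l _ IH); last by rewrite addr_ge0.
by rewrite mulrS; have : 0 <= r *+ n := mulrn_wge0 n r0; nra.
Qed.

Lemma geometric_small r K e : 0 <= r -> r < 1 -> 0 < e ->
  exists N, forall n, (N <= n)%N -> K * r ^+ n < e.
Proof.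
move=> r0 r1 e0; have [->|rn0] := eqVneq r 0.
  exists 1%N => -[//|n _]; by rewrite exprS mul0r mulr0.
have {rn0}r0' : 0 < r by rewrite lt_neqAle eq_sym rn0.
set p := r^-1 - 1; have p0 : 0 < p by rewrite subr_gt0 invf_gt1.
pose N := Num.bound `|K / (e * p)|.
exists N => n Nn.
have hn : K / e < r^-1 ^+ n.
  have -> : r^-1 = 1 + p by rewrite /p addrCA subrr addr0.
  apply: lt_le_trans (bernoulli n (ltW p0)).
  have hK : K / (e * p) < n%:R.
    apply: lt_le_trans (_ : N%:R <= _); last by rewrite ler_nat.
    exact: le_lt_trans (ler_norm _) (archi_boundP (normr_ge0 _)).
  move: hK; rewrite invfM mulrA ltr_pdivrMr// => /lt_trans; apply.
  by rewrite mulr_natl ltrDr.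
move: hn; rewrite exprVn ltr_pdivrMr// mulrC -ltr_pdivlMr ?invr_gt0 ?exprn_gt0//.
Qed.

(** If r < a, then K (r / a)^(2^n) falls below 1. A bound with a crude constant, once known for all
    2^n-th powers, thus sharpens to one without it; this is used for KMS functionals and for product
    functionals. *)
Lemma pow2_le_cancel (a r K : R) : 0 <= a -> 0 <= r ->
  (forall n, a ^+ (2 ^ n) <= K * r ^+ (2 ^ n)) -> a <= r.
Proof.
move=> a0 r0 h; rewrite leNgt; apply/negP => ra.
have a0' : 0 < a by exact: le_lt_trans ra.
have [||N hN] := @geometric_small (r / a) K 1 _ _ ltr01.
- by rewrite divr_ge0.
- by rewrite ltr_pdivrMr// mul1r.
have := hN (2 ^ N)%N (ltnW (ltn_expl _ (ltnSn _))).
by rewrite expr_div_n mulrA ltr_pdivrMr ?exprn_gt0// mul1r ltNge h.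
Qed.

Lemma geometric_cauchy (V : normedZmodType R[i]) (u : nat -> V) r K :
  0 <= r -> r < 1 -> (forall n, nrm (u n.+1 - u n) <= K * r ^+ n) ->
  cauchy_sequence u.
Proof.
move=> r0 r1 h; have r1' : 0 < 1 - r by rewrite subr_gt0.
have K0 : 0 <= K by have := le_trans (nrm_ge0 _) (h 0%N); rewrite expr0 mulr1.
(* The factor 1 - r^k gives the exact partial geometric sum, which lets the induction close. *)
have hm n k : nrm (u (n + k)%N - u n) <= K * r ^+ n / (1 - r) * (1 - r ^+ k).
  elim: k => [|k IH]; first by rewrite addn0 subrr nrm0 expr0 subrr mulr0.
  rewrite addnS; apply: le_trans (nrm_trans (u (n + k)%N) _ _) _.
  apply: le_trans (lerD (h _) IH) _.
  rewrite -[K * r ^+ (n + k)](divfK (lt0r_neq0 r1')) -mulrA mulrC exprD.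
  rewrite le_eqVlt; apply/orP; left; apply/eqP; rewrite exprS; ring.
move=> e e0; have e2 : 0 < e / 2 by rewrite divr_gt0.
have [N hN] := geometric_small (K / (1 - r)) r0 r1 e2.
have hN' n : (N <= n)%N -> nrm (u n - u N) < e / 2.
  move=> Nn; rewrite -(subnKC Nn); apply: le_lt_trans (hm _ _) _.
  apply: le_lt_trans (hN N (leqnn _)).
  rewrite (mulrAC K); apply: ler_piMr; rewrite ?mulr_ge0 ?exprn_ge0 ?invr_ge0// ?(ltW r1')//.
  by rewrite lerBlDr lerDl exprn_ge0.
exists N => m n Nm Nn; apply: le_lt_trans (nrm_trans (u N) _ _) _.
by rewrite [ltRHS](splitr e) ltrD ?hN'// nrmC hN'.
Qed.
End Geometric.

(** * C*-algebras and positive functionals *)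

Section CStarBasics.
Variables (R : realType) (A : cstarAlgType R).
Local Notation C := R[i].
Implicit Types x y z h : A.

Lemma nrm_mul x y : nrm (x * y) <= nrm x * nrm y.
Proof. by have := cstar_normM x y; rewrite !nrmE -rmorphM /= lecR. Qed.

Lemma nrm_starM x : nrm (star x * x) = nrm x ^+ 2.
Proof. by apply: complexI; rewrite rmorphXn /= -!nrmE; exact: cstar_norm. Qed.

Lemma star0 : star (0 : A) = 0.
Proof. by apply: (addIr (star (0 : A))); rewrite -starD !add0r. Qed.

Lemma star1 : star (1 : A) = 1.
Proof. by have := starM (star 1) (1 : A); rewrite !mulr1 starK mulr1. Qed.

Lemma starN x : star (- x) = - star x.
Proof. by apply: (addIr (star x)); rewrite -starD !addNr star0. Qed.

Lemma starB x y : star (x - y) = star x - star y.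
Proof. by rewrite starD starN. Qed.

(** The C*-identity gives |y|^2 <= |y^*| |y|, which is applied to x and to its adjoint. *)
Lemma nrm_star x : nrm (star x) = nrm x.
Proof.
have le y : nrm y <= nrm (star y).
  have [->|y0] := eqVneq y 0; first by rewrite star0.
  have ny : 0 < nrm y.
    by rewrite lt_neqAle nrm_ge0 andbT eq_sym; apply: contra y0 => /eqP/nrm_eq0 ->.
  by rewrite -(ler_pM2r ny) -expr2 -nrm_starM nrm_mul.
by apply/eqP; rewrite eq_le le -{2}[x]starK le.
Qed.

Lemma nrm_isometry x : star x * x = 1 -> nrm x = 1.
Proof.
have n1 : nrm (1 : A) = 1.
  have := nrm_starM 1; rewrite star1 mul1r expr2 => h.
  have n0 : nrm (1 : A) != 0 by apply/eqP => /nrm_eq0/eqP; rewrite oner_eq0.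
  by apply: (mulfI n0); rewrite mulr1 -h.
move=> h; apply/eqP; rewrite -(@eqrXn2 _ 2)// ?nrm_ge0//.
by rewrite -nrm_starM h n1 expr1n.
Qed.

Lemma nrm_one : nrm (1 : A) = 1.
Proof. by apply: nrm_isometry; rewrite star1 mul1r. Qed.

Lemma cvs_mulr (u : nat -> A) l y : cvs u l -> cvs (fun n => u n * y) (l * y).
Proof.
apply: (cvs_lip (f := fun x => x * y) (K := nrm y)) => x.
by rewrite -mulrBl (mulrC (nrm y)) nrm_mul.
Qed.

Lemma cvs_mull (u : nat -> A) l y : cvs u l -> cvs (fun n => y * u n) (y * l).
Proof.
by apply: (cvs_lip (f := fun x => y * x) (K := nrm y)) => x; rewrite -mulrBr nrm_mul.
Qed.

Lemma cvs_star (u : nat -> A) l : cvs u l -> cvs (fun n => star (u n)) (star l).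
Proof.
by apply: (cvs_lip (f := @star R A) (K := 1)) => x; rewrite -starB nrm_star mul1r.
Qed.

Fixpoint sqrt_iter h n : A :=
  if n is n'.+1 then (2^-1 : C) *: (h + sqrt_iter h n' * sqrt_iter h n') else 0.

(* The fixed point of s |-> (h + s^2)/2, a contraction of the ball of radius |h|, is 1 - sqrt (1 - h). *)
Lemma sqrt_one_sub h : star h = h -> nrm h < 1 ->
  exists y, [/\ star y = y, y * y = 1 - h & forall x, x * h = h * x -> x * y = y * x].
Proof.
move=> hh; set r := nrm h => r1; have r0 : 0 <= r := nrm_ge0 h.
have n2 : nrm (2^-1 : C) = 2^-1.
  have -> : (2^-1 : C) = (2^-1 : R)%:C by rewrite fmorphV rmorph_nat.
  by rewrite nrm_real ger0_norm// invr_ge0.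
have sr n : nrm (sqrt_iter h n) <= r.
  elim: n => [|n IH] /=; first by rewrite nrm0.
  rewrite nrmZ n2; apply: le_trans (_ : 2^-1 * (r + r * r) <= _).
    rewrite ler_wpM2l ?invr_ge0//; apply: le_trans (nrmD _ _) _; rewrite lerD//.
    by apply: le_trans (nrm_mul _ _) _; rewrite ler_pM ?nrm_ge0.
  have : r * r <= r by rewrite ler_piMr// ltW.
  lra.
have : cauchy_sequence (sqrt_iter h).
  (* Increments shrink by the factor r: each is half of a sum of two products of the previous
     increment with an iterate, and iterates have norm at most r. *)
  apply: (@geometric_cauchy _ _ _ r 1) => //; elim=> [|n IH].
    by rewrite expr0 mulr1 /= mulr0 addr0 subr0 nrmZ n2 -/r; lra.
  set s := sqrt_iter h in IH *; have -> : s n.+2 - s n.+1 =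
      (2^-1 : C) *: ((s n.+1 - s n) * s n.+1 + s n * (s n.+1 - s n)).
    rewrite mulrBl mulrBr subrKA -scalerBr; congr (_ *: _).
    by rewrite opprD addrACA subrr add0r.
  rewrite nrmZ n2 exprS mul1r.
  apply: le_trans (_ : 2^-1 * (r ^+ n * r + r * r ^+ n) <= _); last first.
    by rewrite -subr_ge0 le_eqVlt; apply/orP; left; apply/eqP; field.
  rewrite ler_wpM2l ?invr_ge0//; apply: le_trans (nrmD _ _) _.
  rewrite mul1r in IH.
  by apply: lerD; apply: le_trans (nrm_mul _ _) _; rewrite ler_pM ?nrm_ge0 ?sr.
move=> /complete_normedMod [s hs].
have s_eq : (2 : C) *: s = h + s * s.
  have : cvs (fun n => sqrt_iter h n.+1) ((2^-1 : C) *: (h + s * s)).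
    apply: (cvs_lip (f := fun x => (2^-1 : C) *: (h + x)) (K := 1)) => [x|].
      rewrite -scalerBr opprD addrACA subrr add0r nrmZ n2 mul1r.
      by have := nrm_ge0 (x - s * s); lra.
    move=> e e0.
    have [|N hN] := hs (e / 2); first by rewrite divr_gt0.
    exists N => n /hN hn.
    have -> : sqrt_iter h n * sqrt_iter h n - s * s =
      (sqrt_iter h n - s) * sqrt_iter h n + s * (sqrt_iter h n - s).
      by rewrite mulrBl mulrBr subrKA.
    have sr' : nrm s <= r by apply: (@cvs_le _ _ (sqrt_iter h) _ _ 0%N).
    rewrite [ltRHS](splitr e); apply: le_lt_trans (nrmD _ _) _.
    apply: le_lt_trans (lerD (nrm_mul _ _) (nrm_mul _ _)) _; apply: ltrD.
      apply: le_lt_trans hn; rewrite ler_piMr ?nrm_ge0//.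
      exact: le_trans (sr n) (ltW r1).
    apply: le_lt_trans hn; rewrite ler_piMl ?nrm_ge0//.
    exact: le_trans sr' (ltW r1).
  move=> /cvs_unique /(_ (cvs_subseq (f := S) (fun n => leqnSn n) hs)) e.
  by rewrite -[in LHS]e scalerA divff ?scale1r// pnatr_eq0.
exists (1 - s); split.
- rewrite starB star1; congr (_ - _).
  apply: cvs_unique (cvs_star hs) _ => e /hs [N hN]; exists N => n /hN.
  suff -> : star (sqrt_iter h n) = sqrt_iter h n by [].
  elim: n => [|n IH] /=; first exact: star0.
  rewrite starZ starD starM IH hh; congr (_ *: _).
  by rewrite fmorphV rmorph_nat.
- have ss : s + s = h + s * s by rewrite -s_eq scaler_nat.
  rewrite mulrBl mul1r mulrBr mulr1 opprB addrACA -opprD ss.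
  by rewrite opprD addrACA subrr addr0.
(* Commutation passes to the iterates and then to the limit; [starhom_contractive] needs it for the
   root of 1 - h^2 to commute with h. *)
- move=> x xh; rewrite mulrBl mulrBr mulr1 mul1r; congr (_ - _).
  apply: cvs_unique (cvs_mull x hs) _.
  move=> e /(cvs_mulr x hs) [N hN]; exists N => n /hN.
  suff -> : x * sqrt_iter h n = sqrt_iter h n * x by [].
  elim: n => [|n IH] /=; first by rewrite mulr0 mul0r.
  by rewrite -scalerAr -scalerAl mulrDl mulrDr xh mulrA IH -mulrA IH mulrA.
Qed.
End CStarBasics.

Section StarHom.
Variables (R : realType) (A B : cstarAlgType R) (f : A -> B).
Local Notation C := R[i].
Hypotheses (flin : linear f) (fM : forall x y, f (x * y) = f x * f y).
Hypotheses (f1 : f 1 = 1) (fstar : forall x, f (star x) = star (f x)).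

(* A self-adjoint contraction h is the real part of the unitary h + i sqrt(1 - h^2). *)
Lemma starhom_contractive x : nrm (f x) <= nrm x.
Proof.
have sa h : star h = h -> nrm h < 1 -> nrm (f h) <= 1.
  move=> hh h1.
  have [||y [ys yy yc]] := @sqrt_one_sub _ _ (h * h).
  - by rewrite starM hh.
  - apply: le_lt_trans (nrm_mul _ _) _.
    by apply: le_lt_trans (h1); apply: ler_piMl; rewrite ?nrm_ge0// ltW.
  have hy : h * y = y * h by apply: yc; rewrite mulrA.
  have unit_norm (a : C) : a^* * a = 1 -> a^* = - a -> nrm (f (h + a *: y)) <= 1.
    move=> aa1 aN; rewrite nrm_isometry//.
    rewrite -fstar -fM starD starZ hh ys mulrDl !mulrDr -!scalerAr -!scalerAl.
    rewrite scalerA mulrC aa1 scale1r hy aN scaleNr.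
    by rewrite addrA addrK yy addrC subrK f1.
  have i1 : ('i : C)^* = - 'i by rewrite conjCi.
  have ii : ('i : C)^* * 'i = 1 by rewrite i1 mulNr -expr2 sqrCi opprK.
  have -> : f h = (2^-1 : C) *: (f (h + 'i *: y) + f (h + (- 'i) *: y)).
    rewrite -(linD flin) addrACA -scalerDl subrr scale0r addr0 (linD flin).
    by rewrite scalerDr -scalerDl [_ + _](_ : _ = 1) ?scale1r// [RHS](splitr 1) div1r.
  rewrite nrmZ; have -> : (2^-1 : C) = (2^-1 : R)%:C by rewrite fmorphV rmorph_nat.
  rewrite nrm_real ger0_norm ?invr_ge0//.
  have := nrmD (f (h + 'i *: y)) (f (h + (- 'i) *: y)).
  have := unit_norm _ ii i1.
  have iN : (- 'i : C)^* = - - 'i by rewrite rmorphN /= i1.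
  have iiN : (- 'i : C)^* * (- 'i) = 1 by rewrite iN opprK mulrN -expr2 sqrCi opprK.
  have := unit_norm _ iiN iN.
  lra.
(* [sa] needs a norm strictly below 1, hence the scaling by [nrm h + e], which also covers h = 0. *)
have sa' h : star h = h -> nrm (f h) <= nrm h.
  move=> hh; apply/ler_addgt0Pr => e e0.
  have M0 : 0 < nrm h + e by rewrite ltr_wpDl ?nrm_ge0.
  have := sa ((nrm h + e)^-1%:C *: h).
  rewrite starZ hh [Num.conj _]conjc_real => /(_ erefl).
  rewrite (linZ flin) !nrmZr ger0_norm ?invr_ge0 ?(ltW M0)//.
  by rewrite mulrC ltr_pdivrMr// mul1r ltrDl mulrC ler_pdivrMr// mul1r; apply.
rewrite -(@ler_pXn2r _ 2)// ?nnegrE ?nrm_ge0// -!nrm_starM -fstar -fM.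
by apply: sa'; rewrite starM starK.
Qed.
End StarHom.

(** * Positive functionals and their seminorms *)

Section Positive.
Variables (R : realType) (A : cstarAlgType R) (phi : A -> R[i]).
Local Notation C := R[i].
Hypotheses (phi_lin : scalar phi) (phi_pos : forall x, 0 <= phi (star x * x)).
Implicit Types x y z : A.



(** The squared GNS seminorm of [phi]. *)
Definition sqnorm x : R := complex.Re (phi (star x * x)).

Lemma sqnormE x : phi (star x * x) = (sqnorm x)%:C.
Proof. by rewrite /sqnorm RRe_real// ger0_real. Qed.

Lemma sqnorm_ge0 x : 0 <= sqnorm x.
Proof. by rewrite -ler0c -sqnormE. Qed.

Lemma functD x y : phi (x + y) = phi x + phi y.
Proof. by have := phi_lin 1 x y; rewrite scale1r mul1r. Qed.

Lemma funct0 : phi 0 = 0.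
Proof. by apply: (addIr (phi 0)); rewrite -functD !add0r. Qed.

Lemma functZ a x : phi (a *: x) = a * phi x.
Proof. by have := phi_lin a x 0; rewrite funct0 !addr0. Qed.

Lemma functN x : phi (- x) = - phi x.
Proof. by rewrite -scaleN1r functZ mulN1r. Qed.

Lemma functB x y : phi (x - y) = phi x - phi y.
Proof. by rewrite functD functN. Qed.

(** Polarization: reality at x + y makes the imaginary parts of the two mixed terms opposite, and
    reality at x + i y makes their real parts equal. *)
Lemma pos_conj x y : phi (star y * x) = (phi (star x * y))^*.
Proof.
have real z : phi (star z * z) \is Num.real by rewrite ger0_real.
have h1 : phi (star x * y) + phi (star y * x) \is Num.real.
  have := real (x + y); rewrite starD mulrDl !mulrDr !functD addrACA.
  set a := phi (star x * y); set b := phi (star y * x) => h.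
  have -> : a + b = phi (star x * x) + b + (a + phi (star y * y))
    - phi (star x * x) - phi (star y * y) by ring.
  by rewrite !rpredB ?real.
have h2 : 'i * (phi (star x * y) - phi (star y * x)) \is Num.real.
  have := real (x + 'i *: y).
  rewrite starD starZ conjCi mulrDl !mulrDr -!scalerAl -!scalerAr !functD !functZ.
  set a := phi (star x * y); set b := phi (star y * x).
  set c := phi (star y * y) => h.
  have ic : - 'i * ('i * c) = c by rewrite mulrA mulNr -expr2 sqrCi opprK mul1r.
  rewrite ic in h; have -> : 'i * a + 'i * - b =
    phi (star x * x) + 'i * a + (- 'i * b + c) - phi (star x * x) - c by ring.
  by rewrite !rpredB ?real.
move: h1 h2; move: (phi (star x * y)) (phi (star y * x)) => [a b] [c d].
by simpc; rewrite !complex_real => /eqP h1 /eqP h2; apply/eqP; rewrite eq_complex /=; apply/andP; split; apply/eqP; lra.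
Qed.

Lemma pos_star x : phi (star x) = (phi x)^*.
Proof. by have := pos_conj 1 x; rewrite star1 mul1r mulr1. Qed.

Lemma sqnormDr x y b : (sqnorm (x + b *: y))%:C =
  (sqnorm x)%:C + b * phi (star x * y) + b^* * (phi (star x * y))^* + b^* * b * (sqnorm y)%:C.
Proof.
rewrite -sqnormE; set rhs := RHS.
rewrite starD starZ mulrDl !mulrDr -!scalerAl -!scalerAr !functD !functZ.
by rewrite (pos_conj x y) !sqnormE /rhs; ring.
Qed.

Lemma pos_cauchy_schwarz x y : nrm (phi (star x * y)) ^+ 2 <= sqnorm x * sqnorm y.
Proof.
set a := phi (star x * y); set n := nrm a ^+ 2.
(* Positivity at x - t a^* y. The best t is 1 / [sqnorm y]; if [sqnorm y] is 0, a large t forces n =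
   0. *)
have key (t : R) : 0 <= sqnorm x - 2 * t * n + t ^+ 2 * n * sqnorm y.
  have := sqnorm_ge0 (x + (- t%:C * a^*) *: y); rewrite -ler0c sqnormDr -/a.
  have -> : (- t%:C * a^*)^* = - t%:C * a.
    by rewrite rmorphM rmorphN /= conjCK; congr (- _ * _); exact: conjc_real.
  have -> : (sqnorm x)%:C + - t%:C * a^* * a + - t%:C * a * a^* +
    - t%:C * a * (- t%:C * a^*) * (sqnorm y)%:C =
    (sqnorm x)%:C - 2 * t%:C * (a^* * a) + t%:C ^+ 2 * (a^* * a) * (sqnorm y)%:C by ring.
  rewrite nrm_sqr -/n.
  have -> : (sqnorm x)%:C - 2 * t%:C * n%:C + t%:C ^+ 2 * n%:C * (sqnorm y)%:C =
     (sqnorm x - 2 * t * n + t ^+ 2 * n * sqnorm y)%:C.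
    by rewrite rmorphD rmorphB !rmorphM /= rmorph_nat expr2.
  by rewrite ler0c.
have n0 : 0 <= n by rewrite exprn_ge0 ?nrm_ge0.
have x0 := sqnorm_ge0 x; have y0 := sqnorm_ge0 y.
have [y00|yn0] := eqVneq (sqnorm y) 0.
  have [->|nn0] := eqVneq n 0; first by rewrite y00 mulr0.
  have := key ((sqnorm x + 1) / n); rewrite y00 mulr0 addr0.
  by rewrite -mulrA divfK//; lra.
have := key (sqnorm y)^-1; rewrite -(pmulr_lge0 _ (_ : 0 < sqnorm y)) ?lt_neqAle ?y0 1?eq_sym ?yn0//.
have -> : (sqnorm x - 2 / sqnorm y * n + (sqnorm y)^-1 ^+ 2 * n * sqnorm y) * sqnorm y =
  sqnorm x * sqnorm y - n by field.
by rewrite subr_ge0.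
Qed.

(** For M > |x|^2 the element 1 - x^* x / M is the square of a self-adjoint y, and positivity at y z
    gives the bound with M. The root is available only for norms below 1, so |x|^2 itself is reached
    in the limit. *)
Lemma sqnorm_mul x z : sqnorm (x * z) <= nrm x ^+ 2 * sqnorm z.
Proof.
have key M : nrm x ^+ 2 < M -> sqnorm (x * z) <= M * sqnorm z.
  move=> hM; have M0 : 0 < M by apply: le_lt_trans hM; rewrite exprn_ge0 ?nrm_ge0.
  have [||y [ys yy _]] := @sqrt_one_sub _ _ (M^-1%:C *: (star x * x)).
  - by rewrite starZ starM starK; congr (_ *: _); exact: conjc_real.
  - by rewrite nrmZr nrm_starM ger0_norm ?invr_ge0 ?(ltW M0)// mulrC ltr_pdivrMr// mul1r.
  have := sqnorm_ge0 (y * z).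
  have -> : sqnorm (y * z) = sqnorm z - M^-1 * sqnorm (x * z).
    apply: complexI; rewrite rmorphB rmorphM /= -!sqnormE !starM ys.
    rewrite -(mulrA _ y) (mulrA y) yy mulrBl mul1r mulrBr functB.
    by rewrite -scalerAl -scalerAr functZ !mulrA.
  by rewrite subr_ge0 mulrC ler_pdivrMr// mulrC.
apply/ler_addgt0Pr => e e0.
have s0 : 0 < sqnorm z + 1 by rewrite ltr_wpDl ?sqnorm_ge0.
apply: le_trans (key (nrm x ^+ 2 + e / (sqnorm z + 1)) _) _.
  by rewrite ltrDl divr_gt0.
rewrite mulrDl lerD2l -mulrA ler_piMr ?(ltW e0)// mulrC ler_pdivrMr// mul1r.
by rewrite lerDl.
Qed.

Lemma sqnorm_parallelogram x y : sqnorm (x + y) <= 2 * sqnorm x + 2 * sqnorm y.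
Proof.
have h1 : sqnorm (x + y) + sqnorm (x - y) = 2 * sqnorm x + 2 * sqnorm y.
  apply: complexI; rewrite rmorphD [RHS]rmorphD !rmorphM /= rmorph_nat.
  have := sqnormDr x y 1; rewrite scale1r => ->.
  have := sqnormDr x y (-1); rewrite scaleN1r => ->.
  by rewrite rmorphN /= rmorph1; ring.
have := sqnorm_ge0 (x - y); lra.
Qed.

Section KMSEstimate.
Variables (w w' : A).
Hypothesis hw : forall x, phi (star w * x) = phi (x * w').

(* For b = w w' the functional satisfies phi (b^* x) = phi (x b); the Cauchy-Schwarz
   inequality, iterated along the powers b^(2^n), then bounds right multiplication
   by w in the seminorm of phi. *)
Lemma sqnorm_mulr_le z : sqnorm (z * w) <= nrm (w * w') * sqnorm z.
Proof.
set b := w * w'.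
(* The adjoint of [hw]. Together they give phi(b^* x) = phi(w^* x w) = phi(x w w'). *)
have hw' x : phi (star w' * x) = phi (x * w).
  have := hw (star x); rewrite -starM !pos_star => /(congr1 Num.conj).
  by rewrite conjCK -pos_star starM starK => ->.
have hb x : phi (star b * x) = phi (x * b).
  by rewrite /b starM -mulrA hw' -mulrA hw mulrA.
have hbn n x : phi (star (b ^+ n) * x) = phi (x * b ^+ n).
  elim: n x => [|n IH] x; first by rewrite !expr0 star1 mul1r mulr1.
  by rewrite {1}exprSr starM -mulrA hb -mulrA IH exprS mulrA.
have q0 := sqnorm_ge0 z; set Q := sqnorm z in q0 *.
(* Here phi(a^* z^* z a) = phi(z^* z a a'), and Cauchy-Schwarz applies to the pair z, z a a'. *)
have step a a' : (forall x, phi (star a * x) = phi (x * a')) ->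
    sqnorm (z * a) ^+ 2 <= Q * sqnorm (z * (a * a')).
  move=> ha; apply: le_trans (pos_cauchy_schwarz _ _); rewrite le_eqVlt.
  apply/orP; left; apply/eqP; rewrite -[X in X ^+ 2]ger0_norm ?sqnorm_ge0//.
  by rewrite -nrm_real -sqnormE starM -mulrA ha !mulrA.
have iter n : sqnorm (z * b) ^+ (2 ^ n) <= Q ^+ (2 ^ n).-1 * sqnorm (z * b ^+ (2 ^ n)).
  elim: n => [|n IH]; first by rewrite !expr1 expr0 mul1r.
  have p2 : (0 < 2 ^ n)%N by rewrite expn_gt0.
  rewrite expnSr exprM; apply: le_trans (_ : (Q ^+ (2 ^ n).-1 * sqnorm (z * b ^+ (2 ^ n))) ^+ 2 <= _).
    by rewrite ler_pXn2r// ?nnegrE ?mulr_ge0 ?exprn_ge0 ?sqnorm_ge0.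
  rewrite exprMn; apply: le_trans (ler_wpM2l _ (step _ _ (hbn _))) _.
    by rewrite exprn_ge0// exprn_ge0.
  rewrite (mulrA _ Q) -exprM -exprSr -exprD addnn -muln2.
  suff -> : ((2 ^ n).-1 * 2).+1 = (2 ^ n * 2).-1 by [].
  by case: (2 ^ n)%N p2 => // m _; rewrite mulSn.
have nbX n : nrm (b ^+ n) <= nrm b ^+ n.
  elim: n => [|n IH]; first by rewrite !expr0 nrm_one.
  by rewrite !exprS; apply: le_trans (nrm_mul _ _) _; rewrite ler_wpM2l ?nrm_ge0.
(* Only the rate [nrm b ^+ 2] survives [pow2_le_cancel]; the constant in front is immaterial. *)
have crude n : sqnorm (z * b ^+ n) <= nrm z ^+ 2 * sqnorm 1 * (nrm b ^+ 2) ^+ n.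
  rewrite -[z * _]mulr1; apply: le_trans (sqnorm_mul _ _) _.
  rewrite [leRHS]mulrAC; apply: ler_wpM2r; first exact: sqnorm_ge0.
  rewrite -exprM mulnC exprM -exprMn ler_pXn2r ?nnegrE ?mulr_ge0 ?exprn_ge0 ?nrm_ge0//.
  by apply: le_trans (nrm_mul _ _) _; rewrite ler_wpM2l ?nrm_ge0.
have [Q0|Qn0] := eqVneq Q 0.
  have := step w w' hw; rewrite Q0 mul0r mulr0 => h.
  have /eqP : sqnorm (z * w) ^+ 2 = 0 by apply/eqP; rewrite eq_le h sqr_ge0.
  by rewrite sqrf_eq0 => /eqP ->.
have Qpos : 0 < Q by rewrite lt_neqAle eq_sym Qn0.
have zb : sqnorm (z * b) <= nrm b ^+ 2 * Q.
  apply: (@pow2_le_cancel _ _ _ (nrm z ^+ 2 * sqnorm 1 / Q)); rewrite ?sqnorm_ge0//.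
    by rewrite mulr_ge0// exprn_ge0 ?nrm_ge0.
  move=> n; apply: le_trans (iter n) _.
  apply: le_trans (ler_wpM2l _ (crude _)) _; first by rewrite exprn_ge0.
  have p2 : (0 < 2 ^ n)%N by rewrite expn_gt0.
  have QX : Q ^+ (2 ^ n) = Q * Q ^+ (2 ^ n).-1 by rewrite -exprS prednK.
  by rewrite (exprMn _ _ Q) QX le_eqVlt; apply/orP; left; apply/eqP; field.
rewrite -(@ler_pXn2r _ 2)// ?nnegrE ?mulr_ge0 ?sqnorm_ge0 ?nrm_ge0//.
apply: le_trans (step _ _ hw) _; rewrite -/b exprMn.
by rewrite (expr2 Q) mulrCA; apply: ler_wpM2l.
Qed.
End KMSEstimate.
End Positive.

Section State.
Variables (R : realType) (A : cstarAlgType R) (phi : A -> R[i]).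
Hypothesis phi_state : state phi.

Lemma state_sqnorm1 : sqnorm phi 1 = 1.
Proof. by case: phi_state => _ _ h; rewrite /sqnorm star1 mul1r h. Qed.

Lemma state_sqnorm_le x : sqnorm phi x <= nrm x ^+ 2.
Proof.
have [h1 h2 h3] := phi_state.
by have := sqnorm_mul h1 h2 x 1; rewrite state_sqnorm1 !mulr1.
Qed.

Lemma state_bound x : nrm (phi x) <= nrm x.
Proof.
have [h1 h2 h3] := phi_state.
rewrite -(@ler_pXn2r _ 2)// ?nnegrE ?nrm_ge0//.
have := pos_cauchy_schwarz h1 h2 1 x; rewrite star1 mul1r state_sqnorm1 mul1r.
by move=> /le_trans; apply; exact: state_sqnorm_le.
Qed.
End State.

(** * Product states *)

Section ProductState.
Variables (R : realType) (A B : cstarAlgType R) (tens : A -> A -> B).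
Local Notation C := R[i].
Hypothesis tensP : is_tensor_square tens.
Implicit Types (x y : A) (s t : seq (A * A)).

Lemma tens_linl y : linear (fun x => tens x y).
Proof. by case: (tensor_bilinear tensP) => h _; exact: h. Qed.

Lemma tens_linr x : linear (tens x).
Proof. by case: (tensor_bilinear tensP) => _ h; exact: h. Qed.

Lemma tensBl x x' y : tens (x - x') y = tens x y - tens x' y.
Proof. exact: (linB (tens_linl y)). Qed.

Lemma tensBr x y y' : tens x (y - y') = tens x y - tens x y'.
Proof. exact: (linB (tens_linr x)). Qed.

Lemma tensZl a x y : tens (a *: x) y = a *: tens x y.
Proof. exact: (linZ (tens_linl y)). Qed.

Lemma tensZr a x y : tens x (a *: y) = a *: tens x y.
Proof. exact: (linZ (tens_linr x)). Qed.

(** The definition of a tensor square says nothing about norms of elementary tensors, but both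
    embeddings of A into B are unital *-homomorphisms, hence contractive. *)
Lemma nrm_tens x y : nrm (tens x y) <= nrm x * nrm y.
Proof.
have -> : tens x y = tens x 1 * tens 1 y by rewrite tensorM// mulr1 mul1r.
apply: le_trans (nrm_mul _ _) _; apply: ler_pM; rewrite ?nrm_ge0//.
- apply: (starhom_contractive (tens_linl 1)) => [u v||u].
  + by rewrite tensorM// mulr1.
  + exact: tensor1.
  + by rewrite tensor_star// star1.
- apply: (starhom_contractive (tens_linr 1)) => [u v||u].
  + by rewrite tensorM// mulr1.
  + exact: tensor1.
  + by rewrite tensor_star// star1.
Qed.

(* A list of pairs stands for the sum of the corresponding elementary tensors. *)
Definition tenssum s : B := \sum_(p <- s) tens p.1 p.2.

Definition tmul s t := [seq (p.1 * q.1, p.2 * q.2) | p <- s, q <- t].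

Definition tstar s := [seq (star p.1, star p.2) | p <- s].

Definition tscale (a : C) s := [seq (a *: p.1, p.2) | p <- s].

Lemma tenssum_cat s t : tenssum (s ++ t) = tenssum s + tenssum t.
Proof. exact: big_cat. Qed.

Lemma tenssum_mul s t : tenssum (tmul s t) = tenssum s * tenssum t.
Proof.
rewrite /tenssum /tmul big_allpairs_dep big_distrlr /=.
by apply: eq_bigr => p _; apply: eq_bigr => q _; rewrite tensorM.
Qed.

Lemma tenssum_star s : tenssum (tstar s) = star (tenssum s).
Proof.
rewrite /tenssum /tstar big_map; elim: s => [|p s IH]; first by rewrite !big_nil star0.
by rewrite !big_cons IH starD tensor_star.
Qed.

Lemma tenssum_scale a s : tenssum (tscale a s) = a *: tenssum s.
Proof. by rewrite /tenssum /tscale big_map scaler_sumr; apply: eq_bigr => p _; rewrite tensZl. Qed.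

Lemma tenssum_dense z e : 0 < e -> exists s, nrm (z - tenssum s) < e.
Proof.
move=> e0; have [_ [n [x [y ->]]] h] := closure_dense z (tensor_dense tensP) e0.
by exists [seq (x i, y i) | i <- enum 'I_n]; rewrite /tenssum big_map big_enum.
Qed.

Variables w1 w2 : A -> C.
Hypotheses (w1_lin : scalar w1) (w2_lin : scalar w2).
Hypotheses (w1_pos : forall x, 0 <= w1 (star x * x)).
Hypotheses (w2_pos : forall x, 0 <= w2 (star x * x)).

(** The prospective value of the product state at [tenssum s]. That it depends on this sum alone,
    and not on the list, will follow from [tensval_bound]. *)
Definition tensval s : C := \sum_(p <- s) w1 p.1 * w2 p.2.

Definition gram s t : C := tensval (tmul (tstar s) t).

Lemma gramE s t : gram s t =
  \sum_(p <- s) \sum_(q <- t) w1 (star p.1 * q.1) * w2 (star p.2 * q.2).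
Proof. by rewrite /gram /tensval /tmul /tstar big_allpairs_dep big_map. Qed.

Lemma tensval_cat s t : tensval (s ++ t) = tensval s + tensval t.
Proof. exact: big_cat. Qed.

Lemma tensval_scale a s : tensval (tscale a s) = a * tensval s.
Proof.
rewrite /tensval /tscale big_map mulr_sumr; apply: eq_bigr => p _.
by rewrite (functZ w1_lin) mulrA.
Qed.

Lemma gram_catl s s' t : gram (s ++ s') t = gram s t + gram s' t.
Proof. by rewrite !gramE big_cat. Qed.

Lemma gram_conj s t : gram t s = (gram s t)^*.
Proof.
rewrite !gramE exchange_big rmorph_sum; apply: eq_bigr => p _.
rewrite rmorph_sum; apply: eq_bigr => q _.
by rewrite rmorphM /= -!pos_conj.
Qed.

Lemma gram_catr s t t' : gram s (t ++ t') = gram s t + gram s t'.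
Proof. by rewrite gram_conj gram_catl rmorphD /= -!gram_conj. Qed.

(* Schur's product theorem, by orthogonalizing the left legs with respect to w1. *)
Lemma gram_ge0 s : 0 <= gram s s.
Proof.
elim: {s}(size s) {-2}s (erefl (size s)) => [|n IH] s.
  by move/size0nil ->; rewrite gramE big_nil.
case: s => [//|[x0 y0] s] [sn].
pose c (q : A * A) := w1 (star x0 * q.1) / w1 (star x0 * x0).
(* If w1 (x0^* x0) = 0, the right-hand side vanishes too, by Cauchy-Schwarz, whatever the quotient
   [c q] is. *)
have cE q : c q * w1 (star x0 * x0) = w1 (star x0 * q.1).
  have [x00|xn0] := eqVneq (w1 (star x0 * x0)) 0; last by rewrite /c divfK.
  rewrite x00 mulr0; apply/esym; apply: nrm_eq0; apply/eqP.
  rewrite -sqrf_eq0 eq_le sqr_ge0 andbT.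
  apply: le_trans (pos_cauchy_schwarz w1_lin w1_pos _ _) _.
  by rewrite {1}/sqnorm x00 /= mul0r.
(* The tensor is rewritten as x0 (x) (y0 + sum c_q y_q) plus the sum of the (x_q - c_q x0) (x) y_q.
   The two parts are orthogonal for [gram], and the second has one term fewer than the original
   list. *)
pose s' := [seq (q.1 - c q *: x0, q.2) | q <- s].
pose e := [:: (x0, y0 + \sum_(q <- s) c q *: q.2)].
have eqv t : gram ((x0, y0) :: s) t = gram (e ++ s') t.
  rewrite !gramE big_cons [in RHS]big_cat /= big_seq1 exchange_big /=.
  rewrite [X in _ = _ + X]exchange_big /= -!big_split /=; apply: eq_bigr => q _.
  rewrite big_map starD mulrDl (functD w2_lin) mulrDr -addrA; congr (_ + _).
  have -> : star (\sum_(q0 <- s) c q0 *: q0.2) * q.2 =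
      \sum_(p <- s) (c p)^* *: (star p.2 * q.2).
    elim: (s) => [|p r IHr]; first by rewrite !big_nil star0 mul0r.
    by rewrite !big_cons starD mulrDl IHr starZ scalerAl.
  have -> : w2 (\sum_(p <- s) (c p)^* *: (star p.2 * q.2)) =
      \sum_(p <- s) (c p)^* * w2 (star p.2 * q.2).
    elim: (s) => [|p r IHr]; first by rewrite !big_nil (funct0 w2_lin).
    by rewrite !big_cons (functD w2_lin) (functZ w2_lin) IHr.
  rewrite mulr_sumr -big_split /=; apply: eq_bigr => p _.
  by rewrite starB mulrBl (functB w1_lin) starZ -scalerAl (functZ w1_lin); ring.
have e_s' : gram e s' = 0.
  rewrite gramE big_seq1 big_map big1// => q _ /=.
  by rewrite mulrBr (functB w1_lin) -scalerAr (functZ w1_lin) cE subrr mul0r.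
rewrite eqv gram_conj eqv -gram_conj gram_catl !gram_catr e_s'.
rewrite (gram_conj e s') e_s' rmorph0 addr0 add0r addr_ge0//; last first.
  by apply: IH; rewrite size_map.
by rewrite gramE !big_seq1 mulr_ge0.
Qed.

Hypotheses (w1_1 : w1 1 = 1) (w2_1 : w2 1 = 1).

(** Cauchy-Schwarz for [gram] against 1 (x) 1, obtained from positivity after subtracting
    [tensval s] times 1 (x) 1. *)
Lemma tensval_sqr s : nrm (tensval s) ^+ 2 <= nrm (gram s s).
Proof.
pose e := [:: (1 : A, 1 : A)].
have es t : gram e t = tensval t.
  by rewrite gramE big_seq1; apply: eq_bigr => p _; rewrite star1 !mul1r.
have ee : gram e e = 1.
  by rewrite es /tensval big_seq1 w1_1 w2_1 mulr1.
pose a := - tensval s.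
have gr t : gram t (tscale a e) = a * gram t e.
  rewrite !gramE mulr_sumr; apply: eq_bigr => p _; rewrite !big_seq1 /=.
  by rewrite -scalerAr (functZ w1_lin) mulrA.
have gl t : gram (tscale a e) t = a^* * gram e t.
  by rewrite gram_conj gr rmorphM /= -gram_conj.
have := gram_ge0 (s ++ tscale a e).
rewrite gram_catl !gram_catr gr gl gl gr es (gram_conj e) es ee.
have -> : gram s s + a * (tensval s)^* + (a^* * tensval s + a^* * (a * 1)) =
  gram s s - (tensval s)^* * tensval s by rewrite /a rmorphN /=; ring.
have gs : gram s s = (nrm (gram s s))%:C by rewrite -nrmE ger0_norm ?gram_ge0.
by rewrite nrm_sqr gs -rmorphB ler0c subr_ge0 nrm_real ger0_norm ?nrm_ge0.
Qed.

Section Matrices.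
Variables (d : nat) (phi : {lrmorphism 'M[C]_d.+1 -> A}).

Definition mx_list (m : seq ('M[C]_d.+1 * 'M[C]_d.+1)) := [seq (phi p.1, phi p.2) | p <- m].

Let E (a b : 'I_d.+1) : A := phi (delta_mx a b).

(** Multiplication by fixed elements isolates a coefficient, so that coefficients are controlled by
    the norm; [mx_coef_extract] does this in both legs at once. *)
Lemma matrix_units_extract a b (M : 'M[C]_d.+1) :
  \sum_p E p a * phi M * E b p = M a b *: 1.
Proof.
rewrite /E; under eq_bigr do rewrite -!rmorphM.
rewrite -raddf_sum -(rmorph1 phi) -linearZ /=; congr (phi _).
rewrite [RHS]scalemx1 scalar_mx_sum_delta; apply: eq_bigr => p _.
rewrite {1}(matrix_sum_delta M) mulr_sumr mulr_suml (bigD1 a)//=.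
rewrite [X in _ + X]big1 ?addr0 => [|i ia]; last first.
  rewrite mulr_sumr mulr_suml big1// => j _.
  by rewrite -scalerAr -!mulmxE mul_delta_mx_0 1?eq_sym// scaler0 mul0mx.
rewrite mulr_sumr mulr_suml (bigD1 b)//= big1 ?addr0 => [|j jb].
  by rewrite -scalerAr -scalerAl /= -!mulmxE !mul_delta_mx.
by rewrite -scalerAr -scalerAl /= -!mulmxE mul_delta_mx mul_delta_mx_0// scaler0.
Qed.

Definition mx_coef (m : seq ('M[C]_d.+1 * 'M[C]_d.+1)) a b c e : C :=
  \sum_(p <- m) p.1 a b * p.2 c e.

Lemma mx_coef_extract m a b c e :
  \sum_p \sum_q tens (E p a) (E q c) * tenssum (mx_list m) * tens (E b p) (E e q) =
  mx_coef m a b c e *: 1.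
Proof.
transitivity (\sum_p \sum_q \sum_(r <- m)
    tens (E p a * phi r.1 * E b p) (E q c * phi r.2 * E e q)).
  apply: eq_bigr => p _; apply: eq_bigr => q _.
  rewrite /tenssum big_map mulr_sumr mulr_suml; apply: eq_bigr => r _.
  by rewrite !tensorM.
rewrite /mx_coef scaler_suml (eq_bigr _ (fun p _ => exchange_big _ _ _ _ _ _)).
rewrite exchange_big /=; apply: eq_bigr => -[M N] _ /=.
transitivity (\sum_p tens (E p a * phi M * E b p) (N c e *: 1)).
  by apply: eq_bigr => p _; rewrite -(lin_sum (tens_linr _)) matrix_units_extract.
by rewrite -(lin_sum (tens_linl _)) matrix_units_extract tensZl tensZr scalerA tensor1.
Qed.

(** The value is a fixed linear combination of finitely many coefficients, each bounded by the norm
    in B through [mx_coef_extract]. *)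
Lemma tensval_mx_crude : exists K : R, forall m,
  nrm (tensval (mx_list m)) <= K * nrm (tenssum (mx_list m)).
Proof.
pose L a b c e := \sum_p \sum_q nrm (tens (E p a) (E q c)) * nrm (tens (E b p) (E e q)).
have hL m a b c e : nrm (mx_coef m a b c e) <= L a b c e * nrm (tenssum (mx_list m)).
  rewrite -[leLHS]mulr1 -(nrm_one B) -nrmZ -mx_coef_extract.
  apply: le_trans (nrm_sum _ _) _; rewrite mulr_suml ler_sum// => p _.
  apply: le_trans (nrm_sum _ _) _; rewrite mulr_suml ler_sum// => q _.
  apply: le_trans (nrm_mul _ _) _; rewrite mulrAC; apply: ler_wpM2r.
    exact: nrm_ge0.
  exact: nrm_mul.
exists (\sum_a \sum_b \sum_c \sum_e L a b c e * nrm (w1 (E a b) * w2 (E c e))) => m.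
have -> : tensval (mx_list m) =
    \sum_a \sum_b \sum_c \sum_e mx_coef m a b c e * (w1 (E a b) * w2 (E c e)).
  have ex (w : A -> C) (M : 'M[C]_d.+1) : scalar w ->
      w (phi M) = \sum_a \sum_b M a b * w (E a b).
    move=> wl; rewrite {1}(matrix_sum_delta M) raddf_sum /=.
    have ws (F : 'I_d.+1 -> A) : w (\sum_i F i) = \sum_i w (F i).
      by elim/big_rec2: _ => [|i y1 y2 _ <-]; rewrite ?(funct0 wl) ?(functD wl).
    rewrite ws; apply: eq_bigr => a _; rewrite raddf_sum ws; apply: eq_bigr => b _.
    by rewrite -(functZ wl); congr w; exact: linearZ.
  rewrite /tensval big_map; under eq_bigr do rewrite (ex w1)// (ex w2)//.
  under eq_bigr do rewrite mulr_suml.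
  rewrite exchange_big; apply: eq_bigr => a _.
  under eq_bigr do rewrite mulr_suml.
  rewrite exchange_big; apply: eq_bigr => b _.
  under eq_bigr do rewrite mulr_sumr.
  rewrite exchange_big; apply: eq_bigr => c _.
  under eq_bigr do rewrite mulr_sumr.
  rewrite exchange_big; apply: eq_bigr => e _.
  by rewrite /mx_coef mulr_suml; apply: eq_bigr => p _; ring.
do 4![apply: le_trans (nrm_sum _ _) _; rewrite mulr_suml ler_sum// => ? _].
by rewrite nrmM mulrAC; apply: ler_wpM2r; rewrite ?nrm_ge0.
Qed.

Hypothesis phi_star : forall M, phi (M ^t*)%sesqui = star (phi M).

(** Passing from t to t^* t squares the norm exactly, at least squares the value by [tensval_sqr],
    and stays in the matrix algebra. So the crude constant cancels. *)
Lemma tensval_mx_bound m : nrm (tensval (mx_list m)) <= nrm (tenssum (mx_list m)).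
Proof.
have [K hK] := tensval_mx_crude.
have mstep m0 : exists m1, mx_list m1 = tmul (tstar (mx_list m0)) (mx_list m0).
  exists [seq ((p.1 ^t*)%sesqui * q.1, (p.2 ^t*)%sesqui * q.2) | p <- m0, q <- m0].
  rewrite /mx_list /tmul /tstar map_allpairs !allpairs_mapl allpairs_mapr.
  apply: eq_allpairs => // p q.
  by rewrite !rmorphM /= !phi_star.
have iter n : exists m1, nrm (tensval (mx_list m)) ^+ (2 ^ n) <= nrm (tensval (mx_list m1))
    /\ nrm (tenssum (mx_list m1)) = nrm (tenssum (mx_list m)) ^+ (2 ^ n).
  elim: n => [|n [m1 [h1 h2]]]; first by exists m; rewrite !expr1.
  have [m2 hm2] := mstep m1; exists m2; rewrite hm2 expnSr !exprM; split.
    apply: le_trans (tensval_sqr _).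
    by rewrite ler_pXn2r// ?nnegrE ?exprn_ge0 ?nrm_ge0.
  by rewrite tenssum_mul tenssum_star nrm_starM h2.
apply: (@pow2_le_cancel _ _ _ K); rewrite ?nrm_ge0// => n.
by have [m1 [h1 <-]] := iter n; exact: le_trans h1 (hK m1).
Qed.
End Matrices.
End ProductState.

Section ProductStateExtension.
Variables (R : realType) (A B : cstarAlgType R) (tens : A -> A -> B).
Local Notation C := R[i].
Hypotheses (tensP : is_tensor_square tens) (uhf : UHF A).
Variables w1 w2 : A -> C.
Hypotheses (w1S : state w1) (w2S : state w2).
Implicit Types s t : seq (A * A).

Let w1_lin : scalar w1. Proof. by case: w1S. Qed.
Let w2_lin : scalar w2. Proof. by case: w2S. Qed.
Let w1_pos x : 0 <= w1 (star x * x). Proof. by case: w1S => _ h _; exact: h. Qed.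
Let w2_pos x : 0 <= w2 (star x * x). Proof. by case: w2S => _ h _; exact: h. Qed.

Local Notation tv := (tensval w1 w2).
Local Notation ts := (tenssum tens).

(** All legs are moved into one matrix algebra of the UHF sequence, at a small cost both in norm and
    in value, and [tensval_mx_bound] applies there. *)
Lemma tensval_bound s : nrm (tv s) <= nrm (ts s).
Proof.
have [k [phi [_ phi_star phi_incr phi_dense]]] := uhf.
have incr m n : (m <= n)%N -> range (phi m) `<=` range (phi n).
  elim: n => [|n IH]; first by rewrite leqn0 => /eqP ->.
  by rewrite leq_eqVlt ltnS => /orP[/eqP -> //|/IH h] x /h /phi_incr.
pose inr n (p : A * A) := range (phi n) p.1 /\ range (phi n) p.2.
have approx x e : 0 < e -> exists n, exists2 x', range (phi n) x' & nrm (x - x') < e.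
  by move=> e0; have [x' [n _ hx] h] := closure_dense x phi_dense e0; exists n, x'.
have bilin (w : R) (x y x' y' : A) : nrm (x - x') * nrm y + nrm x' * nrm (y - y') <= w ->
    nrm (tens x y - tens x' y') <= w /\ nrm (w1 x * w2 y - w1 x' * w2 y') <= w.
  move=> h; split; apply: le_trans h.
    have -> : tens x y - tens x' y' = tens (x - x') y + tens x' (y - y').
      by rewrite tensBl// tensBr// addrA subrK.
    by apply: le_trans (nrmD _ _) _; rewrite lerD ?nrm_tens.
  have -> : w1 x * w2 y - w1 x' * w2 y' = w1 (x - x') * w2 y + w1 x' * w2 (y - y').
    by rewrite !functB//; ring.
  by apply: le_trans (nrmD _ _) _; rewrite !nrmM lerD// ler_pM ?nrm_ge0 ?state_bound.
have dense e : 0 < e -> exists n t, [/\ forall p, p \in t -> inr n p,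
    nrm (ts s - ts t) <= e & nrm (tv s - tv t) <= e].
  elim: s e => [|[x y] s IH] e e0.
    by exists 0%N, [::]; split=> //; rewrite subrr nrm0 ltW.
  have e2 : 0 < e / 2 by rewrite divr_gt0.
  have [n1 [t [ht h1 h2]]] := IH _ e2.
  have e4 : 0 < e / 2 / 2 by rewrite divr_gt0.
  have y0 : 0 < nrm y + 1 by rewrite ltr_wpDl ?nrm_ge0.
  have [n2 [x' rx' hx']] := approx x _ (divr_gt0 e4 y0).
  have x0 : 0 < nrm x' + 1 by rewrite ltr_wpDl ?nrm_ge0.
  (* y' comes after x', since its tolerance depends on the norm of x'. *)
  have [n3 [y' ry' hy']] := approx y _ (divr_gt0 e4 x0).
  have [] := bilin (e / 2) x y x' y'.
    rewrite [leRHS](splitr (e / 2)); apply: lerD.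
      move: hx'; rewrite ltr_pdivlMr// => hx'; apply: le_trans (ltW hx').
      by rewrite ler_wpM2l ?nrm_ge0// lerDl.
    move: hy'; rewrite ltr_pdivlMr// => hy'; apply: le_trans (ltW hy').
    by rewrite mulrC ler_wpM2l ?nrm_ge0// lerDl.
  move=> hT hW; exists (maxn n1 (maxn n2 n3)), ((x', y') :: t); split.
  - move=> p; rewrite inE => /orP[/eqP -> /=|/ht[/= h h']].
      by split; [apply: incr rx'|apply: incr ry']; rewrite !leq_max leqnn ?orbT.
    by split; [apply: incr h|apply: incr h']; rewrite !leq_max leqnn ?orbT.
  - rewrite /tenssum !big_cons /= opprD addrACA [leRHS](splitr e).
    by apply: le_trans (nrmD _ _) _; exact: lerD.
  - rewrite /tensval !big_cons /= opprD addrACA [leRHS](splitr e).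
    by apply: le_trans (nrmD _ _) _; exact: lerD.
apply/ler_addgt0Pr => e e0.
have e2 : 0 < e / 2 by rewrite divr_gt0.
have [n [t [ht h1 h2]]] := dense _ e2.
have [m tm] : exists m, t = mx_list (phi n) m.
  elim: t ht {h1 h2} => [|[x y] t IH] ht; first by exists [::].
  have [p pt|m ->] := IH; first by apply: ht; rewrite inE pt orbT.
  have [[M _ /= <-] [N _ /= <-]] := ht _ (mem_head _ _).
  by exists ((M, N) :: m).
have w1_1 : w1 1 = 1 by case: w1S.
have w2_1 : w2 1 = 1 by case: w2S.
have := tensval_mx_bound tensP w1_lin w2_lin w1_pos w2_pos w1_1 w2_1 (phi_star n) m.
rewrite -tm => h.
have := nrm_le_dist (tv s) (tv t); have := nrm_le_dist (ts t) (ts s).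
rewrite (nrmC (ts t)).
have := splitr e; lra.
Qed.

Lemma product_state : exists phi : B -> C,
  state phi /\ forall x y, phi (tens x y) = w1 x * w2 y.
Proof.
have tvalB s t : nrm (tv s - tv t) <= nrm (ts s - ts t).
  have := tensval_bound (s ++ tscale (-1) t).
  by rewrite tensval_cat tenssum_cat tensval_scale// tenssum_scale// mulN1r scaleN1r.
(* Extension by uniform continuity: c is the limit of the values along sums converging to z.
   Comparing c with every s is what determines it in [uniq]. *)
have ext z : exists c, forall s, nrm (tv s - c) <= nrm (ts s - z).
  have pick n : exists s, nrm (z - ts s) < n.+1%:R^-1.
    by apply: tenssum_dense => //; rewrite invr_gt0.
  have [u hu] := choice pick.
  have cu : cvs (ts \o u) z.
    move=> e e0; exists (Num.bound e^-1) => n Nn; rewrite nrmC; apply: lt_le_trans (hu n) _.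
    rewrite invf_ple ?posrE//; apply: le_trans (_ : (Num.bound e^-1)%:R <= _).
      by rewrite ltW// archi_boundP// invr_ge0 ltW.
    by rewrite ler_nat leqW.
  have : cauchy_sequence (tv \o u : nat -> C^o).
    move=> e /(cvs_cauchy cu) [N hN]; exists N => m n Nm Nn.
    exact: le_lt_trans (tvalB _ _) (hN m n Nm Nn).
  move=> /complete_complex [c hc]; exists c => s.
  have h1 : cvs (fun n => tv s - tv (u n) : C^o) (tv s - c).
    by apply: (cvs_lip (f := fun x : C^o => tv s - x) (K := 1) _ hc) => x;
      rewrite opprB addrC subrKA nrmC mul1r.
  apply/ler_addgt0Pr => e e0; have [N hN] := cu e e0.
  apply: (cvs_le (N := N) h1) => n Nn.
  apply: le_trans (tvalB _ _) _; apply: le_trans (nrm_trans z _ _) _.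
  by rewrite lerD2l nrmC ltW// hN.
have [phi hphi] := choice ext.
have uniq z c : (forall e, 0 < e -> exists s, nrm (ts s - z) <= e /\ nrm (tv s - c) <= e) ->
    phi z = c.
  move=> h; apply/eqP; rewrite -subr_eq0; apply/eqP; apply: nrm_le_small => e e0.
  have [|s [h1 h2]] := h (e / 2); first by rewrite divr_gt0.
  apply: le_trans (nrm_trans (tv s) _ _) _; rewrite [leRHS](splitr e) lerD//.
  by rewrite nrmC; apply: le_trans (hphi z s) _.
have phi_tsum s : phi (ts s) = tv s.
  by apply: uniq => e e0; exists s; rewrite !subrr !nrm0 ltW.
have phi_tens x y : phi (tens x y) = w1 x * w2 y.
  by have := phi_tsum [:: (x, y)]; rewrite /tenssum /tensval !big_seq1.
have phi_lin : scalar phi.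
  move=> a z z'; apply: uniq => e e0.
  have a0 : 0 < nrm a + 1 by rewrite ltr_wpDl ?nrm_ge0.
  have e2 : 0 < e / 2 by rewrite divr_gt0.
  have [s hs] := tenssum_dense tensP z (divr_gt0 e2 a0).
  have [s' hs'] := tenssum_dense tensP z' e2.
  have ae : nrm a * (e / 2 / (nrm a + 1)) <= e / 2.
    by rewrite mulrCA ler_piMr ?(ltW e2)// ler_pdivrMr// mul1r lerDl.
  exists (tscale a s ++ s'); rewrite tenssum_cat tensval_cat tenssum_scale// tensval_scale//.
  rewrite [leRHS](splitr e) !opprD !(addrACA _ _ (- _)) -scalerBr -mulrBr; split.
    apply: le_trans (nrmD _ _) _; rewrite lerD//; last by rewrite nrmC ltW.
    rewrite nrmZ; apply: le_trans ae; rewrite ler_wpM2l ?nrm_ge0//.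
    by rewrite nrmC ltW.
  rewrite [leRHS](splitr e); apply: le_trans (nrmD _ _) _; rewrite lerD//.
    rewrite nrmM; apply: le_trans ae; rewrite ler_wpM2l ?nrm_ge0//.
    by apply: le_trans (hphi z s) _; rewrite nrmC ltW.
  by apply: le_trans (hphi z' s') _; rewrite nrmC ltW.
have phi_bound z : nrm (phi z) <= nrm z.
  apply/ler_addgt0Pr => e e0.
  have e2 : 0 < e / 2 by rewrite divr_gt0.
  have [s hs] := tenssum_dense tensP z e2.
  have := nrm_le_dist (phi z) (tv s); have := nrm_le_dist (ts s) z.
  have := hphi z s; rewrite (nrmC (phi z)); move: hs; rewrite (nrmC z).
  have := tensval_bound s; have := splitr e; lra.
exists phi; split; last exact: phi_tens.
split=> [|z|]; first exact: phi_lin.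
- suff near_pos (c : C) : (forall e : R, 0 < e -> exists2 c', 0 <= c' & nrm (c - c') <= e) -> 0 <= c.
    apply: near_pos => e e0.
    pose K := nrm z + 1 + nrm z; have K0 : 0 < K.
      by rewrite /K; have := nrm_ge0 z; lra.
    (* As d <= 1, the approximant x has norm at most |z| + 1, so z^* z and x^* x differ by at most d
       K <= e. *)
    pose d := Num.min 1 (e / K); have d0 : 0 < d by rewrite lt_min ltr01 divr_gt0.
    have [s hs] := tenssum_dense tensP z d0.
    exists (tv (tmul (tstar s) s)); first exact: (gram_ge0 w1_lin w2_lin w1_pos w2_pos).
    rewrite -phi_tsum -(functB phi_lin); apply: le_trans (phi_bound _) _.
    rewrite tenssum_mul// tenssum_star//; set x := ts s in hs *.
    have -> : star z * z - star x * x = star (z - x) * z + star x * (z - x).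
      by rewrite starB mulrBl mulrBr addrA subrK.
    have x1 : nrm x <= nrm z + 1.
      have := nrm_le_dist x z; rewrite nrmC.
      by move: hs; rewrite lt_min => /andP[]; lra.
    apply: le_trans (_ : d * nrm z + (nrm z + 1) * d <= _).
      apply: le_trans (nrmD _ _) _; apply: lerD; apply: le_trans (nrm_mul _ _) _.
        by rewrite nrm_star ler_wpM2r ?nrm_ge0// ltW.
      by rewrite nrm_star ler_pM ?nrm_ge0// ltW.
    have -> : d * nrm z + (nrm z + 1) * d = d * K by rewrite /K; ring.
    by rewrite -ler_pdivlMr// /d ge_min lexx orbT.
  move=> h; have hRe : 0 <= complex.Re c.
    apply/ler_addgt0Pr => e e0; have [c' c'0 hc] := h e e0.
    have := le_trans (Re_le_nrm (c' - c)) (_ : nrm (c' - c) <= e).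
    rewrite nrmC => /(_ hc); rewrite raddfB /=.
    by move: c'0; rewrite lecE /= => /andP[_]; lra.
  have hIm : complex.Im c = 0.
    apply/eqP; rewrite -normr_eq0 eq_le normr_ge0 andbT.
    apply/ler_addgt0Pr => e e0; have [c' c'0 hc] := h e e0.
    rewrite add0r; apply: le_trans hc; apply: le_trans (Im_le_nrm _).
    by rewrite raddfB /= (ger0_Im c'0) subr0.
  by rewrite lecE /= hIm eqxx.
- have h := phi_tens 1 1; rewrite (tensor1 tensP) in h; rewrite h.
  by case: w1S w2S => _ _ -> [_ _ ->]; rewrite mulr1.
Qed.
End ProductStateExtension.

(** * Midpoint integrals and Goursat's lemma *)

Section Bisection.
Variable R : realType.
Local Notation itv := (R * R)%type.
Implicit Types (I J : itv) (b : bool).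

Definition mid I : R := (I.1 + I.2) / 2.
Definition half b I : itv := if b then (mid I, I.2) else (I.1, mid I).
Definition len I : R := I.2 - I.1.
Definition inI I (x : R) : Prop := I.1 <= x <= I.2.

Lemma len_half b I : len (half b I) = len I / 2.
Proof. by case: b; rewrite /len /= /mid; field. Qed.

Lemma half_nested b I : I.1 <= I.2 ->
  [/\ I.1 <= (half b I).1, (half b I).1 <= (half b I).2 & (half b I).2 <= I.2].
Proof. by case: b; rewrite /= /mid => h; split; lra. Qed.

Lemma nested_halves (u : nat -> itv) : (u 0%N).1 <= (u 0%N).2 ->
  (forall n, exists b, u n.+1 = half b (u n)) ->
  exists x, forall n, [/\ inI (u n) x, len (u n) = len (u 0%N) / 2 ^+ n,
    (u 0%N).1 <= (u n).1, (u n).1 <= (u n).2 & (u n).2 <= (u 0%N).2].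
Proof.
move=> u0 hu.
have le n : (u n).1 <= (u n).2.
  by elim: n => // n IH; have [b ->] := hu n; case: (half_nested b IH).
have mono n k : (u n).1 <= (u (n + k)%N).1 /\ (u (n + k)%N).2 <= (u n).2.
  elim: k => [|k [h1 h2]]; first by rewrite addn0.
  rewrite addnS; have [b ->] := hu (n + k)%N.
  have [h3 _ h4] := half_nested b (le (n + k)%N).
  by split; [exact: le_trans h3|exact: le_trans h2].
have cross m n : (u m).1 <= (u n).2.
  have [h1 _] := mono m n; have [_ h2] := mono n m.
  by apply: le_trans h1 (le_trans (le _) _); rewrite addnC.
pose E := range (fun n => (u n).1).
exists (sup E) => n.
have h0 := mono 0%N n; rewrite add0n in h0.
have hn : len (u n) = len (u 0%N) / 2 ^+ n.
  elim: n {h0} => [|n IH]; first by rewrite expr0 divr1.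
  by have [b ->] := hu n; rewrite len_half IH exprS invfM mulrA mulrAC.
split; rewrite ?le//; [|by case: h0|by case: h0].
apply/andP; split.
  apply: ub_le_sup; last by exists n.
  by exists (u 0%N).2 => _ [m _ <-]; exact: cross.
apply: ge_sup; first by exists (u 0%N).1, 0%N.
by move=> _ [m _ <-]; exact: cross.
Qed.

(** A failure of P persists in some quarter, and the failing rectangles shrink to a point, against
    the local hypothesis. This form of compactness yields uniform continuity, Goursat's lemma and,
    with a degenerate second interval, uniformity in one variable. *)
Lemma bisection (P : itv -> itv -> Prop) (I0 J0 : itv) :
  I0.1 <= I0.2 -> J0.1 <= J0.2 ->
  (forall I J, I.1 <= I.2 -> J.1 <= J.2 ->
    (forall b c, P (half b I) (half c J)) -> P I J) ->
  (forall x y, inI I0 x -> inI J0 y -> exists2 d, 0 < d & forall I J,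
    [/\ I0.1 <= I.1, inI I x & I.2 <= I0.2] -> [/\ J0.1 <= J.1, inI J y & J.2 <= J0.2] ->
    len I < d -> len J < d -> P I J) ->
  P I0 J0.
Proof.
move=> hI hJ hsub hloc; apply: contrapT => nP.
(* The conditions stand under the existential so that [choice] gives a function on all pairs of
   intervals. *)
have step (Q : itv * itv) : exists bc : bool * bool,
    Q.1.1 <= Q.1.2 -> Q.2.1 <= Q.2.2 -> ~ P Q.1 Q.2 -> ~ P (half bc.1 Q.1) (half bc.2 Q.2).
  apply: contrapT => h; have h' bc : ~ (Q.1.1 <= Q.1.2 -> Q.2.1 <= Q.2.2 ->
    ~ P Q.1 Q.2 -> ~ P (half bc.1 Q.1) (half bc.2 Q.2)) by move=> e; apply: h; exists bc.
  have /not_implyP[h1 /not_implyP[h2 /not_implyP[h3 _]]] := h' (true, true).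
  apply: h3; apply: hsub => // b c.
  by have /not_implyP[_ /not_implyP[_ /not_implyP[_ /contrapT]]] := h' (b, c).
have [f hf] := choice step.
pose q := fix q n := if n is n'.+1 then
  (half (f (q n')).1 (q n').1, half (f (q n')).2 (q n').2) else (I0, J0).
have [x hx] := @nested_halves (fun n => (q n).1) hI (fun n => ex_intro _ _ erefl).
have [y hy] := @nested_halves (fun n => (q n).2) hJ (fun n => ex_intro _ _ erefl).
have nPq n : ~ P (q n).1 (q n).2.
  elim: n => [//|n IH]; apply: hf IH; first by case: (hx n).
  by case: (hy n).
have [hx0 hy0] : inI I0 x /\ inI J0 y by have [? _ _ _ _] := hx 0%N; have [? _ _ _ _] := hy 0%N.
have [d d0 hd] := hloc x y hx0 hy0.
have small (a : R) : exists N, forall n, (N <= n)%N -> a / 2 ^+ n < d.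
  have [||N hN] := @geometric_small R 2^-1 a d _ _ d0.
  - by rewrite invr_ge0.
  - by rewrite invf_lt1// ltr1n.
  by exists N => n /hN; rewrite exprVn.
have [N1 h1] := small (len I0); have [N2 h2] := small (len J0).
apply: (nPq (maxn N1 N2)); apply: hd.
- by have [? _ ? _ ?] := hx (maxn N1 N2).
- by have [? _ ? _ ?] := hy (maxn N1 N2).
- by have [_ -> _ _ _] := hx (maxn N1 N2); apply: h1; exact: leq_maxl.
- by have [_ -> _ _ _] := hy (maxn N1 N2); apply: h2; exact: leq_maxr.
Qed.
End Bisection.

Section Continuity.
Variable R : realType.
Local Notation C := R[i].

Definition cont2 (V : normedZmodType C) (G : R -> R -> V) : Prop :=
  forall t s (e : R), 0 < e -> exists2 d : R, 0 < d &
    forall t' s', `|t' - t| < d -> `|s' - s| < d -> nrm (G t' s' - G t s) < e.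

(** Only t and s are confined to the rectangle, not t' and s'. Thus the moduli of the four quarters
    combine by a minimum, even across common edges. *)
Lemma cont2_uniform (V : normedZmodType C) (G : R -> R -> V) (I J : R * R) (e : R) :
  cont2 G -> I.1 <= I.2 -> J.1 <= J.2 -> 0 < e -> exists2 d : R, 0 < d &
    forall t s t' s', inI I t -> inI J s -> `|t' - t| < d -> `|s' - s| < d ->
      nrm (G t' s' - G t s) < e.
Proof.
move=> hG hI hJ e0.
apply: (@bisection R (fun I J => exists2 d : R, 0 < d &
    forall t s t' s', inI I t -> inI J s -> `|t' - t| < d -> `|s' - s| < d ->
      nrm (G t' s' - G t s) < e)) => // [{}I {}J {}hI {}hJ h|x y hx hy].
  have [d1 d10 h1] := h false false; have [d2 d20 h2] := h false true.
  have [d3 d30 h3] := h true false; have [d4 d40 h4] := h true true.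
  exists (Num.min (Num.min d1 d2) (Num.min d3 d4)); first by rewrite !lt_min d10 d20 d30 d40.
  move=> t s t' s' /andP[t1 t2] /andP[s1 s2].
  rewrite !lt_min => /andP[/andP[a1 a2] /andP[a3 a4]] /andP[/andP[b1 b2] /andP[b3 b4]].
  have [tm|tm] := leP t (mid I); have [sm|sm] := leP s (mid J).
  - by apply: h1; rewrite // /inI ?t1 ?s1.
  - by apply: h2; rewrite // /inI ?t1 ?s2 ?(ltW sm).
  - by apply: h3; rewrite // /inI ?t2 ?s1 ?(ltW tm).
  - by apply: h4; rewrite // /inI ?t2 ?s2 ?(ltW tm) ?(ltW sm).
have e2 : 0 < e / 2 by rewrite divr_gt0.
have [d d0 hd] := hG x y _ e2.
have d2 : 0 < d / 2 by rewrite divr_gt0.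
exists (d / 2) => // I' J' [_ /andP[i1 i2] _] [_ /andP[j1 j2] _]; rewrite /len => li lj.
exists (d / 2) => // t s t' s' /andP[t1 t2] /andP[s1 s2] ht hs.
apply: le_lt_trans (nrm_trans (G x y) _ _) _; rewrite [ltRHS](splitr e) ltrD//.
  apply: hd.
    apply: le_lt_trans (ler_distD t _ _) _; rewrite [ltRHS](splitr d) ltrD//.
    by rewrite ltr_norml; apply/andP; split; lra.
  apply: le_lt_trans (ler_distD s _ _) _; rewrite [ltRHS](splitr d) ltrD//.
  by rewrite ltr_norml; apply/andP; split; lra.
by rewrite nrmC; apply: hd; rewrite ltr_norml; apply/andP; split; lra.
Qed.

Lemma cont_uniform (V : normedZmodType C) (g : R -> V) (I : R * R) (e : R) :
  cont g -> I.1 <= I.2 -> 0 < e -> exists2 d : R, 0 < d &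
    forall t t', inI I t -> `|t' - t| < d -> nrm (g t' - g t) < e.
Proof.
move=> hg hI e0.
have [||||d d0 hd] := @cont2_uniform V (fun t _ => g t) I (0, 0) e => //.
  by move=> t s e' /(hg t)[d d0 hd]; exists d => // t' s' ht _; exact: hd.
by exists d => // t t' ht h; apply: (hd t 0 t' 0); rewrite // /inI ?lexx// subrr normr0.
Qed.
End Continuity.

Section Riemann.
Variables (R : realType).
Local Notation C := R[i].

(* Dyadic midpoint sums are additive under halving of [a, b] and exact on affine functions. *)
Fixpoint riem (V : normedModType C) (g : R -> V) (n : nat) (a b : R) : V :=
  if n is n'.+1 then riem g n' a ((a + b) / 2) + riem g n' ((a + b) / 2) b
  else (b - a)%:C *: g ((a + b) / 2).

Section Module.
Variable V : normedModType C.
Implicit Types (g h : R -> V) (a b : R).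

Lemma mid_ltr a b : a <= b -> a <= (a + b) / 2 /\ (a + b) / 2 <= b.
Proof. by move=> h; split; lra. Qed.

Lemma riem_lin k g h n a b :
  riem (fun t => k *: g t + h t) n a b = k *: riem g n a b + riem h n a b.
Proof.
elim: n a b => [|n IH] a b /=; first by rewrite scalerDr !scalerA mulrC.
by rewrite !IH scalerDr addrACA.
Qed.

Lemma riem_sub g h n a b :
  riem (fun t => g t - h t) n a b = riem g n a b - riem h n a b.
Proof.
elim: n a b => [|n IH] a b /=; first by rewrite scalerBr.
by rewrite !IH opprD addrACA.
Qed.

Lemma riem_affine (p q : V) n a b :
  riem (fun t => p + t%:C *: q) n a b = (b - a)%:C *: (p + ((a + b) / 2)%:C *: q).
Proof.
elim: n a b => [//|n IH] a b /=; rewrite !IH !scalerDr addrACA -!scalerDl !scalerA -scalerDl.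
by congr (_ *: _ + _ *: _); rewrite -?rmorphM -rmorphD; congr (_%:C); field.
Qed.

Lemma riem_bound g (f : R -> R) n a b : a <= b ->
  (forall t, a <= t <= b -> nrm (g t) <= f t) ->
  nrm (riem g n a b) <= complex.Re (riem (fun t => (f t)%:C : C^o) n a b).
Proof.
elim: n a b => [|n IH] a b ab gf /=; have [m1 m2] := mid_ltr ab.
  rewrite mulr0 subr0 nrmZr ger0_norm ?subr_ge0//.
  by rewrite ler_wpM2l ?subr_ge0// gf// m1 m2.
rewrite raddfD /=; apply: le_trans (nrmD _ _) _; apply: lerD; apply: IH => // t /andP[h1 h2];
  by apply: gf; rewrite ?(le_trans m1 h1) ?(le_trans h2 m2) ?h1 ?h2.
Qed.

Lemma riem_cst (K : R) n a b : riem (fun=> K%:C : C^o) n a b = ((b - a) * K)%:C.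
Proof.
elim: n a b => [|n IH] a b /=; first by rewrite rmorphM.
by rewrite !IH -rmorphD; congr (_%:C); field.
Qed.

Lemma riem_le_cst g (K : R) n a b : a <= b ->
  (forall t, a <= t <= b -> nrm (g t) <= K) -> nrm (riem g n a b) <= (b - a) * K.
Proof. by move=> ab h; have := @riem_bound g (fun=> K) n a b ab h; rewrite riem_cst. Qed.

(** Each sample of level n + k lies in the same piece of length (b - a) / 2^n as one midpoint of
    level n. For n = 0 the single midpoint value is itself a sum of level k of a constant. *)
Lemma riem_refine g (e : R) n k a b : a <= b ->
  (forall x y, a <= x <= b -> a <= y <= b -> `|x - y| <= (b - a) / 2 ^+ n ->
    nrm (g x - g y) <= e) ->
  nrm (riem g (n + k) a b - riem g n a b) <= (b - a) * e.
Proof.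
elim: n a b => [|n IH] a b ab h /=; have [m1 m2] := mid_ltr ab.
  rewrite add0n expr0 divr1 in h *.
  have -> : (b - a)%:C *: g ((a + b) / 2) = riem (fun=> g ((a + b) / 2)) k a b.
    elim: k a b {ab h m1 m2} (g _) => [//|k IHk] a b v /=.
    by rewrite -!IHk -scalerDl -rmorphD; congr (_%:C *: _); ring.
  rewrite -riem_sub; apply: riem_le_cst => // t /andP[h1 h2].
  apply: h; rewrite ?h1 ?h2 ?m1 ?m2// ler_norml; apply/andP; split; lra.
rewrite opprD addrACA; have -> : (b - a) * e = ((a + b) / 2 - a) * e + (b - (a + b) / 2) * e.
  by ring.
have hm : (b - a) / 2 ^+ n.+1 = (b - a) / 2 / 2 ^+ n by rewrite exprS invfM mulrA.
apply: le_trans (nrmD _ _) _; apply: lerD; apply: IH => // x y /andP[x1 x2] /andP[y1 y2] xy.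
  apply: h; rewrite ?x1 ?y1 ?(le_trans x2 m2) ?(le_trans y2 m2)//.
  by rewrite hm; apply: le_trans xy _; rewrite le_eqVlt; apply/orP; left; apply/eqP;
    congr (_ / _); field.
apply: h; rewrite ?x2 ?y2 ?(le_trans m1 x1) ?(le_trans m1 y1)//.
by rewrite hm; apply: le_trans xy _; rewrite le_eqVlt; apply/orP; left; apply/eqP;
  congr (_ / _); field.
Qed.

Definition is_int g a b (l : V) : Prop := cvs (fun n => riem g n a b) l.

Lemma int_exists g a b : seq_complete V -> cont g -> a <= b -> exists l, is_int g a b l.
Proof.
move=> cV hg ab; apply: cV => e e0.
pose K := b - a + 1; have K0 : 0 < K by rewrite /K; lra.
have eK : 0 < e / K / 2 by rewrite !divr_gt0.
have [d d0 hd] := @cont_uniform R V g (a, b) _ hg ab eK.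
have [||N hN] := @geometric_small R 2^-1 (b - a) d _ _ d0.
- by rewrite invr_ge0.
- by rewrite invf_lt1// ltr1n.
have key n : (N <= n)%N -> nrm (riem g n a b - riem g N a b) < e / 2.
  move=> Nn; rewrite -(subnKC Nn).
  apply: le_lt_trans (_ : (b - a) * (e / K / 2) < _).
    apply: riem_refine => // x y hx hy xy; apply: ltW; apply: hd => //.
    by apply: le_lt_trans xy _; have := hN N (leqnn _); rewrite exprVn.
  rewrite mulrA ltr_pM2r ?invr_gt0// mulrCA -[ltRHS]mulr1 ltr_pM2l//.
  by rewrite ltr_pdivrMr// mul1r /K; lra.
exists N => m n Nm Nn; apply: le_lt_trans (nrm_trans (riem g N a b) _ _) _.
by rewrite [ltRHS](splitr e) ltrD ?key// nrmC key.
Qed.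
End Module.

Lemma riem_map (V W : normedModType C) (f : V -> W) (g : R -> V) n a b :
  linear f -> f (riem g n a b) = riem (f \o g) n a b.
Proof.
move=> hf; elim: n a b => [|n IH] a b /=; first by rewrite linZ.
by rewrite (linD hf) !IH.
Qed.
End Riemann.

Section Goursat.
Variables (R : realType) (G : R -> R -> (R[i])^o) (kappa : R[i]).
Local Notation C := R[i].
Implicit Types (I J : R * R).

(* Sums for the integral of G along the boundary of I x J, where G is thought of as a
   function of z = t + kappa s. *)
Definition contour (n : nat) I J : C :=
  riem (fun t => G t J.1) n I.1 I.2 - riem (fun t => G t J.2) n I.1 I.2 +
  kappa * (riem (fun s => G I.2 s) n J.1 J.2 - riem (fun s => G I.1 s) n J.1 J.2).

Definition cdiff (t s : R) : Prop := exists l : C, forall e : R, 0 < e ->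
  exists2 d : R, 0 < d & forall t' s', `|t' - t| < d -> `|s' - s| < d ->
    nrm (G t' s' - G t s - l * ((t' - t)%:C + kappa * (s' - s)%:C)) <=
    e * (`|t' - t| + `|s' - s|).

(** The inner edges cancel exactly at every finite level, because the sums are additive under
    halving. *)
Lemma contour_split n I J :
  contour n.+1 I J = \sum_(b : bool) \sum_(c : bool) contour n (half b I) (half c J).
Proof.
by rewrite !big_bool /= /contour /half /mid /=; ring.
Qed.

Lemma contour_local n I J x y (g0 l : C) (e : R) : I.1 <= I.2 -> J.1 <= J.2 ->
  (forall t s, inI I t -> inI J s ->
    nrm (G t s - g0 - l * ((t - x)%:C + kappa * (s - y)%:C)) <= e) ->
  nrm (contour n I J) <= 2 * (1 + nrm kappa) * e * (len I + len J).
Proof.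
move=> hI hJ hE.
pose F t s : C^o := g0 + l * ((t - x)%:C + kappa * (s - y)%:C).
have Fh s n' a b : riem (fun t => F t s) n' a b =
    (b - a)%:C * (g0 + l * (kappa * (s - y)%:C - x%:C) + ((a + b) / 2)%:C * l).
  transitivity (riem (fun t => (g0 + l * (kappa * (s - y)%:C - x%:C) : C^o) +
    t%:C *: (l : C^o)) n' a b); last exact: riem_affine.
  by congr riem; apply: funext => t; rewrite /F -[_ *: _]/(_ * _) rmorphB /=; ring.
have Fv t n' a b : riem (fun s => F t s) n' a b =
    (b - a)%:C * (g0 + l * ((t - x)%:C - kappa * y%:C) + ((a + b) / 2)%:C * (l * kappa)).
  transitivity (riem (fun s => (g0 + l * ((t - x)%:C - kappa * y%:C) : C^o) +
    s%:C *: (l * kappa : C^o)) n' a b); last exact: riem_affine.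
  by congr riem; apply: funext => s; rewrite /F -[_ *: _]/(_ * _) (rmorphB _ s) /=; ring.
pose D t s : C^o := G t s - F t s.
have hD t s : inI I t -> inI J s -> nrm (D t s) <= e.
  by move=> ht hs; rewrite /D /F opprD addrA; exact: hE.
(* The affine part F contributes nothing, midpoint sums being exact on it; only the remainder D is
   summed along the perimeter. *)
have -> : contour n I J = riem (fun t => D t J.1) n I.1 I.2 - riem (fun t => D t J.2) n I.1 I.2 +
  kappa * (riem (fun s => D I.2 s) n J.1 J.2 - riem (fun s => D I.1 s) n J.1 J.2).
  rewrite !riem_sub !Fh !Fv /contour.
  have h2 : (2%:R : R)%:C = 2 :> C by rewrite rmorph_nat.
  rewrite !(rmorphB, rmorphM, fmorphV) /= !(rmorphD _ I.1) !(rmorphD _ J.1) /= h2.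
  by field.
have e0 : 0 <= e.
  by apply: le_trans (nrm_ge0 _) (hD I.1 J.1 _ _); rewrite /inI lexx.
have hh s : inI J s -> nrm (riem (fun t => D t s) n I.1 I.2) <= len I * e.
  by move=> hs; apply: riem_le_cst => // t ht; exact: hD.
have hv t : inI I t -> nrm (riem (fun s => D t s) n J.1 J.2) <= len J * e.
  by move=> ht; apply: riem_le_cst => // s hs; exact: hD.
have h1 := hh J.1; have h2 := hh J.2; have h3 := hv I.1; have h4 := hv I.2.
rewrite /inI !lexx ?hI ?hJ in h1 h2 h3 h4.
move: (h1 isT) (h2 isT) (h3 isT) (h4 isT) => {}h1 {}h2 {}h3 {}h4.
have k0 := nrm_ge0 kappa.
apply: le_trans (_ : 2 * (len I * e) + nrm kappa * (2 * (len J * e)) <= _); last first.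
  have : 0 <= len I * e by rewrite mulr_ge0// /len subr_ge0.
  have : 0 <= len J * e by rewrite mulr_ge0// /len subr_ge0.
  by move=> a b; have : 0 <= nrm kappa * (len I * e); [rewrite mulr_ge0|nra].
apply: le_trans (nrmD _ _) _; apply: lerD.
  by apply: le_trans (nrmB _ _) _; lra.
rewrite nrmM ler_wpM2l//; apply: le_trans (nrmB _ _) _; lra.
Qed.

(** The squared lengths play the role of the area: those of the four quarters add up to those of the
    rectangle, so the bound passes from quarters to the whole, and near each point it follows from
    differentiability. *)
Lemma goursat I J : I.1 <= I.2 -> J.1 <= J.2 ->
  (forall t s, inI I t -> inI J s -> cdiff t s) -> cvs (fun n => contour n I J : C) 0.
Proof.
move=> hI hJ hd e e0.
have k0 : 0 < 1 + nrm kappa by rewrite ltr_pwDl ?nrm_ge0.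
pose w := len I ^+ 2 + len J ^+ 2 + 1.
have w0 : 0 < w by rewrite /w; have := sqr_ge0 (len I); have := sqr_ge0 (len J); lra.
suff [N hN] : exists N, forall n, (N <= n)%N ->
    nrm (contour n I J) <= e / w * (len I ^+ 2 + len J ^+ 2).
  exists N => n /hN h; rewrite subr0; apply: le_lt_trans h _.
  by rewrite mulrAC ltr_pdivrMr// ltr_pM2l// /w; lra.
have {}e0 : 0 < e / w by rewrite divr_gt0.
move: (e / w) e0 => {w0 w}e e0.
apply: (@bisection R (fun I J => exists N, forall n, (N <= n)%N ->
    nrm (contour n I J) <= e * (len I ^+ 2 + len J ^+ 2))) => //.
- move=> {hd hI hJ I J} I J hI hJ h.
  have [N1 h1] := h true true; have [N2 h2] := h true false.
  have [N3 h3] := h false true; have [N4 h4] := h false false.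
  (* The extra level is the one that [contour_split] consumes. *)
  exists (maxn (maxn N1 N2) (maxn N3 N4)).+1 => -[//|n].
  rewrite ltnS !geq_max => /andP[/andP[n1 n2] /andP[n3 n4]].
  rewrite contour_split !big_bool /=.
  have {h1}h1 := h1 _ n1; have {h2}h2 := h2 _ n2; have {h3}h3 := h3 _ n3; have {h4}h4 := h4 _ n4.
  rewrite !len_half in h1 h2 h3 h4.
  apply: le_trans (nrmD _ _) _; apply: le_trans (lerD (nrmD _ _) (nrmD _ _)) _.
  apply: le_trans (lerD (lerD h1 h2) (lerD h3 h4)) _.
  by rewrite le_eqVlt; apply/orP; left; apply/eqP; field.
- move=> x y hx hy; have [l hl] := hd x y hx hy.
  (* With this tolerance [contour_local] gives e (len I' + len J')^2 / 2, which is at most e times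
     the sum of the squared lengths. *)
  have e'0 : 0 < e / (4 * (1 + nrm kappa)) by rewrite divr_gt0// mulr_gt0.
  have [d d0 hd'] := hl _ e'0; exists d => // I' J' [i1 i2 i3] [j1 j2 j3] li lj.
  have [hI' hJ'] : I'.1 <= I'.2 /\ J'.1 <= J'.2.
    by move: i2 j2 => /andP[a b] /andP[a' b']; split; [exact: le_trans b|exact: le_trans b'].
  have bound t s : inI I' t -> inI J' s -> `|t - x| <= len I' /\ `|s - y| <= len J'.
    move: i2 j2 => /andP[a1 a2] /andP[a3 a4] /andP[b1 b2] /andP[b3 b4].
    by rewrite /len !ler_norml; split; apply/andP; split; lra.
  exists 0%N => n _.
  apply: le_trans (contour_local (x := x) (y := y) (g0 := G x y) (l := l)
    (e := e / (4 * (1 + nrm kappa)) * (len I' + len J')) n hI' hJ' _) _.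
    move=> t s ht hs; have [b1 b2] := bound t s ht hs.
    apply: le_trans (hd' _ _ (le_lt_trans b1 li) (le_lt_trans b2 lj)) _.
    by rewrite ler_wpM2l ?(ltW e'0)// lerD.
  have -> : 2 * (1 + nrm kappa) * (e / (4 * (1 + nrm kappa)) * (len I' + len J')) *
    (len I' + len J') = e * ((len I' + len J') ^+ 2 / 2) by field; rewrite lt0r_neq0.
  rewrite ler_wpM2l ?(ltW e0)//; have := sqr_ge0 (len I' - len J'); lra.
Qed.
End Goursat.

(** Holomorphy holds only for 0 < s < 1, so the horizontal edges are moved inwards by h, and s and
    [kappa] are rescaled to keep the rectangle I x [0, 1]. Uniform continuity controls the change of
    G, and M that of [kappa]. *)
Lemma goursat_boundary (R : realType) (G : R -> R -> (R[i])^o) (kappa : R[i]) (I : R * R) (M : R) :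
  I.1 <= I.2 -> cont2 G -> (forall t s, nrm (G t s) <= M) ->
  (forall t s, 0 < s < 1 -> cdiff G kappa t s) ->
  cvs (fun n => contour G kappa n I (0, 1) : R[i]) 0.
Proof.
move=> hI hG hM hd e e0.
have M0 : 0 <= M by exact: le_trans (nrm_ge0 _) (hM 0 0).
have k0 := nrm_ge0 kappa.
have lI : 0 <= len I by rewrite subr_ge0.
(* The three terms come from the horizontal edges, the vertical edges and the error 2 h in the
   factor of [kappa], where h <= e1. *)
pose K := 2 * len I + 2 * nrm kappa + 4 * nrm kappa * M + 1.
have kM : 0 <= nrm kappa * M by rewrite mulr_ge0.
have K0 : 0 < K by rewrite /K; lra.
pose e1 := e / 2 / K; have e10 : 0 < e1 by rewrite !divr_gt0.
have [d d0 hu] := @cont2_uniform R _ G I (0, 1) e1 hG hI ler01 e10.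
pose h := Num.min (4^-1) (Num.min (d / 2) e1).
have h0 : 0 < h by rewrite !lt_min invr_gt0 divr_gt0// e10 ltr0n.
have h4 : h <= 4^-1 by rewrite ge_min lexx.
have hd2 : h < d.
  apply: le_lt_trans (_ : d / 2 < _); first by rewrite !ge_min lexx orbT.
  by rewrite ltr_pdivrMr// ltr_pMr// ltr1n.
have he1 : h <= e1 by rewrite !ge_min lexx !orbT.
pose G' t s := G t (h + (1 - 2 * h) * s).
have := @goursat R G' (kappa * (1 - 2 * h)%:C) I (0, 1) hI ler01 _ (e / 2).
case=> [t s _ /andP[/= s0 s1]||N hN].
- have hc : 0 < 1 - 2 * h by lra.
  have [|l hl] := hd t (h + (1 - 2 * h) * s).
    by apply/andP; split; nra.
  exists l => e' e'0; have [d' d'0 hd'] := hl e' e'0.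
  exists d' => // t' s' ht hs; rewrite /G'.
  have es : h + (1 - 2 * h) * s' - (h + (1 - 2 * h) * s) = (1 - 2 * h) * (s' - s) by ring.
  have es' : `|h + (1 - 2 * h) * s' - (h + (1 - 2 * h) * s)| <= `|s' - s|.
    by rewrite es normrM ler_piMl// ger0_norm ?ltW//; lra.
  have := hd' t' (h + (1 - 2 * h) * s') ht (le_lt_trans es' hs).
  rewrite es rmorphM mulrA => /le_trans; apply.
  by rewrite ler_wpM2l ?(ltW e'0)// lerD2l -es.
- by rewrite divr_gt0.
exists N => n /hN; rewrite !subr0 => hn.
have GG' t s : inI I t -> inI (0, 1) s -> nrm (G t s - G' t s) <= e1.
  move=> ht hs; rewrite nrmC ltW// hu// ?subrr ?normr0//.
  have -> : h + (1 - 2 * h) * s - s = h * (1 - 2 * s) by ring.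
  apply: le_lt_trans hd2; rewrite normrM ger0_norm ?(ltW h0)// ler_piMr ?(ltW h0)//.
  by move: hs => /andP[/= s0 s1]; rewrite ler_norml; apply/andP; split; lra.
apply: le_lt_trans (nrm_le_dist _ (contour G' (kappa * (1 - 2 * h)%:C) n I (0, 1))) _.
rewrite [ltRHS](splitr e); apply: ltr_leD hn _.
have -> : contour G kappa n I (0, 1) - contour G' (kappa * (1 - 2 * h)%:C) n I (0, 1) =
  riem (fun t => G t 0 - G' t 0) n I.1 I.2 - riem (fun t => G t 1 - G' t 1) n I.1 I.2 +
  kappa * (riem (fun s => G I.2 s - G' I.2 s) n 0 1 - riem (fun s => G I.1 s - G' I.1 s) n 0 1)
  + kappa * (2 * h)%:C * (riem (fun s => G' I.2 s) n 0 1 - riem (fun s => G' I.1 s) n 0 1).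
  by rewrite /contour !riem_sub /= rmorphB /= rmorph1; ring.
have h01 : inI (0, 1) (0 : R) /\ inI (0, 1) (1 : R) by rewrite /inI /= !lexx ler01.
have hh s : inI (0, 1) s -> nrm (riem (fun t => G t s - G' t s) n I.1 I.2) <= len I * e1.
  by move=> hs; apply: riem_le_cst => // t ht; exact: GG'.
have hv t : inI I t -> nrm (riem (fun s => G t s - G' t s) n 0 1) <= e1.
  move=> ht; rewrite -[e1]mul1r -{2}[1](subr0 1).
  by apply: riem_le_cst => // s hs; exact: GG'.
have hb t : nrm (riem (fun s => G' t s) n 0 1) <= M.
  rewrite -[M]mul1r -{2}[1](subr0 1).
  by apply: riem_le_cst => // s hs; exact: hM.
have [iI1 iI2] : inI I I.1 /\ inI I I.2 by rewrite /inI !lexx hI.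
have b1 := hh _ h01.1; have b2 := hh _ h01.2; have b3 := hv _ iI1; have b4 := hv _ iI2.
have b5 := hb I.1; have b6 := hb I.2.
apply: le_trans (_ : 2 * (len I * e1) + nrm kappa * (2 * e1) + nrm kappa * (2 * h) * (2 * M) <= _).
  apply: le_trans (nrmD _ _) _; apply: lerD; last first.
    rewrite !nrmM nrm_real ger0_norm; last by rewrite mulr_ge0// ltW.
    apply: ler_wpM2l; first by rewrite !mulr_ge0// ltW.
    by apply: le_trans (nrmB _ _) _; lra.
  apply: le_trans (nrmD _ _) _; apply: lerD; first by apply: le_trans (nrmB _ _) _; lra.
  by rewrite nrmM ler_wpM2l//; apply: le_trans (nrmB _ _) _; lra.
apply: le_trans (_ : K * e1 <= _); last by rewrite /e1 mulrC divfK// lt0r_neq0.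
rewrite /K; have : nrm kappa * M * h <= nrm kappa * M * e1 by rewrite ler_wpM2l.
lra.
Qed.

(** * Integrals over the real line *)

Section ImproperIntegral.
Variable R : realType.
Local Notation C := R[i].

Section Module.
Variable V : normedModType C.
Implicit Types (g h : R -> V).

(** The intervals double because of [riem_double]: dyadic sums over [-2L, 2L] split exactly into
    sums over [-L, L] and two tails. *)
Definition is_line_int g (l : V) : Prop := exists I : nat -> V,
  (forall j, is_int g (- 2 ^+ j) (2 ^+ j) (I j)) /\ cvs I l.

Lemma line_int_unique g l m : is_line_int g l -> is_line_int g m -> l = m.
Proof.
move=> [I [hI Il]] [J [hJ Jm]]; have e : I = J.
  by apply: funext => j; apply: cvs_unique (hI j) (hJ j).
by rewrite -e in Jm; exact: cvs_unique Il Jm.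
Qed.

Lemma line_int_lin k g h l m : is_line_int g l -> is_line_int h m ->
  is_line_int (fun t => k *: g t + h t) (k *: l + m).
Proof.
have cvs_scale (u : nat -> V) a : cvs u a -> cvs (fun n => k *: u n) (k *: a).
  by apply: (cvs_lip (f := fun x => k *: x) (K := nrm k)) => x; rewrite -scalerBr nrmZ.
move=> [I [hI Il]] [J [hJ Jm]]; exists (fun j => k *: I j + J j); split.
  move=> j; rewrite /is_int (funext (fun n => riem_lin k g h n _ _)).
  by apply: cvsD; [apply: cvs_scale; exact: hI|exact: hJ].
by apply: cvsD; [exact: cvs_scale|].
Qed.

Lemma line_int_ext g h l : (forall t, g t = h t) -> is_line_int g l -> is_line_int h l.
Proof. by move=> /funext ->. Qed.
End Module.

Lemma line_int_map (V W : normedModType C) (f : V -> W) (K : R) (g : R -> V) l :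
  linear f -> (forall x, nrm (f x) <= K * nrm x) ->
  is_line_int g l -> is_line_int (f \o g) (f l).
Proof.
move=> flin fK [I [hI Il]].
have cvs_f u a : cvs u a -> cvs (f \o u) (f a).
  by apply: (cvs_lip (K := K)) => x; rewrite -(linB flin).
exists (f \o I); split; last exact: cvs_f.
move=> j; rewrite /is_int -(funext (fun n => riem_map g n _ _ flin)).
exact: cvs_f (hI j).
Qed.

Lemma cvs_Re (u : nat -> C^o) (l : C^o) : cvs u l -> forall e : R, 0 < e ->
  exists N, forall n, (N <= n)%N -> `|complex.Re (u n) - complex.Re l| < e.
Proof.
move=> h e /h[N hN]; exists N => n /hN; rewrite -raddfB; apply: le_lt_trans.
by rewrite ler_norml lerNl Re_le_nrm -raddfN /= -nrmN Re_le_nrm.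
Qed.

Lemma line_int_le (V : normedModType C) (g : R -> V) (f : R -> R) l (F : C^o) :
  (forall t, nrm (g t) <= f t) -> is_line_int g l ->
  is_line_int (fun t => (f t)%:C : C^o) F -> nrm l <= complex.Re F.
Proof.
move=> gf [I [hI Il]] [J [hJ JF]].
have step j : nrm (I j) <= complex.Re (J j).
  apply/ler_addgt0Pr => e e0; have [N hN] := cvs_Re (hJ j) e0.
  apply: (cvs_le (N := N) (hI j)) => n Nn.
  have ab : - 2 ^+ j <= 2 ^+ j :> R by rewrite ge0_cp ?exprn_ge0.
  apply: le_trans (riem_bound n ab (fun t _ => gf t)) _.
  by have := hN n Nn; rewrite ltr_norml => /andP[]; lra.
apply/ler_addgt0Pr => e e0; have [N hN] := cvs_Re JF e0.
apply: (cvs_le (N := N) Il) => n Nn; apply: le_trans (step n) _.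
by have := hN n Nn; rewrite ltr_norml => /andP[]; lra.
Qed.

Lemma riem_double (V : normedModType C) (g : R -> V) n (L : R) :
  riem g n.+2 (- (2 * L)) (2 * L) = riem g n (- (2 * L)) (- L) +
    riem g n.+1 (- L) L + riem g n L (2 * L).
Proof.
rewrite /=; have -> : (- (2 * L) + 2 * L) / 2 = 0 by field.
have -> : (- L + L) / 2 = 0 by field.
have -> : (- (2 * L) + 0) / 2 = - L by field.
have -> : (0 + 2 * L) / 2 = L by field.
by rewrite !addrA.
Qed.

Lemma line_int_exists (V : normedModType C) (g : R -> V) (M : R) :
  seq_complete V -> cont g -> (forall t, nrm (g t) <= M / (1 + t ^+ 2)) ->
  exists l, is_line_int g l.
Proof.
move=> cV cg gM.
have ab j : - 2 ^+ j <= 2 ^+ j :> R by rewrite ge0_cp ?exprn_ge0.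
have [I hI] := choice (fun j => int_exists cV cg (ab j)).
suff /cV[l hl] : cauchy_sequence I by exists l, I.
have M0 : 0 <= M.
  by have := le_trans (nrm_ge0 _) (gM 0); rewrite expr0n addr0 divr1.
apply: (@geometric_cauchy _ _ _ (2^-1) (2 * M)); rewrite ?invr_ge0 ?invf_lt1 ?ltr1n//.
move=> j; set L : R := 2 ^+ j; have L0 : 0 < L by rewrite exprn_gt0.
have h1 : cvs (fun n => riem g n.+2 (- (2 * L)) (2 * L)) (I j.+1).
  have := cvs_subseq (f := fun n => n.+2) (fun n => leqW (leqnSn n)) (hI j.+1).
  by rewrite exprS.
have h2 : cvs (fun n => - riem g n.+1 (- L) L) (- I j).
  have := cvs_subseq (f := S) leqnSn (hI j).
  by apply: (cvs_lip (f := fun x => - x) (K := 1)) => x; rewrite mul1r -nrmN opprD !opprK.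
apply: (cvs_le (N := 0%N) (cvsD h1 h2)) => n _.
rewrite riem_double addrAC addrK.
(* Each tail has length L = 2^j, so consecutive integrals differ by at most 2 M / L, a geometric
   rate. *)
have tail t : L <= `|t| -> nrm (g t) <= M / L ^+ 2.
  move=> Lt; apply: le_trans (gM t) _; rewrite ler_wpM2l// lef_pV2 ?posrE ?exprn_gt0//.
    apply: le_trans (_ : t ^+ 2 <= _); last by rewrite lerDr.
    by rewrite -[t ^+ 2]real_normK ?num_real// lerXn2r// nnegrE// ltW.
  by rewrite ltr_pwDl// sqr_ge0.
have -> : 2 * M * 2^-1 ^+ j = (- L - - (2 * L)) * (M / L ^+ 2) + (2 * L - L) * (M / L ^+ 2).
  by rewrite exprVn -/L; field; rewrite lt0r_neq0.
have L2 : L <= 2 * L by lra.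
apply: le_trans (nrmD _ _) _; apply: lerD; apply: riem_le_cst; rewrite ?lerN2// => t /andP[t1 t2];
  apply: tail.
  by rewrite ler_normr; apply/orP; right; lra.
by rewrite ler_normr t1.
Qed.

(** The radius is a power of 2 so that doubling leads from it to 2^j. The sums over [-2^j, 2^j] then
    contain those over the small interval, and all other terms are nonnegative. *)
Lemma line_int_lower (f : R -> R) (m : R) (i : nat) (F : C^o) :
  (forall t, 0 <= f t) -> (forall t, `|t| <= 2 ^- i -> m <= f t) ->
  is_line_int (fun t => (f t)%:C : C^o) F -> 2 * 2 ^- i * m <= complex.Re F.
Proof.
move=> f0 fm [I [hI IF]].
have i0 : 0 < (2 : R) ^- i by rewrite invr_gt0 exprn_gt0.
have ge0 a b n : a <= b -> 0 <= complex.Re (riem (fun t => (f t)%:C : C^o) n a b).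
  elim: n a b => [|n IH] a b ab /=; first by rewrite mulr0 subr0 mulr_ge0 ?subr_ge0.
  by have [h1 h2] := mid_ltr ab; rewrite raddfD addr_ge0 ?IH.
have base a b n : a <= b -> (forall t, a <= t <= b -> m <= f t) ->
    (b - a) * m <= complex.Re (riem (fun t => (f t)%:C : C^o) n a b).
  elim: n a b => [|n IH] a b ab h /=; have [h1 h2] := mid_ltr ab.
    by rewrite mulr0 subr0 ler_wpM2l ?subr_ge0// h// h1 h2.
  have -> : (b - a) * m = ((a + b) / 2 - a) * m + (b - (a + b) / 2) * m by ring.
  rewrite raddfD /=; apply: lerD; apply: IH => // t /andP[t1 t2]; apply: h;
    by rewrite ?(le_trans h1 t1) ?(le_trans t2 h2) ?t1 ?t2.
have grow k n : 2 * 2 ^- i * m <= complex.Re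
    (riem (fun t => (f t)%:C : C^o) (n.+1 + k) (- (2 ^+ k * 2 ^- i)) (2 ^+ k * 2 ^- i)).
  elim: k n => [|k IH] n.
    rewrite addn0 expr0 mul1r; set d : R := 2 ^- i in i0 *.
    apply: le_trans (base (- d) d n.+1 _ _); first by rewrite le_eqVlt; apply/orP; left; apply/eqP; ring.
      by lra.
    by move=> t ht; apply: fm; rewrite ler_norml.
  set L := 2 ^+ k * _ in IH *; have -> : 2 ^+ k.+1 * 2 ^- i = 2 * L :> R by rewrite exprS mulrA.
  have L0 : 0 < L by rewrite /L mulr_gt0// exprn_gt0.
  rewrite addnS addSn riem_double [in leRHS]raddfD [X in _ <= X + _]raddfD.
  have h1 : - (2 * L) <= - L by lra.
  have h2 : L <= 2 * L by lra.
  have := ge0 _ _ (n + k)%N h1; have := ge0 _ _ (n + k)%N h2; have := IH n.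
  rewrite addSn; lra.
have step j : 2 * 2 ^- i * m <= complex.Re (I j).
  apply/ler_addgt0Pr => e e0; have [N hN] := cvs_Re (hI j) e0.
  have := hN (N.+1 + (i + j))%N (leqW (leq_addr _ _)).
  have := grow (i + j)%N N.
  have -> : 2 ^+ (i + j) * 2 ^- i = 2 ^+ j :> R.
    by rewrite exprD mulrC mulrA mulVf ?mul1r// expf_neq0.
  by move=> h1; rewrite ltr_norml => /andP[]; lra.
apply/ler_addgt0Pr => e e0; have [N hN] := cvs_Re IF e0.
by have := hN N (leqnn _); have := step N; rewrite ltr_norml => h1 /andP[]; lra.
Qed.
End ImproperIntegral.

(** * Holomorphic functions on a strip, the kernel and the shift of the contour *)

Section ComplexDifferentiability.
Variable R : realType.
Local Notation C := R[i].
Implicit Types (F : C -> C) (z : C).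

Definition diff_at F z : Prop := exists l : C, forall e : R, 0 < e ->
  exists2 d : R, 0 < d & forall z', nrm (z' - z) < d ->
    nrm (F z' - F z - l * (z' - z)) <= e * nrm (z' - z).

Definition cts_on (S : set C) F z : Prop := forall e : R, 0 < e ->
  exists2 d : R, 0 < d & forall z', S z' -> nrm (z' - z) < d -> nrm (F z' - F z) < e.

Lemma derivable_diff_at (F : C^o -> C^o) (z : C^o) : derivable F z 1 -> diff_at F z.
Proof.
move=> /cvg_ex [l /= /cvgrPdist_lt hl]; exists l => e e0.
have /hl : 0 < e%:C :> C by rewrite ltcR.
move=> /nbhs_normP [d /= d0 hd].
have dd : d = (complex.Re d)%:C by rewrite RRe_real// ger0_real// ltW.
exists (complex.Re d); first by rewrite -ltcR -dd.
move=> z' hz'; have [->|zz] := eqVneq z' z; first by rewrite !subrr mulr0 subr0 nrm0 mulr0.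
have hn0 : z' - z != 0 by rewrite subr_eq0.
have := hd (z' - z); rewrite /ball_ /= sub0r normrN nrmE dd ltcR => /(_ hz' hn0).
rewrite nrmE ltcR [(z' - z) *: 1]mulr1 subrK => /ltW h.
have -> : F z' - F z - l * (z' - z) = - ((z' - z) * (l - (z' - z)^-1 *: (F z' - F z))).
  rewrite [in RHS]mulrBr; have -> : (z' - z) * ((z' - z)^-1 *: (F z' - F z)) = F z' - F z.
    by rewrite -[X in _ * X]/((z' - z)^-1 * (F z' - F z)) mulrA divff// mul1r.
  by rewrite opprB mulrC.
by rewrite nrmN nrmM mulrC ler_wpM2r ?nrm_ge0.
Qed.

Lemma diff_at_cts S F z : diff_at F z -> cts_on S F z.
Proof.
move=> [l hl] e e0; have [d d0 hd] := hl 1 ltr01.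
have K0 : 0 < nrm l + 1 by rewrite ltr_wpDl ?nrm_ge0.
exists (Num.min d (e / (nrm l + 1))); first by rewrite lt_min d0 divr_gt0.
move=> z' _; rewrite lt_min => /andP[/hd h]; rewrite ltr_pdivlMr// => h'.
apply: le_lt_trans (nrm_le_dist _ (l * (z' - z))) _; apply: le_lt_trans h'.
by rewrite mul1r in h; rewrite nrmM; lra.
Qed.

Lemma cts_onM S F G z : cts_on S F z -> cts_on S G z -> cts_on S (fun w => F w * G w) z.
Proof.
move=> hF hG e e0.
pose K := nrm (F z) + nrm (G z) + 1.
have K0 : 0 < K by rewrite /K; have := nrm_ge0 (F z); have := nrm_ge0 (G z); lra.
pose e1 := Num.min 1 (e / (2 * K)).
have e10 : 0 < e1 by rewrite lt_min ltr01 divr_gt0// mulr_gt0.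
have [d1 d10 h1] := hF _ e10; have [d2 d20 h2] := hG _ e10.
exists (Num.min d1 d2); first by rewrite lt_min d10.
move=> z' Sz'; rewrite lt_min => /andP[/(h1 _ Sz') {}h1 /(h2 _ Sz') {}h2].
have -> : F z' * G z' - F z * G z = (F z' - F z) * G z' + F z * (G z' - G z) by ring.
apply: le_lt_trans (nrmD _ _) _; rewrite !nrmM.
have g1 : nrm (G z') <= nrm (G z) + 1.
  apply: le_trans (nrm_le_dist _ (G z)) _; rewrite lerD2l.
  by apply: le_trans (ltW h2) _; rewrite ge_min lexx.
apply: le_lt_trans (_ : e1 * (nrm (G z) + 1) + nrm (F z) * e1 < _).
  by apply: lerD; [apply: ler_pM; rewrite ?nrm_ge0// ltW|rewrite ler_wpM2l ?nrm_ge0// ltW].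
have -> : e1 * (nrm (G z) + 1) + nrm (F z) * e1 = e1 * K by rewrite /K; ring.
apply: le_lt_trans (_ : e / (2 * K) * K < _); first by rewrite ler_wpM2r ?(ltW K0)// ge_min lexx orbT.
have -> : e / (2 * K) * K = e / 2 by field; rewrite lt0r_neq0.
lra.
Qed.

Lemma diff_at_translate F a z : diff_at F (z + a) -> diff_at (fun w => F (w + a)) z.
Proof.
move=> [l hl]; exists l => e /hl[d d0 hd]; exists d => // z' hz.
have e1 : z' + a - (z + a) = z' - z by rewrite opprD addrACA subrr addr0.
by have := hd (z' + a); rewrite e1; apply.
Qed.

Lemma diff_at_cst a z : diff_at (fun=> a) z.
Proof.
exists 0 => e e0; exists 1 => // z' _.
by rewrite subrr mul0r subr0 nrm0 mulr_ge0 ?nrm_ge0 ?ltW.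
Qed.

Lemma diff_at_id z : diff_at id z.
Proof.
exists 1 => e e0; exists 1 => // z' _.
by rewrite mul1r subrr nrm0 mulr_ge0 ?nrm_ge0 ?ltW.
Qed.

Lemma diff_atM F G z : diff_at F z -> diff_at G z -> diff_at (fun w => F w * G w) z.
Proof.
move=> hF hG; have := diff_at_cts setT hG.
move: hF hG => [l hl] [m hm] cG.
exists (l * G z + F z * m) => e e0.
pose K := nrm (G z) + 1 + nrm l + nrm (F z).
have K0 : 0 < K.
  by rewrite /K; have := nrm_ge0 (F z); have := nrm_ge0 (G z); have := nrm_ge0 l; lra.
have e10 : 0 < e / K by rewrite divr_gt0.
have [d1 d10 h1] := hl _ e10; have [d2 d20 h2] := hm _ e10.
have [|d3 d30 h3] := cG (Num.min 1 (e / K)); first by rewrite lt_min ltr01.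
exists (Num.min d1 (Num.min d2 d3)); first by rewrite !lt_min d10 d20.
move=> z'; rewrite !lt_min => /andP[/h1 {}h1 /andP[/h2 {}h2 /(h3 _ I)]].
rewrite lt_min => /andP[h3a h3b].
have -> : F z' * G z' - F z * G z - (l * G z + F z * m) * (z' - z) =
  (F z' - F z - l * (z' - z)) * G z' + l * (z' - z) * (G z' - G z) +
  F z * (G z' - G z - m * (z' - z)) by ring.
have g1 : nrm (G z') <= nrm (G z) + 1.
  by apply: le_trans (nrm_le_dist _ (G z)) _; rewrite lerD2l ltW.
set n := nrm (z' - z) in h1 h2 *; have n0 : 0 <= n := nrm_ge0 _.
apply: le_trans (_ : e / K * n * (nrm (G z) + 1) + nrm l * n * (e / K) +
  nrm (F z) * (e / K * n) <= _).
  apply: le_trans (nrmD _ _) _; apply: lerD; last by rewrite nrmM ler_wpM2l ?nrm_ge0.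
  apply: le_trans (nrmD _ _) _; apply: lerD; rewrite !nrmM.
    by apply: ler_pM; rewrite ?nrm_ge0.
  by rewrite ler_wpM2l ?mulr_ge0 ?nrm_ge0// ltW.
rewrite le_eqVlt; apply/orP; left; apply/eqP; rewrite /K; field.
by rewrite lt0r_neq0.
Qed.

Lemma diff_atX F k z : diff_at F z -> diff_at (fun w => F w ^+ k) z.
Proof.
move=> hF; elim: k => [|k IH]; first exact: diff_at_cst.
rewrite (_ : (fun w => _) = fun w => F w * F w ^+ k); last by apply: funext => w; rewrite exprS.
exact: diff_atM.
Qed.

Lemma diff_at_shift F a z : diff_at F z -> diff_at (fun w => a + F w) z.
Proof.
move=> [l hl]; exists l => e /hl[d d0 hd]; exists d => // z' /hd.
by rewrite opprD addrACA subrr add0r.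
Qed.

Lemma diff_atV F z : F z != 0 -> diff_at F z -> diff_at (fun w => (F w)^-1) z.
Proof.
move=> Fz0 hF; have := diff_at_cts setT hF.
move: hF => [l hl] cF; exists (- l / F z ^+ 2) => e e0.
set a := F z in Fz0 *; set A := nrm a.
have A0 : 0 < A.
  by rewrite lt_neqAle nrm_ge0 eq_sym andbT; apply: contra Fz0 => /eqP/nrm_eq0 ->.
have nV (b : C) : b != 0 -> nrm b^-1 = (nrm b)^-1.
  move=> b0; have nb : nrm b != 0 by apply: contra b0 => /eqP/nrm_eq0 ->.
  by apply: (mulIf nb); rewrite mulVf// -nrmM mulVf ?nrm1.
(* K adds the coefficients of the two error terms below, both bounded by means of [nrm b] >= A /
   2. *)
pose K := 2 / A ^+ 2 + 2 * nrm l / A ^+ 3.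
have K0 : 0 < K.
  by rewrite ltr_wpDr ?divr_gt0 ?exprn_gt0// divr_ge0 ?mulr_ge0 ?nrm_ge0 ?exprn_ge0// ltW.
have e10 : 0 < e / K by rewrite divr_gt0.
have [d1 d10 h1] := hl _ e10.
have [|d2 d20 h2] := cF (Num.min (A / 2) (e / K)); first by rewrite lt_min e10 divr_gt0.
exists (Num.min d1 d2); first by rewrite lt_min d10.
move=> z'; rewrite lt_min => /andP[/h1 {}h1 /(h2 _ I)]; rewrite lt_min => /andP[h2a h2b].
rewrite -/a in h1 h2a h2b *; set b := F z' in h1 h2a h2b *.
have hb : A / 2 <= nrm b.
  by have := nrm_le_dist a b; rewrite nrmC -/A; lra.
have b0 : b != 0.
  by apply/eqP => h; move: hb; rewrite h nrm0; lra.
have -> : b^-1 - a^-1 - - l / a ^+ 2 * (z' - z) =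
  - (b - a - l * (z' - z)) * (a^-1 * b^-1) + l * (z' - z) * (b - a) * (a^-1 ^+ 2 * b^-1).
  by field; rewrite Fz0 b0.
set n := nrm (z' - z) in h1 *; have n0 : 0 <= n := nrm_ge0 _.
have bV : nrm b^-1 <= 2 / A.
  by rewrite nV// -[2 / A]invf_div lef_pV2 ?posrE ?divr_gt0// (lt_le_trans _ hb) ?divr_gt0.
apply: le_trans (_ : e / K * n * (A^-1 * (2 / A)) + nrm l * n * (e / K) * (A^-1 ^+ 2 * (2 / A)) <= _).
  have iA : 0 <= A^-1 by rewrite invr_ge0 ltW.
  apply: le_trans (nrmD _ _) _; apply: lerD; rewrite !nrmM ?nrmX nV//.
    rewrite nrmN; apply: ler_pM; rewrite ?mulr_ge0 ?nrm_ge0//.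
    by rewrite ler_wpM2l.
  apply: ler_pM; rewrite ?mulr_ge0 ?nrm_ge0 ?exprn_ge0//.
    by rewrite ler_wpM2l ?mulr_ge0 ?nrm_ge0// ltW.
  by rewrite -expr2 ler_wpM2l ?exprn_ge0.
have K' : K != 0 by rewrite lt0r_neq0.
have -> : e / K * n * (A^-1 * (2 / A)) + nrm l * n * (e / K) * (A^-1 ^+ 2 * (2 / A)) =
  e / K * n * (2 / A ^+ 2 + 2 * nrm l / A ^+ 3) by field; rewrite K' lt0r_neq0.
by rewrite -/K mulrAC divfK.
Qed.

Lemma within_cts_on S (F : C^o -> C^o) z : {within S, continuous F} -> S z -> cts_on S F z.
Proof.
move=> /subspace_continuousP h Sz e e0.
have /cvgrPdist_lt/(_ e%:C) := h z Sz.
rewrite ltcR => /(_ e0) /nbhs_normP [d /= d0 hd].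
have dd : d = (complex.Re d)%:C by rewrite RRe_real// ger0_real// ltW.
exists (complex.Re d); first by rewrite -ltcR -dd.
move=> z' Sz' hz'; have := hd z'; rewrite /ball_ /= nrmE dd ltcR nrmC => /(_ hz' Sz').
by rewrite nrmE ltcR nrmC.
Qed.
End ComplexDifferentiability.

Section Kernel.
Variables (R : realType) (c : R).
Local Notation C := R[i].

(** The base is 1 at t = 0 and smaller elsewhere, so its powers concentrate at 0. The constant c^2 +
    1 puts the poles at distance sqrt (c^2 + 1) > |c| from the real line. *)
Definition ker (k : nat) (t : R) : R := ((c ^+ 2 + 1) / (c ^+ 2 + 1 + t ^+ 2)) ^+ k.

(* The analytic continuation of [ker], without poles for |Im z| <= |c|. *)
Definition kerc (k : nat) (z : C) : C := ((c ^+ 2 + 1)%:C / ((c ^+ 2 + 1)%:C + z ^+ 2)) ^+ k.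

Lemma ker_den_gt0 t : 0 < c ^+ 2 + 1 + t ^+ 2.
Proof. by have := sqr_ge0 c; have := sqr_ge0 t; lra. Qed.

Lemma ker_gt0 k t : 0 < ker k t.
Proof. by rewrite exprn_gt0// divr_gt0 ?ker_den_gt0// ltr_wpDl ?sqr_ge0. Qed.

Lemma kerc_real k t : kerc k t%:C = (ker k t)%:C.
Proof. by rewrite /kerc /ker rmorphXn rmorphM fmorphV /= !rmorphD !rmorphXn. Qed.

Lemma kerc_den (t y : R) : y ^+ 2 <= c ^+ 2 ->
  1 + t ^+ 2 <= nrm ((c ^+ 2 + 1)%:C + (t +i* y) ^+ 2).
Proof.
move=> yc; apply: le_trans (Re_le_nrm _).
by rewrite raddfD /= expr2 /= -!expr2; lra.
Qed.

Lemma kerc_den_neq0 (t y : R) : y ^+ 2 <= c ^+ 2 -> (c ^+ 2 + 1)%:C + (t +i* y) ^+ 2 != 0.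
Proof.
move=> yc; apply/eqP => h; have := kerc_den t yc; rewrite h nrm0.
by have := sqr_ge0 t; lra.
Qed.

(** One factor supplies the integrable decay 1 / (1 + t^2), which is why the smoothing kernels have
    exponent [k.+1]. *)
Lemma kerc_bound k (t y : R) : y ^+ 2 <= c ^+ 2 ->
  nrm (kerc k.+1 (t +i* y)) <= (c ^+ 2 + 1) ^+ k.+1 / (1 + t ^+ 2).
Proof.
move=> yc; have c0 : 0 < c ^+ 2 + 1 by rewrite ltr_wpDl ?sqr_ge0.
have t0 : 0 < 1 + t ^+ 2 by rewrite ltr_pwDl ?sqr_ge0.
have base : nrm ((c ^+ 2 + 1)%:C / ((c ^+ 2 + 1)%:C + (t +i* y) ^+ 2)) <=
    (c ^+ 2 + 1) / (1 + t ^+ 2).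
  set D := _%:C + _ ^+ 2; have hD := kerc_den t yc; rewrite -/D in hD.
  have D0 : 0 < nrm D by apply: lt_le_trans hD.
  rewrite nrmM nrm_real gtr0_norm// ler_pM2l//.
  have -> : nrm D^-1 = (nrm D)^-1.
    by apply: (mulIf (lt0r_neq0 D0)); rewrite mulVf ?lt0r_neq0// -nrmM mulVf ?nrm1// kerc_den_neq0.
  by rewrite lef_pV2 ?posrE.
rewrite nrmX; apply: le_trans (_ : ((c ^+ 2 + 1) / (1 + t ^+ 2)) ^+ k.+1 <= _).
  by rewrite lerXn2r// ?nnegrE ?nrm_ge0// ltW// divr_gt0.
rewrite expr_div_n ler_wpM2l ?exprn_ge0 ?(ltW c0)//.
rewrite lef_pV2 ?posrE ?exprn_gt0// -[leLHS]expr1 ler_weXn2l//.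
by rewrite lerDl sqr_ge0.
Qed.

Lemma ker_bound k t : ker k.+1 t <= (c ^+ 2 + 1) ^+ k.+1 / (1 + t ^+ 2).
Proof.
have := @kerc_bound k t 0; rewrite expr0n sqr_ge0 => /(_ isT); apply: le_trans.
by rewrite -[t +i* 0]/(t%:C) kerc_real nrm_real ler_norm.
Qed.

Lemma kerc_diff_at k (t y : R) : y ^+ 2 <= c ^+ 2 -> diff_at (kerc k) (t +i* y).
Proof.
move=> yc; apply: diff_atX; apply: diff_atM; first exact: diff_at_cst.
apply: (@diff_atV _ (fun w => (c ^+ 2 + 1)%:C + w ^+ 2)); first exact: kerc_den_neq0.
by apply: diff_at_shift; apply: diff_atX; exact: diff_at_id.
Qed.

Lemma kerc_cont k (y : R) : y ^+ 2 <= c ^+ 2 -> cont (fun t => kerc k (t +i* y) : C^o).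
Proof.
move=> yc t e e0; have [d d0 hd] := diff_at_cts setT (kerc_diff_at k t yc) e0.
exists d => // s hs; apply: hd => //.
have -> : s +i* y - t +i* y = (s - t)%:C.
  by apply/eqP; rewrite eq_complex /= subrr !eqxx.
by rewrite nrm_real.
Qed.
End Kernel.

Section StripShift.
Variables (R : realType) (c : R) (H : R[i] -> R[i]) (M : R).
Local Notation C := R[i].

(** Letting s run through [0, 1] treats both signs of c at once. *)
Definition line_point (t s : R) : C := t +i* (c * s).
Definition closed_strip : set C := [set z | exists t s, 0 <= s <= 1 /\ z = line_point t s].

Hypothesis H_bound : forall t s, 0 <= s <= 1 -> nrm (H (line_point t s)) <= M / (1 + t ^+ 2).
Hypothesis H_cts : forall t s, 0 <= s <= 1 -> cts_on closed_strip H (line_point t s).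
Hypothesis H_diff : forall t s, 0 < s < 1 -> diff_at H (line_point t s).

(** [goursat_boundary] asks for a function that is continuous and bounded on the whole plane;
    clamping s extends H from the strip. *)
Let clamp (s : R) : R := Num.max 0 (Num.min s 1).

Let clampP s : 0 <= clamp s <= 1.
Proof. by rewrite /clamp le_max lexx /= ge_max ler01 ge_min lexx orbT. Qed.

Let clamp_id s : 0 <= s <= 1 -> clamp s = s.
Proof. by move=> /andP[h1 h2]; rewrite /clamp min_l// max_r. Qed.

Let clamp_lip s s' : `|clamp s' - clamp s| <= `|s' - s|.
Proof.
rewrite /clamp !maxEle !minEle.
by case: (leP s 1) => h1; case: (leP s' 1) => h2; rewrite ?ler01;
  do ?[case: ifP => ? ]; rewrite !ler_norml; apply/andP; split;
  have := ler_norm (s' - s); have := ler_norm (- (s' - s)); rewrite normrN; lra.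
Qed.

Let nrm_line_point t s t' s' :
  nrm (line_point t' s' - line_point t s) <= (1 + `|c|) * (`|t' - t| + `|s' - s|).
Proof.
apply: le_trans (nrm_le_ReIm _) _; rewrite !raddfB /= -mulrBr normrM.
have := normr_ge0 c; have := normr_ge0 (t' - t); have := normr_ge0 (s' - s).
nra.
Qed.

(** On the rectangle over [-L, L] the contour sums tend to 0, and each vertical side contributes at
    most |c| M / L. Hence the two horizontal integrals agree as L grows. *)
Lemma strip_shift (l0 l1 : C^o) :
  is_line_int (fun t => H (line_point t 0) : C^o) l0 ->
  is_line_int (fun t => H (line_point t 1) : C^o) l1 -> l0 = l1.
Proof.
move=> [I0 [hI0 Il0]] [I1 [hI1 Il1]].
pose G t s : C^o := H (line_point t (clamp s)).
have c0 : 0 < 1 + `|c| by rewrite ltr_pwDl.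
have M0 : 0 <= M.
  have h : 0 <= (0 : R) <= 1 by rewrite lexx ler01.
  by have := le_trans (nrm_ge0 _) (H_bound 0 h); rewrite expr0n addr0 divr1.
have G_cont : cont2 G.
  move=> t s e e0; have [d d0 hd] := H_cts t (clampP s) e0.
  have d'0 : 0 < d / (2 * (1 + `|c|)) by rewrite divr_gt0// mulr_gt0.
  exists (d / (2 * (1 + `|c|))) => // t' s' ht hs; apply: hd.
    by exists t', (clamp s').
  apply: le_lt_trans (nrm_line_point _ _ _ _) _.
  have := le_lt_trans (clamp_lip s s') hs; move: ht.
  rewrite !ltr_pdivlMr ?mulr_gt0//; nra.
have G_bound t s : nrm (G t s) <= M / (1 + t ^+ 2) by exact: H_bound.
have t1 t : 1 <= 1 + t ^+ 2 :> R by rewrite lerDl sqr_ge0.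
have G_bound' t s : nrm (G t s) <= M.
  apply: le_trans (G_bound t s) _; rewrite ler_piMr// invf_le1 ?t1//.
  exact: lt_le_trans (t1 t).
have G_diff t s : 0 < s < 1 -> cdiff G (0 +i* c) t s.
  move=> hs; have [s0 s1] := andP hs; have [l hl] := H_diff t hs; exists l => e e0.
  have e'0 : 0 < e / (1 + `|c|) by rewrite divr_gt0.
  have [d d0 hd] := hl _ e'0.
  have d'0 : 0 < d / (2 * (1 + `|c|)) by rewrite divr_gt0// mulr_gt0.
  exists (Num.min (d / (2 * (1 + `|c|))) (Num.min s (1 - s))).
    by rewrite !lt_min d'0 s0 subr_gt0.
  move=> t' s'; rewrite !lt_min => /andP[ht _] /andP[hs' /andP[]].
  rewrite !ltr_norml => /andP[a1 a2] /andP[a3 a4].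
  rewrite /G !clamp_id; [|by rewrite !ltW|by apply/andP; split; lra].
  have -> : (t' - t)%:C + (0 +i* c) * (s' - s)%:C = line_point t' s' - line_point t s.
    by rewrite /line_point; simpc; congr (_ +i* _); ring.
  apply: le_trans (hd _ _) _.
    apply: le_lt_trans (nrm_line_point _ _ _ _) _; move: ht hs'.
    rewrite !ltr_pdivlMr ?mulr_gt0//; nra.
  rewrite -mulrA ler_wpM2l ?(ltW e0)// ler_pdivrMl//; exact: nrm_line_point.
have close j : nrm (I0 j - I1 j) <= 2 * `|c| * M * 2^-1 ^+ j.
  set L : R := 2 ^+ j; have L0 : 0 < L by rewrite exprn_gt0.
  have LL : - L <= L by lra.
  have hc := @goursat_boundary _ G (0 +i* c) (- L, L) M LL G_cont G_bound' G_diff.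
  have hG s I' : 0 <= s <= 1 -> is_int (fun t => H (line_point t s) : C^o) (- L) L I' ->
      cvs (fun n => riem (fun t => G t s) n (- L) L) I'.
    by move=> hs; rewrite /G clamp_id.
  have cN (u : nat -> C^o) a : cvs u a -> cvs (fun n => - u n) (- a).
    by apply: (cvs_lip (f := fun x => - x) (K := 1)) => x; rewrite mul1r -nrmN opprD !opprK.
  have h0 : 0 <= (0 : R) <= 1 by rewrite lexx ler01.
  have h1 : 0 <= (1 : R) <= 1 by rewrite lexx ler01.
  have := cvsD (cvsD (hG _ _ h0 (hI0 j)) (cN _ _ (hG _ _ h1 (hI1 j)))) (cN _ _ hc).
  rewrite oppr0 addr0 => hcv; apply: (cvs_le (N := 0%N) hcv) => n _; rewrite /contour /= opprD addrA subrr sub0r nrmN nrmM.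
  have -> : nrm (0 +i* c : C) = `|c|.
    by rewrite /nrm normc_def /= expr0n add0r sqrtr_sqr.
  have hv t : `|t| = L -> nrm (riem (fun s => G t s) n 0 1) <= M / L.
    move=> tL; apply: le_trans (riem_le_cst (K := M / L) n ler01 _) _ => [s _|]; last first.
      by rewrite subr0 mul1r.
    apply: le_trans (G_bound t s) _; rewrite ler_wpM2l// lef_pV2 ?posrE ?(lt_le_trans _ (t1 t))//.
    rewrite -[t ^+ 2]real_normK ?num_real// tL; nra.
  have v1 := hv L (gtr0_norm L0); have v2 := hv (- L); rewrite normrN gtr0_norm// in v2.
  rewrite exprVn -/L -[2 * _]mulrC -!mulrA; apply: ler_wpM2l; first exact: normr_ge0.
  by apply: le_trans (nrmB _ _) _; have := v2 erefl; lra.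
apply/eqP; rewrite -subr_eq0; apply/eqP; apply: nrm_le_small => e e0.
have [||N hN] := @geometric_small R 2^-1 (2 * `|c| * M) e _ _ e0.
- by rewrite invr_ge0.
- by rewrite invf_lt1// ltr1n.
have cN (u : nat -> C^o) a : cvs u a -> cvs (fun n => - u n) (- a).
  by apply: (cvs_lip (f := fun x => - x) (K := 1)) => x; rewrite mul1r -nrmN opprD !opprK.
apply: (cvs_le (N := N) (cvsD Il0 (cN _ _ Il1))) => j Nj.
by apply: le_trans (close j) _; rewrite ltW// hN.
Qed.
End StripShift.

(** * Smoothing along the flow and the KMS condition *)

Section KMSFunctions.
Variables (R : realType) (A : cstarAlgType R) (alpha : flow A) (c : R) (w : A -> R[i]).
Local Notation C := R[i].

Lemma line_point_strip t s : 0 <= s <= 1 -> strip c (line_point c t s).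
Proof.
move=> /andP[s0 s1]; rewrite /strip /=; case: leP => c0; apply/andP; split; nra.
Qed.

Lemma line_point_interior t s : c != 0 -> 0 < s < 1 -> (strip c)^° (line_point c t s).
Proof.
move=> cn0 /andP[s0 s1].
suff : \forall z \near (line_point c t s : C^o), strip c z by [].
apply/nbhs_normP; pose d := `|c| * Num.min s (1 - s).
have d0 : 0 < d by rewrite mulr_gt0 ?normr_gt0// lt_min s0 subr_gt0.
exists d%:C => /=; first by rewrite ltcR.
move=> z; rewrite /ball_ /= nrmE ltcR nrmC => h.
have := le_lt_trans (Im_le_nrm _) h; rewrite raddfB /= /strip /= => {}h.
have h1 : `|complex.Im z - c * s| < `|c| * s.
  by apply: lt_le_trans h _; rewrite ler_wpM2l// ge_min lexx.
have h2 : `|complex.Im z - c * s| < `|c| * (1 - s).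
  by apply: lt_le_trans h _; rewrite ler_wpM2l// ge_min lexx orbT.
move: h1 h2; case: (leP 0 c) => c0.
  rewrite (ger0_norm c0).
  by rewrite !ltr_norml => /andP[a1 a2] /andP[a3 a4]; apply/andP; split; lra.
by rewrite (ltr0_norm c0) !ltr_norml => /andP[a1 a2] /andP[a3 a4]; apply/andP; split; lra.
Qed.

Lemma KMS_function x y : c != 0 -> KMS alpha c w -> exists F : C -> C,
  [/\ exists M, forall t s, 0 <= s <= 1 -> nrm (F (line_point c t s)) <= M,
    forall t s, 0 <= s <= 1 -> cts_on (closed_strip c) F (line_point c t s),
    forall t s, 0 < s < 1 -> diff_at F (line_point c t s),
    forall t, F (line_point c t 0) = w (x * alpha t y) &
    forall t, F (line_point c t 1) = w (alpha t y * x)].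
Proof.
move=> c0 [_]; rewrite (negbTE c0) => /(_ x y) [F [[M hM] Fc Fd F0 F1]].
exists F; split.
- exists M => t s hs; rewrite -lecR -nrmE; apply: hM; exact: line_point_strip.
- move=> t s hs e e0.
  have [d d0 hd] := within_cts_on Fc (line_point_strip t hs) e0.
  exists d => // _ [t' [s' [hs' ->]]]; apply: hd; exact: line_point_strip.
- move=> t s hs; apply: derivable_diff_at; apply: Fd; exact: line_point_interior.
- by move=> t; rewrite /line_point mulr0 F0.
- by move=> t; rewrite /line_point mulr1 F1.
Qed.
End KMSFunctions.

Section Flows.
Variables (R : realType) (A : cstarAlgType R) (alpha : flow A).
Local Notation C := R[i].

Lemma automorphism_contractive (f : {lrmorphism A -> A}) x :
  star_automorphism f -> nrm (f x) <= nrm x.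
Proof.
move=> [_ fs]; apply: starhom_contractive => //.
- by move=> a u v; rewrite linearP.
- by move=> u v; rewrite rmorphM.
- exact: rmorph1.
Qed.

Lemma flow_contractive t x : nrm (alpha t x) <= nrm x.
Proof. exact: automorphism_contractive (flow_aut alpha t). Qed.

Lemma flow_cont x : cont (fun t => alpha t x).
Proof. by apply: cont_continuous; exact: flow_cts. Qed.
End Flows.

Lemma cont_scale (R : realType) (V : normedModType R[i]) (f : R -> (R[i])^o) (g : R -> V) :
  cont f -> cont g -> cont (fun t => (f t : R[i]) *: g t).
Proof.
move=> hf hg t e e0.
pose K := nrm (f t) + nrm (g t) + 1.
have K0 : 0 < K by rewrite /K; have := nrm_ge0 (f t); have := nrm_ge0 (g t); lra.
pose e1 := Num.min 1 (e / (2 * K)).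
have e10 : 0 < e1 by rewrite lt_min ltr01 divr_gt0// mulr_gt0.
have [d1 d10 h1] := hf t _ e10; have [d2 d20 h2] := hg t _ e10.
exists (Num.min d1 d2); first by rewrite lt_min d10.
move=> s; rewrite lt_min => /andP[/h1 {}h1 /h2 {}h2].
have -> : (f s : R[i]) *: g s - (f t : R[i]) *: g t =
    (f s - f t : R[i]) *: g s + (f t : R[i]) *: (g s - g t).
  by rewrite scalerBl scalerBr addrA subrK.
apply: le_lt_trans (nrmD _ _) _; rewrite !nrmZ.
have g1 : nrm (g s) <= nrm (g t) + 1.
  apply: le_trans (nrm_le_dist _ (g t)) _; rewrite lerD2l.
  by apply: le_trans (ltW h2) _; rewrite ge_min lexx.
apply: le_lt_trans (_ : e1 * (nrm (g t) + 1) + nrm (f t) * e1 < _).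
  by apply: lerD; [apply: ler_pM; rewrite ?nrm_ge0// ltW|rewrite ler_wpM2l ?nrm_ge0// ltW].
have -> : e1 * (nrm (g t) + 1) + nrm (f t) * e1 = e1 * K by rewrite /K; ring.
apply: le_lt_trans (_ : e / (2 * K) * K < _); first by rewrite ler_wpM2r ?(ltW K0)// ge_min lexx orbT.
have -> : e / (2 * K) * K = e / 2 by field; rewrite lt0r_neq0.
lra.
Qed.

Section Smoothing.
Variables (R : realType) (c : R) (k : nat) (B : cstarAlgType R) (beta : flow B).
Local Notation C := R[i].

(* The integrals of ker t * beta_t y and of ker (t - ic) * beta_t y over the line;
   formally the second is the analytic continuation of the flow of the first to i c. *)
Definition smooth (y w : B) : Prop :=
  is_line_int (fun t => (ker c k.+1 t)%:C *: beta t y) w.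

Definition smooth_shift (y w : B) : Prop :=
  is_line_int (fun t => kerc c k.+1 (t +i* - c) *: beta t y) w.

(** The integrand majorizes both the real kernel and the shifted one, so m bounds both smoothing
    maps. *)
Lemma mass_exists : exists m : C^o,
  is_line_int (fun t => ((c ^+ 2 + 1) ^+ k.+1 / (1 + t ^+ 2))%:C : C^o) m.
Proof.
have t0 (t : R) : 0 < 1 + t ^+ 2 by rewrite ltr_pwDl ?sqr_ge0.
apply: (@line_int_exists R C^o _ ((c ^+ 2 + 1) ^+ k.+1) (@complete_complex R)) => [|t]; last first.
  by rewrite nrm_real ger0_norm// divr_ge0 ?exprn_ge0 ?(ltW (t0 t))// addr_ge0 ?sqr_ge0.
move=> t e e0.
have hdiff : diff_at (fun z : C => ((c ^+ 2 + 1) ^+ k.+1)%:C / (1 + z ^+ 2)) t%:C.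
  apply: diff_atM; first exact: diff_at_cst.
  apply: (@diff_atV _ (fun w => 1 + w ^+ 2)).
    by rewrite -rmorphXn -(rmorph1 (real_complex R)) -rmorphD /= (inj_eq (@complexI R)) lt0r_neq0.
  by apply: diff_at_shift; apply: diff_atX; exact: diff_at_id.
have [d d0 hd] := diff_at_cts setT hdiff e0; exists d => // s hs.
have := hd s%:C I; rewrite -rmorphB /= nrm_real => /(_ hs).
by rewrite -!rmorphXn -(rmorph1 (real_complex R)) -!rmorphD -!fmorphV -!rmorphM.
Qed.

Lemma line_int_mass_bound (f : R -> C) y w m : (forall t, nrm (f t) <=
    (c ^+ 2 + 1) ^+ k.+1 / (1 + t ^+ 2)) -> is_line_int (fun t => f t *: beta t y) w ->
  is_line_int (fun t => ((c ^+ 2 + 1) ^+ k.+1 / (1 + t ^+ 2))%:C : C^o) m ->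
  nrm w <= complex.Re m * nrm y.
Proof.
move=> hf hw hm; set K := fun t : R => _ in hm.
have := @line_int_map R C^o C^o (fun z => (nrm y)%:C * z) (nrm y) _ m.
move=> /(_ K)[a u v|z||].
- by rewrite mulrDr; congr (_ + _); exact: mulrCA.
- by rewrite nrmM nrm_real ger0_norm ?nrm_ge0.
- exact: hm.
move=> I hI; have -> : complex.Re m * nrm y = complex.Re ((nrm y)%:C * m).
  by case: (m) => a b; simpc; rewrite mulrC.
apply: (line_int_le (f := fun t => nrm y * ((c ^+ 2 + 1) ^+ k.+1 / (1 + t ^+ 2)))) hw _ => [t|].
  by rewrite nrmZ mulrC; apply: ler_pM; rewrite ?nrm_ge0 ?flow_contractive.
by exists I; move: hI; rewrite /comp /K; under eq_fun do rewrite -rmorphM.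
Qed.

Lemma nrm_ker_le t : nrm ((ker c k.+1 t)%:C : C) <= (c ^+ 2 + 1) ^+ k.+1 / (1 + t ^+ 2).
Proof. by rewrite nrm_real gtr0_norm ?ker_gt0// ker_bound. Qed.

Lemma nrm_kerc_shift_le t : nrm (kerc c k.+1 (t +i* - c)) <= (c ^+ 2 + 1) ^+ k.+1 / (1 + t ^+ 2).
Proof. by apply: kerc_bound; rewrite sqrrN. Qed.

Lemma weighted_exists (f : R -> C^o) y : cont f ->
  (forall t, nrm (f t) <= (c ^+ 2 + 1) ^+ k.+1 / (1 + t ^+ 2)) ->
  exists w, is_line_int (fun t => (f t : C) *: beta t y) w.
Proof.
move=> cf hf; apply: (@line_int_exists _ _ _ ((c ^+ 2 + 1) ^+ k.+1 * nrm y)).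
- exact: complete_normedMod.
- by apply: cont_scale; [|exact: flow_cont].
- move=> t; rewrite nrmZ mulrAC; apply: ler_pM; rewrite ?nrm_ge0 ?flow_contractive//.
Qed.

Lemma smooth_exists y : exists w, smooth y w.
Proof.
apply: weighted_exists; last exact: nrm_ker_le.
have : cont (fun t => kerc c k.+1 (t +i* 0) : C^o).
  by apply: kerc_cont; rewrite expr0n sqr_ge0.
by congr cont; apply: funext => t; rewrite -kerc_real.
Qed.

Lemma smooth_shift_exists y : exists w, smooth_shift y w.
Proof.
apply: weighted_exists; last exact: nrm_kerc_shift_le.
by apply: kerc_cont; rewrite sqrrN.
Qed.

Lemma weighted_lin (f : R -> C) a y y' w w' :
  is_line_int (fun t => f t *: beta t y) w -> is_line_int (fun t => f t *: beta t y') w' ->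
  is_line_int (fun t => f t *: beta t (a *: y + y')) (a *: w + w').
Proof.
move=> hw hw'; apply: line_int_ext (line_int_lin a hw hw') => t.
by rewrite linearP scalerDr !scalerA mulrC.
Qed.
End Smoothing.

Section Partner.
Variables (R : realType) (A B : cstarAlgType R) (tens : A -> A -> B).
Variables (alpha : flow A) (beta : flow B) (c : R) (k : nat).
Variables (w1 w2 : A -> R[i]) (phi : B -> R[i]).
Local Notation C := R[i].
Hypotheses (tensP : is_tensor_square tens) (flowP : is_tensor_flow tens alpha beta).
Hypotheses (w1K : KMS alpha c w1) (w2K : KMS alpha c w2).
Hypotheses (phiS : state phi) (phi_tens : forall x y, phi (tens x y) = w1 x * w2 y).

Let phi_lin : scalar phi. Proof. by case: phiS. Qed.

Lemma tens_ext (g : B -> C) (K : R) : scalar g -> (forall z, nrm (g z) <= K * nrm z) ->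
  (forall x y, g (tens x y) = 0) -> forall z, g z = 0.
Proof.
move=> gl gK g0 z; apply: nrm_le_small => e e0.
have K0 : 0 < `|K| + 1 by rewrite ltr_wpDl.
have [s hs] := tenssum_dense tensP z (divr_gt0 e0 K0).
have gs : g (tenssum tens s) = 0.
  rewrite /tenssum; elim: s {hs} => [|p s IH]; first by rewrite big_nil (funct0 gl).
  by rewrite big_cons (functD gl) g0 IH addr0.
rewrite -[g z]subr0 -gs -(functB gl); apply: le_trans (gK _) _.
move: hs; rewrite ltr_pdivlMr// => /ltW; apply: le_trans.
by rewrite mulrC ler_wpM2l ?nrm_ge0// (le_trans (ler_norm _))// lerDl.
Qed.

Lemma mulr_line_int (f : R -> C) y w x : is_line_int (fun t => f t *: beta t y) w ->
  is_line_int (fun t => f t * phi (beta t y * x) : C^o) (phi (w * x)).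
Proof.
move=> hw; have := @line_int_map R B C^o (fun z => phi (z * x)) (nrm x) _ w _ _ hw.
move=> h; apply: line_int_ext (h _ _) => [t|a u v|z] /=.
- by rewrite -scalerAl (functZ phi_lin).
- by rewrite mulrDl -scalerAl (functD phi_lin) (functZ phi_lin).
- by apply: le_trans (state_bound phiS _) _; rewrite mulrC nrm_mul.
Qed.

Lemma mull_line_int (f : R -> C) y w x : is_line_int (fun t => f t *: beta t y) w ->
  is_line_int (fun t => f t * phi (x * beta t y) : C^o) (phi (x * w)).
Proof.
move=> hw; have := @line_int_map R B C^o (fun z => phi (x * z)) (nrm x) _ w _ _ hw.
move=> h; apply: line_int_ext (h _ _) => [t|a u v|z] /=.
- by rewrite -scalerAr (functZ phi_lin).
- by rewrite mulrDr -scalerAr (functD phi_lin) (functZ phi_lin).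
- by apply: le_trans (state_bound phiS _) _; rewrite nrm_mul.
Qed.

(** On elementary tensors phi factors, and the product of the strip functions of w1 and w2 connects
    the integrand of the left side with that of the right. *)
Lemma partner_elementary a b x1 x2 v v' :
  smooth c k beta (tens a b) v -> smooth_shift c k beta (tens a b) v' ->
  phi (v * tens x1 x2) = phi (tens x1 x2 * v').
Proof.
move=> /(mulr_line_int (tens x1 x2)) hv /(mull_line_int (tens x1 x2)) hv'.
have pr t : phi (beta t (tens a b) * tens x1 x2) = w1 (alpha t a * x1) * w2 (alpha t b * x2).
  by rewrite flowP (tensorM tensP) phi_tens.
have pl t : phi (tens x1 x2 * beta t (tens a b)) = w1 (x1 * alpha t a) * w2 (x2 * alpha t b).
  by rewrite flowP (tensorM tensP) phi_tens.
(* For c = 0 there is no strip: the states are traces and the shifted kernel is the kernel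
   itself. *)
have [c0|c0] := eqVneq c 0.
  have tr w : KMS alpha c w -> forall x y, w (x * y) = w (y * x).
    by move=> [_]; rewrite c0 eqxx.
  apply: line_int_unique hv _; apply: line_int_ext hv' => t.
  by rewrite pr pl (tr _ w1K) (tr _ w2K) c0 oppr0 -kerc_real.
have [F1 [[M1 b1] c1 d1 e10 e11]] := KMS_function x1 a c0 w1K.
have [F2 [[M2 b2] c2 d2 e20 e21]] := KMS_function x2 b c0 w2K.
(* Because of the shift, the kernel factor is the real kernel on the line s = 1 and the one of
   [smooth_shift] on s = 0. *)
pose H z := kerc c k.+1 (z + (0 +i* - c)) * (F1 z * F2 z).
have lp t s : line_point c t s + (0 +i* - c) = t +i* (c * s - c).
  by rewrite /line_point; simpc.
have yc s : 0 <= s <= 1 -> (c * s - c) ^+ 2 <= c ^+ 2.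
  move=> /andP[s0 s1]; rewrite -[X in _ - X]mulr1 -mulrBr exprMn ler_piMr ?sqr_ge0//.
  by rewrite -sqrrN opprB expr_le1// ?subr_ge0// gerBl.
have kd t s : 0 <= s <= 1 -> diff_at (fun z => kerc c k.+1 (z + (0 +i* - c))) (line_point c t s).
  by move=> hs; apply: diff_at_translate; rewrite lp; apply: kerc_diff_at; exact: yc.
apply/esym; apply: (@strip_shift _ c H ((c ^+ 2 + 1) ^+ k.+1 * (M1 * M2))).
- move=> t s hs; rewrite /H lp !nrmM mulrAC; apply: ler_pM; rewrite ?mulr_ge0 ?nrm_ge0//.
    by apply: kerc_bound; exact: yc.
  by apply: ler_pM; rewrite ?nrm_ge0 ?b1 ?b2.
- move=> t s hs; apply: cts_onM; first by apply: diff_at_cts; exact: kd.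
  by apply: cts_onM; [exact: c1|exact: c2].
- move=> t s hs; have [s0 s1] := andP hs; apply: diff_atM; first by apply: kd; rewrite !ltW.
  by apply: diff_atM; [exact: d1|exact: d2].
- apply: line_int_ext hv' => t.
  by rewrite pl /H lp mulr0 sub0r e10 e20.
- apply: line_int_ext hv => t.
  by rewrite pr /H lp mulr1 subrr -kerc_real e11 e21.
Qed.

(** Uniqueness of integrals makes the chosen smoothings W and W' linear, and the mass bounds them.
    So the identity extends from elementary tensors by density, first in x and then in y. *)
Lemma partner y v v' : smooth c k beta y v -> smooth_shift c k beta y v' ->
  forall x, phi (v * x) = phi (x * v').
Proof.
move=> hv hv' x.
have [m hm] := mass_exists c k.
have [W hW] := choice (smooth_exists c k beta).
have [W' hW'] := choice (smooth_shift_exists c k beta).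
have -> : v = W y by exact: line_int_unique hv (hW y).
have -> : v' = W' y by exact: line_int_unique hv' (hW' y).
have Wlin : linear W by move=> a u u'; apply: line_int_unique (hW _) (weighted_lin a (hW _) (hW _)).
have W'lin : linear W' by move=> a u u'; apply: line_int_unique (hW' _) (weighted_lin a (hW' _) (hW' _)).
have Wb u : nrm (W u) <= complex.Re m * nrm u.
  exact: (line_int_mass_bound (@nrm_ker_le _ c k) (hW u) hm).
have W'b u : nrm (W' u) <= complex.Re m * nrm u.
  exact: (line_int_mass_bound (@nrm_kerc_shift_le _ c k) (hW' u) hm).
have step1 a b z : phi (W (tens a b) * z) - phi (z * W' (tens a b)) = 0.
  move: z; apply: (@tens_ext _ (nrm (W (tens a b)) + nrm (W' (tens a b)))) => [r z z'|z|x1 x2].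
  - rewrite mulrDr mulrDl -scalerAr -scalerAl !(functD phi_lin) !(functZ phi_lin).
    by ring.
  - apply: le_trans (nrmB _ _) _; rewrite mulrDl; apply: lerD;
      apply: le_trans (state_bound phiS _) _; first exact: nrm_mul.
    by rewrite mulrC nrm_mul.
  - by rewrite (partner_elementary x1 x2 (hW _) (hW' _)) subrr.
apply/eqP; rewrite -subr_eq0; apply/eqP; move: y {hv hv'}.
apply: (@tens_ext _ (2 * complex.Re m * nrm x)) => [r z z'|z|a b].
- rewrite Wlin W'lin mulrDr mulrDl -scalerAr -scalerAl !(functD phi_lin) !(functZ phi_lin).
  by ring.
- apply: le_trans (nrmB _ _) _.
  have -> : 2 * complex.Re m * nrm x * nrm z =
    complex.Re m * nrm z * nrm x + nrm x * (complex.Re m * nrm z) by ring.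
  apply: lerD; apply: le_trans (state_bound phiS _) _; apply: le_trans (nrm_mul _ _) _.
    by rewrite ler_wpM2r ?nrm_ge0.
  by rewrite ler_wpM2l ?nrm_ge0.
- exact: step1.
Qed.
End Partner.

(** * Concentration of the kernel at 0 *)

Section Concentration.
Variables (R : realType) (c : R).
Local Notation C := R[i].

Lemma ker_line_int k : exists F : C^o, is_line_int (fun t => (ker c k.+1 t)%:C : C^o) F.
Proof.
apply: (@line_int_exists _ _ _ ((c ^+ 2 + 1) ^+ k.+1) (@complete_complex R)); last exact: nrm_ker_le.
have : cont (fun t => kerc c k.+1 (t +i* 0) : C^o).
  by apply: kerc_cont; rewrite expr0n sqr_ge0.
by congr cont; apply: funext => t; rewrite -kerc_real.
Qed.

Lemma ker1_antitone s t : `|s| <= `|t| -> ker c 1 t <= ker c 1 s.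
Proof.
move=> st; rewrite /ker !expr1 ler_wpM2l ?addr_ge0 ?sqr_ge0//.
rewrite lef_pV2 ?posrE ?ker_den_gt0// lerD2l.
by rewrite -[s ^+ 2]real_normK ?num_real// -[t ^+ 2]real_normK ?num_real// lerXn2r ?nnegrE.
Qed.

Lemma ker1_lt s t : `|s| < `|t| -> ker c 1 t < ker c 1 s.
Proof.
move=> st; rewrite /ker !expr1 ltr_pM2l ?ltr_wpDl ?sqr_ge0//.
rewrite ltf_pV2 ?posrE ?ker_den_gt0// ltrD2l.
by rewrite -[s ^+ 2]real_normK ?num_real// -[t ^+ 2]real_normK ?num_real// ltrXn2r ?nnegrE.
Qed.

Lemma kerX k t : ker c k t = ker c 1 t ^+ k.
Proof. by rewrite /ker expr1. Qed.

Lemma ker1_le1 t : ker c 1 t <= 1.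
Proof. by rewrite /ker expr1 ler_pdivrMr ?ker_den_gt0// mul1r lerDl sqr_ge0. Qed.

(* For some 2^-i < d the kernel ker k is at least (ker 1 2^-i)^k on [-2^-i, 2^-i], whereas
   beyond d it is at most (ker 1 d)^k, which is exponentially smaller. *)
Lemma ker_concentrates (d : R) : 0 < d -> exists (k : nat) (F F1 : C^o) (r : R),
  [/\ is_line_int (fun t => (ker c k.+2 t)%:C : C^o) F,
      is_line_int (fun t => (ker c 1 t)%:C : C^o) F1,
      0 < complex.Re F, 8 * r * complex.Re F1 <= complex.Re F &
      0 <= r /\ forall t, d < `|t| -> ker c k.+2 t <= r * ker c 1 t].
Proof.
move=> d0; have [F1 hF1] := ker_line_int 0.
have [||i hi] := @geometric_small R 2^-1 1 d _ _ d0.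
- by rewrite invr_ge0.
- by rewrite invf_lt1// ltr1n.
have {hi} hid : (2 : R) ^- i < d by have := hi i (leqnn _); rewrite mul1r exprVn.
have i0 : 0 < (2 : R) ^- i by rewrite invr_gt0 exprn_gt0.
set s := ker c 1 (2 ^- i); set r := ker c 1 d.
have s0 : 0 < s by exact: ker_gt0.
have r0 : 0 < r by exact: ker_gt0.
have rs : r < s by apply: ker1_lt; rewrite !gtr0_norm.
have p0 : 0 < 2 * 2 ^- i * s by rewrite mulr_gt0// mulr_gt0.
(* One factor [ker c 1] is kept to make the tail integrable. The 8 turns the tail 2 r F1 in
   [kms_domination] into at most F / 4. *)
have [||N hN] := @geometric_small R (r / s) (8 * complex.Re F1) _ _ _ p0.
- by rewrite divr_ge0// ltW.
- by rewrite ltr_pdivrMr// mul1r.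
have [F hF] := ker_line_int N.+1.
have low : 2 * 2 ^- i * s ^+ N.+2 <= complex.Re F.
  apply: (line_int_lower _ _ hF) => t; first by rewrite ltW// ker_gt0.
  move=> ht; rewrite kerX; apply: lerXn2r; rewrite ?nnegrE ?(ltW (ker_gt0 _ _ _))//.
  by apply: ker1_antitone; rewrite (gtr0_norm i0).
have F0 : 0 < complex.Re F by apply: lt_le_trans low; rewrite mulr_gt0 ?exprn_gt0// mulr_gt0.
exists N, F, F1, (r ^+ N.+1); split => //.
- apply: le_trans low; have := hN N.+1 (leqnSn N).
  rewrite expr_div_n mulrA ltr_pdivrMr ?exprn_gt0// => /ltW h.
  by rewrite (exprS s N.+1); lra.
- split; first by rewrite exprn_ge0// ltW.
  move=> t dt; rewrite kerX exprSr; apply: ler_wpM2r; first by rewrite ltW// ker_gt0.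
  apply: lerXn2r; rewrite ?nnegrE ?(ltW (ker_gt0 _ _ _)) ?(ltW r0)//.
  by apply: ker1_antitone; rewrite (gtr0_norm d0) ltW.
Qed.

Lemma line_int_comb (k k' : nat) (F F1 : C^o) (a b : R) :
  is_line_int (fun t => (ker c k t)%:C : C^o) F ->
  is_line_int (fun t => (ker c k' t)%:C : C^o) F1 ->
  is_line_int (fun t => (a * ker c k t + b * ker c k' t)%:C : C^o) (a%:C * F + b%:C * F1) .
Proof.
move=> hF hF1.
have hb : is_line_int (fun t => b%:C * (ker c k' t)%:C : C^o) (b%:C * F1 : C^o).
  apply: (@line_int_map R C^o C^o (fun z => b%:C * z) (nrm (b%:C : C)) _ _ _ _ hF1) => [u v w|z].
    by rewrite mulrDr; congr (_ + _); exact: mulrCA.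
  by rewrite nrmM.
apply: line_int_ext (line_int_lin a%:C hF hb) => t.
by rewrite rmorphD !rmorphM.
Qed.

Lemma Re_comb (a b : R) (F F1 : C) :
  complex.Re (a%:C * F + b%:C * F1) = a * complex.Re F + b * complex.Re F1.
Proof. by case: F F1 => [? ?] [? ?] /=; rewrite !mul0r !subr0. Qed.

(** The integral is split at |t| = L: g is small inside, the kernel outside. It serves with a small
    L for closeness to the unitaries and with a large L for the intertwining relation. *)
Lemma weighted_small (V : normedModType C) (k : nat) (g : R -> V) w (F F1 : C^o) (e M r L : R) :
  is_line_int (fun t => (ker c k t)%:C *: g t) w ->
  is_line_int (fun t => (ker c k t)%:C : C^o) F ->
  is_line_int (fun t => (ker c 1 t)%:C : C^o) F1 ->
  0 <= e -> 0 <= r -> (forall t, `|t| <= L -> nrm (g t) <= e) -> (forall t, nrm (g t) <= M) ->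
  (forall t, L < `|t| -> ker c k t <= r * ker c 1 t) ->
  nrm w <= e * complex.Re F + M * r * complex.Re F1.
Proof.
move=> hw hF hF1 e0 r0 gs gM kr; rewrite -Re_comb.
have M0 : 0 <= M := le_trans (nrm_ge0 _) (gM 0).
apply: (line_int_le _ hw (line_int_comb e (M * r) hF hF1)) => t.
have k0 := ltW (ker_gt0 c k t); have k10 := ltW (ker_gt0 c 1 t).
rewrite nrmZr ger0_norm//; have [tL|tL] := leP `|t| L.
  apply: le_trans (_ : e * ker c k t <= _); last by rewrite lerDl mulr_ge0// mulr_ge0.
  by rewrite mulrC ler_wpM2r// gs.
apply: le_trans (_ : M * r * ker c 1 t <= _); last by rewrite lerDr mulr_ge0.
by rewrite mulrC -mulrA; apply: ler_pM; rewrite ?nrm_ge0// kr.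
Qed.
End Concentration.

(** * Domination and uniqueness *)

Section Domination.
Variables (R : realType) (A B : cstarAlgType R) (tens : A -> A -> B).
Variables (alpha : flow A) (beta : flow B) (sigma : {lrmorphism B -> B}) (c : R).
Local Notation C := R[i].
Hypotheses (uhf : UHF A) (tensP : is_tensor_square tens) (flipP : is_flip tens sigma).
Hypotheses (flowP : is_tensor_flow tens alpha beta).
Variable u : nat -> B.
Hypotheses (u_unitary : forall n, unitary (u n))
  (u_ad : forall z, (fun n => Ad (u n) z) @ \oo --> sigma z)
  (u_equi : equicontinuous [set: nat] (fun n (t : R) => beta t (u n))).

Let sigma_le z : nrm (sigma z) <= nrm z.
Proof. by apply: automorphism_contractive; case: flipP. Qed.

Let nrm_u n : nrm (u n) = 1.
Proof. by apply: nrm_isometry; case: (u_unitary n). Qed.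

(** Equicontinuity is used at t = 0; one d for all n is what lets a single kernel work for the whole
    sequence. *)
Lemma equicontinuous_modulus (e : R) : 0 < e -> exists2 d : R, 0 < d &
  forall n t, `|t| <= d -> nrm (beta t (star (u n)) - star (u n)) <= e.
Proof.
move=> e0.
have e0' : 0 < e%:C :> C by rewrite ltcR.
have := @u_equi 0 _ (entourage_ball B (PosNum e0')).
move=> /nbhs_normP [d /= d0 hd]; exists (d / 2); first by rewrite divr_gt0.
move=> n t ht.
have -> : beta t (star (u n)) = star (beta t (u n)) by have [_ ->] := flow_aut beta t.
rewrite -starB nrm_star nrmC.
have /hd /(_ n I) : ball_ Num.norm 0 d t.
  by rewrite /ball_ /= sub0r normrN; apply: le_lt_trans ht _; rewrite ltr_pdivrMr// ltr_pMr// ltr1n.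
by rewrite /= flow0 -ball_normE /= nrmE ltcR => /ltW.
Qed.

Lemma flip_flow_comm t z : sigma (beta t z) = beta t (sigma z).
Proof.
apply/eqP; rewrite -subr_eq0; apply/eqP; apply: nrm_le_small => e e0.
have e2 : 0 < e / 2 by rewrite divr_gt0.
have [s hs] := tenssum_dense tensP z e2.
have es : sigma (beta t (tenssum tens s)) = beta t (sigma (tenssum tens s)).
  rewrite /tenssum !raddf_sum; apply: eq_bigr => p _.
  by rewrite /= flowP; case: flipP => _ h; rewrite !h flowP.
rewrite -[z](subrK (tenssum tens s)); move: (z - _) hs => y /ltW hs.
rewrite !rmorphD /= es opprD addrACA subrr addr0.
rewrite [leRHS](splitr e); apply: le_trans (nrmB _ _) _; apply: lerD; apply: le_trans hs.
  exact: le_trans (sigma_le _) (flow_contractive _ _ _).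
exact: le_trans (flow_contractive _ _ _) (sigma_le _).
Qed.

(** The maps [Ad (u n)] are contractive, so their pointwise convergence is uniform on the compact
    piece of orbit with |t| <= L. *)
Lemma ad_uniform z (e L : R) : 0 < e -> 0 <= L -> exists N, forall n t, (N <= n)%N -> `|t| <= L ->
  nrm (Ad (u n) (beta (- t) z) - sigma (beta (- t) z)) <= e.
Proof.
move=> e0 L0.
have LL : - L <= L by lra.
have [||N hN] := @bisection R (fun I _ => exists N, forall n t, (N <= n)%N -> inI I t ->
  nrm (Ad (u n) (beta (- t) z) - sigma (beta (- t) z)) <= e) (- L, L) (0, 0) LL (lexx 0).
- move=> I J hI _ h; have [N1 h1] := h false false; have [N2 h2] := h true false.
  exists (maxn N1 N2) => n t; rewrite geq_max => /andP[n1 n2] /andP[t1 t2].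
  have [tm|tm] := leP t (mid I); first by apply: h1; rewrite // /inI t1.
  by apply: h2; rewrite // /inI t2 ltW.
- move=> x y _ _; have e3 : 0 < e / 3 by rewrite divr_gt0.
  have [d d0 hd] := flow_cont beta z (- x) e3.
  have [N hN] := cvs_cvg (@u_ad (beta (- x) z)) e3.
  exists d => // I' J' [_ /andP[i1 i2] _] _ li _; exists N => n t Nn /andP[t1 t2].
  have close : nrm (beta (- t) z - beta (- x) z) < e / 3.
    by apply: hd; rewrite /len in li; rewrite ltr_norml; apply/andP; split; lra.
  have -> : e = e / 3 + e / 3 + e / 3 by field.
  set a := beta (- t) z in close *; set b := beta (- x) z in close hN.
  apply: le_trans (nrm_trans (sigma b) _ _) _; apply: lerD; last first.
    by rewrite nrmC -rmorphB; apply: le_trans (sigma_le _) (ltW close).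
  apply: le_trans (nrm_trans (Ad (u n) b) _ _) _; apply: lerD; last exact: ltW (hN _ Nn).
  have -> : Ad (u n) a - Ad (u n) b = u n * (a - b) * star (u n).
    by rewrite /Ad mulrBr mulrBl.
  apply: le_trans (nrm_mul _ _) _; rewrite nrm_star nrm_u mulr1.
  by apply: le_trans (nrm_mul _ _) _; rewrite nrm_u mul1r ltW.
exists N => n t Nn ht; apply: hN => //; by rewrite /inI /= -ler_norml.
Qed.

(** As sigma commutes with the flow, the integrand is beta_t applied to u_n^* times the defect of
    [Ad (u n)] at beta_(-t) z, which is uniformly small for |t| <= L; the kernel takes care of
    larger |t|. *)
Lemma smooth_intertwines k (w : nat -> B) z :
  (forall n, smooth c k.+1 beta (star (u n)) (w n)) ->
  cvs (fun n => z * w n - w n * sigma z) 0.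
Proof.
move=> hw e e0.
have [F1 hF1] := ker_line_int c 0; have [F hF] := ker_line_int c k.+1.
pose K := `|complex.Re F| + `|complex.Re F1| * (2 * nrm z) + 1.
have K0 : 0 < K by rewrite ltr_wpDl// addr_ge0// mulr_ge0// mulr_ge0 ?nrm_ge0.
pose e1 := e / (2 * K); have e10 : 0 < e1 by rewrite divr_gt0// mulr_gt0.
(* Then e1 L >= c^2 + 1 and L >= 1, so that [ker c 1] is at most e1 at L. *)
pose L := (c ^+ 2 + 1) / e1 + 1.
have c0 : 0 < c ^+ 2 + 1 by rewrite ltr_wpDl ?sqr_ge0.
have L1 : 1 <= L by rewrite lerDr divr_ge0// ltW.
have kL : ker c 1 L <= e1.
  rewrite /ker expr1 ler_pdivrMr ?ker_den_gt0//.
  apply: le_trans (_ : e1 * L <= _).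
    by rewrite /L mulrDr mulrC divfK ?lt0r_neq0// mulr1 lerDl ltW.
  by rewrite ler_wpM2l ?(ltW e10)//; have := sqr_ge0 L; nra.
have L0 : 0 <= L by lra.
have [N hN] := ad_uniform z e10 L0.
exists N => n Nn; rewrite subr0.
have hint : is_line_int (fun t => (ker c k.+2 t)%:C *:
    (z * beta t (star (u n)) - beta t (star (u n)) * sigma z)) (z * w n - w n * sigma z).
  have := @line_int_map R B B (fun x => z * x - x * sigma z) (nrm z + nrm z) _ _ _ _ (hw n).
  move=> h; apply: line_int_ext (h _ _) => [t|a x y|x] /=.
  - by rewrite -scalerAr -scalerAl scalerBr.
  - rewrite mulrDr mulrDl -scalerAr -scalerAl scalerBr opprD addrACA.
    by congr (_ + _); rewrite scalerBr.
  - apply: le_trans (nrmB _ _) _; rewrite mulrDl; apply: lerD; first exact: nrm_mul.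
    by apply: le_trans (nrm_mul _ _) _; rewrite mulrC ler_wpM2r ?nrm_ge0.
have pointwise t : nrm (z * beta t (star (u n)) - beta t (star (u n)) * sigma z) <=
    nrm (Ad (u n) (beta (- t) z) - sigma (beta (- t) z)).
  set x := beta (- t) z.
  have zx : z = beta t x by rewrite /x -flowD subrr flow0.
  have -> : z * beta t (star (u n)) - beta t (star (u n)) * sigma z =
      beta t (star (u n) * (Ad (u n) x - sigma x)).
    rewrite mulrBr rmorphB !rmorphM /= [in LHS]zx flip_flow_comm; congr (_ - _).
    rewrite -!rmorphM /Ad !mulrA; case: (u_unitary n) => -> _.
    by rewrite mul1r.
  apply: le_trans (flow_contractive _ _ _) _.
  by apply: le_trans (nrm_mul _ _) _; rewrite nrm_star nrm_u mul1r.
apply: le_lt_trans (weighted_small (e := e1) (M := 2 * nrm z) (r := e1) (L := L) hint hF hF1 _ _ _ _ _) _.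
- exact: ltW.
- exact: ltW.
- by move=> t ht; apply: le_trans (pointwise t) _; apply: hN.
- move=> t; apply: le_trans (nrmB _ _) _; rewrite mulr_natl mulr2n; apply: lerD.
    apply: le_trans (nrm_mul _ _) _; rewrite ler_piMr ?nrm_ge0//.
    by apply: le_trans (flow_contractive _ _ _) _; rewrite nrm_star nrm_u.
  apply: le_trans (nrm_mul _ _) _; rewrite -[leRHS]mul1r; apply: ler_pM; rewrite ?nrm_ge0//.
  by apply: le_trans (flow_contractive _ _ _) _; rewrite nrm_star nrm_u.
- move=> t Lt; rewrite kerX exprSr.
  apply: ler_wpM2r; first by rewrite ltW// ker_gt0.
  apply: le_trans kL; apply: le_trans (_ : ker c 1 t <= _).
    rewrite exprS ler_piMr ?(ltW (ker_gt0 _ _ _))//.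
    by rewrite exprn_ile1 ?(ltW (ker_gt0 _ _ _))// ker1_le1.
  by apply: ker1_antitone; rewrite (ger0_norm L0) ltW.
apply: le_lt_trans (_ : e1 * K < _); last first.
  have -> : e1 * K = e / 2 by rewrite /e1; field; rewrite lt0r_neq0.
  by rewrite ltr_pdivrMr// ltr_pMr// ltr1n.
have := ler_norm (complex.Re F); have := ler_norm (complex.Re F1) => h1 h2.
rewrite /K; have : nrm z * complex.Re F1 <= nrm z * `|complex.Re F1| by rewrite ler_wpM2l ?nrm_ge0.
nra.
Qed.

Lemma kms_domination : exists K : R, forall w1 w2 : A -> C,
  KMS alpha c w1 -> KMS alpha c w2 -> forall a, sqnorm w2 a <= K * sqnorm w1 a.
Proof.
have e4 : 0 < (4^-1 : R) by rewrite invr_gt0.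
have [d d0 hd] := equicontinuous_modulus e4.
have [k [F [F1 [r [hF hF1 F0 hr [r0 hker]]]]]] := ker_concentrates c d0.
have [m hm] := mass_exists c k.+1.
set f := complex.Re F in F0 hr; set mm := complex.Re m.
have [w hw] := choice (fun n => smooth_exists c k.+1 beta (star (u n))).
have [w' hw'] := choice (fun n => smooth_shift_exists c k.+1 beta (star (u n))).
have w_le n : nrm (w n) <= mm.
  have := line_int_mass_bound (@nrm_ker_le _ c k.+1) (hw n) hm.
  by rewrite nrm_star nrm_u mulr1.
have w'_le n : nrm (w' n) <= mm.
  have := line_int_mass_bound (@nrm_kerc_shift_le _ c k.+1) (hw' n) hm.
  by rewrite nrm_star nrm_u mulr1.
(* F is the total mass of the kernel. Modulus 1/4 for |t| <= d gives f / 4, and the tail gives at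
   most another f / 4. *)
have w_close n : nrm (w n - (F : C) *: star (u n)) <= f / 2.
  have hFu : is_line_int (fun t => (ker c k.+2 t)%:C *: star (u n)) ((F : C) *: star (u n)).
    apply: (@line_int_map R C^o B (fun z => (z : C) *: star (u n)) 1 _ _ _ _ hF) => [a x y|x].
      by rewrite scalerDl scalerA.
    by rewrite nrmZ nrm_star nrm_u mulr1 mul1r.
  have hint : is_line_int (fun t => (ker c k.+2 t)%:C *: (beta t (star (u n)) - star (u n)))
      (w n - (F : C) *: star (u n)).
    have := line_int_lin (-1) hFu (hw n); rewrite scaleN1r addrC => h.
    by apply: line_int_ext h => t; rewrite scaleN1r scalerBr addrC.
  apply: le_trans (weighted_small (e := 4^-1) (M := 2) (r := r) (L := d) hint hF hF1 _ _ _ _ _) _ => //.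
  - by move=> t ht; exact: hd.
  - move=> t; apply: le_trans (nrmB _ _) _.
    by have := flow_contractive beta t (star (u n)); rewrite !nrm_star nrm_u; lra.
  - by rewrite -/f; lra.
(* Both [mm] and [f] are fixed before the states, which is the uniformity that
   [KMS_unique_of_domination] requires. *)
exists (8 * mm ^+ 2 / f ^+ 2) => w1 w2 w1K w2K a.
have [w1S _] := w1K; have [w2S _] := w2K.
have [phi [phiS phi_tens]] := product_state tensP uhf w1S w2S.
have [pl pp p1] := phiS.
(* The 8 is 2 * 2 * 2: two parallelogram inequalities, and half of the left side absorbed in
   [h2]. *)
have main z n : f ^+ 2 * sqnorm phi z <= 8 * mm ^+ 2 * sqnorm phi (sigma z) +
    8 * nrm (star z * w n - w n * sigma (star z)) ^+ 2.
  pose v := star (w n).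
  have hv : sqnorm phi (sigma z * v) <= mm ^+ 2 * sqnorm phi (sigma z).
    apply: le_trans (sqnorm_mulr_le pl pp (w' := w' n) _ _) _.
      move=> x; rewrite /v starK.
      exact: (partner tensP flowP w1K w2K phiS phi_tens (hw n) (hw' n)).
    apply: ler_wpM2r; first exact: sqnorm_ge0.
    apply: le_trans (nrm_mul _ _) _; rewrite expr2 /v nrm_star.
    by apply: ler_pM; rewrite ?nrm_ge0.
  have e_le : sqnorm phi (v * z - sigma z * v) <=
      nrm (star z * w n - w n * sigma (star z)) ^+ 2.
    apply: le_trans (state_sqnorm_le phiS _) _; rewrite -[leLHS]/(_ ^+ 2).
    rewrite -(nrm_star (v * z - _)) starB !starM /v starK.
    by case: flipP => -[_ ->] _.
  have h1 : sqnorm phi (v * z) <= 2 * sqnorm phi (sigma z * v) +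
      2 * sqnorm phi (v * z - sigma z * v).
    by have := sqnorm_parallelogram pl pp (sigma z * v) (v * z - sigma z * v); rewrite addrC subrK.
  (* Left multiplication by F^* u_n scales the seminorm exactly by |F| >= f, and v differs from F^*
     u_n by at most f / 2. *)
  have h2 : f ^+ 2 * sqnorm phi z <= 2 * sqnorm phi (v * z) + f ^+ 2 / 2 * sqnorm phi z.
    pose g := F^* *: u n - v.
    have hg : sqnorm phi (g * z) <= (f / 2) ^+ 2 * sqnorm phi z.
      apply: le_trans (sqnorm_mul pl pp _ _) _; apply: ler_wpM2r; first exact: sqnorm_ge0.
      rewrite lerXn2r ?nnegrE ?nrm_ge0 ?divr_ge0 ?(ltW F0)//.
      rewrite -nrm_star /g starB starZ conjCK /v starK nrmC; exact: w_close.
    have := sqnorm_parallelogram pl pp (v * z) (g * z).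
    rewrite -mulrDl /g addrC subrK -scalerAl.
    have -> : sqnorm phi (F^* *: (u n * z)) = nrm (F : C) ^+ 2 * sqnorm phi z.
      apply: complexI; rewrite rmorphM /= -!sqnormE// starZ starM -scalerAl -scalerAr scalerA.
      have -> : star z * star (u n) * (u n * z) = star z * z.
        by rewrite mulrA -(mulrA (star z)); case: (u_unitary n) => -> _; rewrite mulr1.
      by rewrite (functZ pl) conjCK -nrm_sqr (mulrC (F : C)).
    have Ff : f ^+ 2 <= nrm (F : C) ^+ 2.
      by rewrite lerXn2r ?nnegrE ?nrm_ge0 ?(ltW F0)// Re_le_nrm.
    have := ler_wpM2r (sqnorm_ge0 pp z) Ff; rewrite expr_div_n in hg.
    move: hg; rewrite /g => hg; lra.
  lra.
have key z : f ^+ 2 * sqnorm phi z <= 8 * mm ^+ 2 * sqnorm phi (sigma z).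
  apply/ler_addgt0Pr => e e0.
  (* The minimum with 1 makes the square of the error at most e / 8 too. *)
  have [|N hN] := smooth_intertwines (star z) hw (e := Num.min 1 (e / 8)).
    by rewrite lt_min ltr01 divr_gt0.
  have := hN N (leqnn _); rewrite subr0 lt_min => /andP[n1 n2].
  apply: le_trans (main z N) _; rewrite lerD2l.
  have : nrm (star z * w N - w N * sigma (star z)) ^+ 2 <= e / 8.
    apply: le_trans (ltW n2); rewrite expr2 ler_piMr ?nrm_ge0// ltW//.
  lra.
have q1 : sqnorm phi (tens 1 a) = sqnorm w2 a.
  rewrite /sqnorm (tensor_star tensP) (tensorM tensP) star1 mul1r phi_tens.
  by case: w1S => _ _ ->; rewrite mul1r.
have q2 : sqnorm phi (sigma (tens 1 a)) = sqnorm w1 a.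
  case: flipP => _ ->; rewrite /sqnorm (tensor_star tensP) (tensorM tensP) star1 mul1r phi_tens.
  by case: w2S => _ _ ->; rewrite mulr1.
have := key (tens 1 a); rewrite q1 q2 => h.
by rewrite mulrAC ler_pdivlMr ?exprn_gt0// mulrC.
Qed.
End Domination.

(** * Affine combinations of KMS states and uniqueness *)

Section KMSConvexity.
Variables (R : realType) (A : cstarAlgType R) (alpha : flow A) (c : R).
Local Notation C := R[i].

(** Being a state is a hypothesis instead of convexity of the coefficients, because the
    extrapolations have a negative one. *)
Lemma KMS_comb (w1 w2 : A -> C) (a b : C) : KMS alpha c w1 -> KMS alpha c w2 ->
  state (fun x => a * w1 x + b * w2 x) -> KMS alpha c (fun x => a * w1 x + b * w2 x).
Proof.
move=> [_ h1] [_ h2] hS; split=> //; move: h1 h2; case: ifP => _ h1 h2 x y.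
  by rewrite h1 h2.
have [F1 [[M1 b1] c1 d1 e10 e11]] := h1 x y; have [F2 [[M2 b2] c2 d2 e20 e21]] := h2 x y.
exists (fun z => a * F1 z + b * F2 z); split.
- exists (nrm a * M1 + nrm b * M2) => z hz; rewrite nrmE lecR.
  apply: le_trans (nrmD _ _) _; rewrite !nrmM.
  have := b1 z hz; have := b2 z hz; rewrite !nrmE !lecR => k2 k1.
  by apply: lerD; rewrite ler_wpM2l ?nrm_ge0.
- move=> z; apply: (@cvgD _ C^o).
    by apply: (@cvgM C); [exact: cvg_cst|exact: c1].
  by apply: (@cvgM C); [exact: cvg_cst|exact: c2].
- move=> z hz; apply: (@derivableD C C^o C^o).
    by apply: (@derivableM C C^o); [exact: derivable_cst|exact: d1].
  by apply: (@derivableM C C^o); [exact: derivable_cst|exact: d2].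
- by move=> t; rewrite e10 e20.
- by move=> t; rewrite e11 e21.
Qed.

(** Polarization at 1 + b x, where b = 1 and b = i recover the real and the imaginary part of the
    value at x. *)
Lemma sqnorm_state_eq (w1 w2 : A -> C) : state w1 -> state w2 ->
  (forall a, sqnorm w1 a = sqnorm w2 a) -> w1 = w2.
Proof.
move=> [l1 p1 u1] [l2 p2 u2] h; apply: funext => x.
have e (b : C) : b * w1 x + b^* * (w1 x)^* = b * w2 x + b^* * (w2 x)^*.
  have := sqnormDr l1 p1 1 x b; have := sqnormDr l2 p2 1 x b.
  rewrite !h star1 mul1r => -> k.
  apply: (addrI (sqnorm w2 1)%:C); apply: (addIr (b^* * b * (sqnorm w2 x)%:C)).
  by rewrite !addrA.
have e1 := e 1; have ei := e 'i.
rewrite rmorph1 !mul1r in e1; rewrite conjCi in ei.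
have ei' : w1 x - (w1 x)^* = w2 x - (w2 x)^*.
  have i0 : ('i : C) != 0 by apply: neq0Ci.
  by apply: (mulfI i0); rewrite !mulrBr -!mulNr.
have two : (2 : C) != 0 by rewrite pnatr_eq0.
apply: (mulfI two).
have -> : 2 * w1 x = (w1 x + (w1 x)^*) + (w1 x - (w1 x)^*) by ring.
by rewrite e1 ei'; ring.
Qed.

(* If all KMS states dominate each other up to a common factor, that factor can be improved
   by applying the domination to extrapolations ((1 + e) w1 - w2) / e, which are again KMS. *)
Lemma KMS_unique_of_domination (K : R) :
  (forall w1 w2 : A -> C, KMS alpha c w1 -> KMS alpha c w2 ->
    forall a, sqnorm w2 a <= K * sqnorm w1 a) ->
  forall w1 w2 : A -> C, KMS alpha c w1 -> KMS alpha c w2 -> w1 = w2.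
Proof.
move=> hK.
pose P (e : R) := forall w1 w2 : A -> C, KMS alpha c w1 -> KMS alpha c w2 ->
  forall a, sqnorm w2 a <= (1 + e) * sqnorm w1 a.
have q0 (w : A -> C) a : KMS alpha c w -> 0 <= sqnorm w a.
  by move=> [[_ p _] _]; exact: sqnorm_ge0.
have P0 : P `|K|.
  move=> w1 w2 h1 h2 a; apply: le_trans (hK _ _ h1 h2 a) _.
  by apply: ler_wpM2r; rewrite ?q0// (le_trans (ler_norm _))// lerDr.
have half e : 0 < e -> P e -> P (e / 2).
  move=> e0 Pe w1 w2 h1 h2 a.
  pose a1 : C := ((1 + e) / e)%:C; pose a2 : C := (- e^-1)%:C.
  (* Its positivity is exactly [P e] for w1 and w2. *)
  pose w3 x := a1 * w1 x + a2 * w2 x.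
  have sq x : w3 (star x * x) = ((1 + e) / e * sqnorm w1 x - e^-1 * sqnorm w2 x)%:C.
    have [[_ p1 _] _] := h1; have [[_ p2 _] _] := h2.
    rewrite /w3 /a1 /a2 (sqnormE p1) (sqnormE p2) rmorphB !rmorphM /= rmorphN mulNr.
    by [].
  have w3S : state w3.
    have [[l1 _ u1] _] := h1; have [[l2 _ u2] _] := h2; split.
    - by move=> b x y; rewrite /w3 l1 l2; ring.
    - move=> x; rewrite sq ler0c -mulrAC -[e^-1 * _]mulrC -mulrBl.
      by rewrite divr_ge0 ?(ltW e0)// subr_ge0; exact: Pe.
    - rewrite /w3 u1 u2 !mulr1 /a1 /a2 -rmorphD /=.
      have -> : (1 + e) / e - e^-1 = 1 by field; rewrite lt0r_neq0.
      exact: rmorph1.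
  have h3 := KMS_comb h1 h2 w3S.
  have := Pe _ _ h3 h2 a.
  have -> : sqnorm w3 a = (1 + e) / e * sqnorm w1 a - e^-1 * sqnorm w2 a.
    by rewrite {1}/sqnorm sq.
  have := q0 _ a h1; have := q0 _ a h2.
  set x := sqnorm w1 a; set y := sqnorm w2 a => y0 x0 h.
  (* This is y <= (1 + e) ((1 + e) x - y) / e multiplied by e. It improves the factor because (1 +
     e)^2 <= (1 + 2 e) (1 + e / 2). *)
  have h' : (1 + 2 * e) * y <= (1 + e) ^+ 2 * x.
    rewrite -subr_ge0; move: h; rewrite -subr_ge0 => /(mulr_ge0 (ltW e0)).
    by congr (0 <= _); field; rewrite lt0r_neq0.
  have e21 : 0 < 1 + 2 * e by lra.
  rewrite -(ler_pM2l e21); apply: le_trans h' _.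
  rewrite mulrA ler_wpM2r//; nra.
have Pn n : P (`|K| / 2 ^+ n).
  elim: n => [|n IH]; first by rewrite expr0 divr1.
  have -> : `|K| / 2 ^+ n.+1 = `|K| / 2 ^+ n / 2 by rewrite exprS invfM mulrA mulrAC.
  (* Halving needs e > 0, and for K = 0 the bound is already the final one. *)
  have [K0|K0] := eqVneq K 0; first by rewrite K0 normr0 !mul0r in IH *.
  by apply: half => //; rewrite divr_gt0 ?exprn_gt0// normr_gt0.
have le w1 w2 : KMS alpha c w1 -> KMS alpha c w2 -> forall a, sqnorm w2 a <= sqnorm w1 a.
  move=> h1 h2 a; apply/ler_addgt0Pr => e e0.
  have [||N hN] := @geometric_small R 2^-1 (`|K| * sqnorm w1 a) e _ _ e0.
  - by rewrite invr_ge0.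
  - by rewrite invf_lt1// ltr1n.
  apply: le_trans (Pn N _ _ h1 h2 a) _; rewrite mulrDl mul1r lerD2l.
  by rewrite mulrAC -exprVn ltW// hN.
move=> w1 w2 h1 h2; apply: sqnorm_state_eq; [by case: h1|by case: h2|].
by move=> a; apply/eqP; rewrite eq_le !le.
Qed.
End KMSConvexity.

Theorem proposition4p3 (R : realType) (A : cstarAlgType R) (alpha : flow A)
  (B : cstarAlgType R) (tens : A -> A -> B)
  (sigma : {lrmorphism B -> B}) (beta : flow B) :
  UHF A ->
  is_tensor_square tens ->
  is_flip tens sigma ->
  is_tensor_flow tens alpha beta ->
  smoothly_approx_inner beta sigma ->
  forall c : R,
    [set omega : A -> R[i] | KMS alpha c omega] !=set0 ->
    exists omega0 : A -> R[i],
      [set omega : A -> R[i] | KMS alpha c omega] = [set omega0].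
Proof.
move=> uhf tensP flipP flowP [u [uU uA uE]] c [w0 hw0].
have [K hK] := kms_domination c uhf tensP flipP flowP uU uA uE.
exists w0; apply/seteqP; split=> w /=; last by move=> ->.
by move=> hw; exact: KMS_unique_of_domination hK _ _ hw hw0.
Qed.
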